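(* Let $f\in(\mathcal{E}'(\mathbb{R}^2))^2$ be a compactly supported covector-valued distribution and let $V\subset\mathbb{R}^2$ be a nonempty open set. (1) Assume that $\operatorname{div}(f)|_V=0$. Then $X_\perp f$ vanishes on all lines intersecting $V$ if and only if $\operatorname{div}(f)=0$ (in $\mathbb{R}^2$). (2) In particular, if $\mathrm{d}f|_V=\operatorname{div}(f)|_V=0$ and both $X_1f$ and $X_\perp f$ vanish on all lines intersecting $V$, then $f=0$.
   Context: $\mathcal{E}'(\mathbb{R}^2)$ is the space of compactly supported distributions on $\mathbb{R}^2$. $f\in(\mathcal{E}'(\mathbb{R}^2))^2$ means $f=(f_1,f_2)$ with $f_1,f_2\in\mathcal{E}'(\mathbb{R}^2)$, with pairing $\langle f,\varphi\rangle=\sum_i\langle f_i,\varphi_i\rangle$. One-forms are identified with vector fields. In the sense of distributions, the exterior derivative has components $(\mathrm{d}f)_{ij}=\partial_if_j-\partial_jf_i$ (so in $\mathbb{R}^2$ it is identified with $\partial_1f_2-\partial_2f_1$), and $\operatorname{div}(f)=\partial_1f_1+\partial_2f_2$. Restrictions to $V$ are restrictions of distributions to the open set $V$. Let $\Gamma=\{(z,\theta):\theta\in S^{1},\ z\in\theta^\perp\}$ be the manifold of oriented lines in $\mathbb{R}^2$, where $(z,\theta)$ represents $t\mapsto z+t\theta$, with measure $dz\,d\theta$. The X-ray transform of a smooth compactly supported one-form $f$ is $X_1f(z,\theta)=\int_{\mathbb{R}}f(z+t\theta)\cdot\theta\,dt$, and its adjoint, acting on $\psi\in C^\infty(\Gamma)$,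 is $(X_1^*\psi)_i(x)=\int_{S^{1}}\theta_i\,\psi(x-(x\cdot\theta)\theta,\theta)\,d\theta$. For $f\in(\mathcal{E}'(\mathbb{R}^2))^2$, $X_1f\in\mathcal{E}'(\Gamma)$ is defined by $\langle X_1f,\varphi\rangle=\langle f,X_1^*\varphi\rangle$ for $\varphi\in C^\infty(\Gamma)$. The transverse ray transform is $X_\perp f=X_1(Bf)$, where $B$ is the constant matrix field $B(v_1,v_2)=(v_2,-v_1)$, i.e. $Bf=(f_2,-f_1)$. ''$X_1f$ (respectively $X_\perp f$) vanishes on all lines intersecting $V$'' means that this distribution vanishes on the open subset of $\Gamma$ consisting of the lines that meet $V$, i.e. its pairing with every $\varphi\in C_c^\infty(\Gamma)$ supported in that open subset is zero. *)

(* Defs.v *)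
From Stdlib Require Import Reals List Lra.
From Coquelicot Require Import Coquelicot.
Open Scope R_scope.

(** * Point sets *)

Definition plane : Type := (R * R)%type.

Definition closure {T : UniformSpace} (A : T -> Prop) (x : T) : Prop :=
  forall eps : posreal, exists y : T, ball x eps y /\ A y.

Definition bounded_set {T : UniformSpace} (A : T -> Prop) : Prop :=
  exists (x : T) (M : R), forall y : T, A y -> ball x M y.

(** * Smooth complex-valued functions on the plane *)

Inductive axis : Type := axis1 | axis2.

Definition coord (d : axis) (p : plane) : R :=
  match d with axis1 => fst p | axis2 => snd p end.

(* [p] with its coordinate along [d] replaced by [t] *)
Definition slice (d : axis) (p : plane) (t : R) : plane :=
  match d with axis1 => (t, snd p) | axis2 => (fst p, t) end.

Definition partial (d : axis) (phi : plane -> C) (p : plane) : C :=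
  (Derive (fun t => Re (phi (slice d p t))) (coord d p),
   Derive (fun t => Im (phi (slice d p t))) (coord d p)).

(* Higher derivatives are indexed by words of axes; for smooth functions only
   the number of occurrences of each axis matters. *)
Definition iter_partial (w : list axis) (phi : plane -> C) : plane -> C :=
  fold_right partial phi w.

(* [Derive] is total, so the existence of each further derivative is required
   explicitly. *)
Definition smooth (phi : plane -> C) : Prop :=
  forall (w : list axis) (p : plane),
    continuous (iter_partial w phi) p /\
    forall d : axis,
      ex_derive (V := C_R_NormedModule)
        (fun t => iter_partial w phi (slice d p t)) (coord d p).

Definition support (phi : plane -> C) : plane -> Prop :=
  closure (fun p : plane => phi p <> RtoC 0).

(* C_c^oo(V): the support is closed by construction, so it is compact exactly
   when it is bounded. *)
Definition test_in (V : plane -> Prop) (phi : plane -> C) : Prop :=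
  smooth phi /\ bounded_set (support phi) /\
  forall p, support phi p -> V p.

(** * Compactly supported distributions

    A distribution is a functional on all functions [plane -> C]; only its
    values on smooth functions are meaningful. *)

Definition functional : Type := (plane -> C) -> C.

(* E'(R^2), the continuous linear forms on C^oo(R^2): the topology of
   C^oo(R^2) is given by the directed seminorms
   max_{|w| <= N} sup_{|p| <= M} |D_w phi|. The bound by [K] times such a
   seminorm is phrased through an arbitrary upper bound [B] of the seminorm. *)
Definition compact_distribution (u : functional) : Prop :=
  (forall phi psi, smooth phi -> smooth psi ->
     u (fun p => (phi p + psi p)%C) = (u phi + u psi)%C) /\
  (forall (c : C) phi, smooth phi ->
     u (fun p => (c * phi p)%C) = (c * u phi)%C) /\
  (exists (N : nat) (M K : R), 0 <= M /\ 0 <= K /\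
     forall phi (B : R), smooth phi -> 0 <= B ->
       (forall w p, (length w <= N)%nat ->
          Rabs (fst p) <= M -> Rabs (snd p) <= M ->
          Cmod (iter_partial w phi p) <= B) ->
       Cmod (u phi) <= K * B).

Definition dist_zero (u : functional) : Prop :=
  forall phi, smooth phi -> u phi = RtoC 0.

Definition dist_zero_on (V : plane -> Prop) (u : functional) : Prop :=
  forall phi, test_in V phi -> u phi = RtoC 0.

Definition dist_partial (d : axis) (u : functional) : functional :=
  fun phi => (- u (partial d phi))%C.

(** * Covector-valued distributions *)

Definition vfunctional : Type := (functional * functional)%type.

Definition vcompact_distribution (f : vfunctional) : Prop :=
  compact_distribution (fst f) /\ compact_distribution (snd f).

Definition vdist_zero (f : vfunctional) : Prop :=
  dist_zero (fst f) /\ dist_zero (snd f).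

Definition pairing (f : vfunctional) (Phi : (plane -> C) * (plane -> C)) : C :=
  (fst f (fst Phi) + snd f (snd Phi))%C.

Definition divergence (f : vfunctional) : functional :=
  fun phi =>
    (dist_partial axis1 (fst f) phi + dist_partial axis2 (snd f) phi)%C.

Definition exterior_d (f : vfunctional) : functional :=
  fun phi =>
    (dist_partial axis1 (snd f) phi - dist_partial axis2 (fst f) phi)%C.

Definition rotateB (f : vfunctional) : vfunctional :=
  (snd f, fun phi => (- fst f phi)%C).

(** * The manifold of oriented lines *)

Definition dot (x y : plane) : R := fst x * fst y + snd x * snd y.

(* the line t |-> base + t * dir *)
Record line : Type := Line {
  base : plane;
  dir : plane;
  dir_unit : dot dir dir = 1;
  base_orth : dot base dir = 0
}.

Definition line_point (l : line) (t : R) : plane :=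
  (fst (base l) + t * fst (dir l), snd (base l) + t * snd (dir l)).

Definition meets (V : plane -> Prop) (l : line) : Prop :=
  exists t : R, V (line_point l t).

Definition unit_dir (a : R) : plane := (cos a, sin a).

Lemma unit_dir_unit (a : R) : dot (unit_dir a) (unit_dir a) = 1.
Proof.
  unfold dot, unit_dir; simpl.
  pose proof (sin2_cos2 a) as H; unfold Rsqr in H; lra.
Qed.

Lemma normal_orth (s a : R) : dot (s * - sin a, s * cos a) (unit_dir a) = 0.
Proof. unfold dot, unit_dir; simpl; ring. Qed.

(* (s, a) |-> (s * theta^perp, theta) with theta = (cos a, sin a): a smooth
   covering of the manifold of lines by R^2, under which the measure dz dtheta
   is ds da. *)
Definition line_of (s a : R) : line :=
  Line (s * - sin a, s * cos a) (unit_dir a) (unit_dir_unit a)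
    (normal_orth s a).

(* As a covering is a local diffeomorphism, smoothness on the manifold is
   smoothness of the pullback. *)
Definition smooth_lines (psi : line -> C) : Prop :=
  smooth (fun p => psi (line_of (fst p) (snd p))).

(* The manifold is a closed submanifold of R^2 x R^2. *)
Definition line_coords (l : line) : plane * plane := (base l, dir l).

Definition support_lines (psi : line -> C) : plane * plane -> Prop :=
  closure (fun q : plane * plane =>
             exists l, line_coords l = q /\ psi l <> RtoC 0).

Definition test_lines_in (W : line -> Prop) (psi : line -> C) : Prop :=
  smooth_lines psi /\ bounded_set (support_lines psi) /\
  forall l, support_lines psi (line_coords l) -> W l.

(** * X-ray transforms *)

Definition foot (x theta : plane) : plane :=
  (fst x - dot x theta * fst theta, snd x - dot x theta * snd theta).

Lemma foot_orth (x : plane) (a : R) : dot (foot x (unit_dir a)) (unit_dir a) = 0.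
Proof.
  pose proof (unit_dir_unit a) as H.
  set (th := unit_dir a) in *.
  replace (dot (foot x th) th) with (dot x th * (1 - dot th th))
    by (unfold foot, dot; simpl; ring).
  rewrite H; ring.
Qed.

Definition line_through (x : plane) (a : R) : line :=
  Line (foot x (unit_dir a)) (unit_dir a) (unit_dir_unit a) (foot_orth x a).

Definition X1_adjoint_comp (d : axis) (psi : line -> C) (x : plane) : C :=
  RInt (V := C_R_CompleteNormedModule)
    (fun a => (RtoC (coord d (unit_dir a)) * psi (line_through x a))%C)
    0 (2 * PI).

Definition X1_adjoint (psi : line -> C) : (plane -> C) * (plane -> C) :=
  (X1_adjoint_comp axis1 psi, X1_adjoint_comp axis2 psi).

Definition X1 (f : vfunctional) : (line -> C) -> C :=
  fun psi => pairing f (X1_adjoint psi).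

Definition Xperp (f : vfunctional) : (line -> C) -> C := X1 (rotateB f).

Definition vanishes_on_lines_meeting
    (V : plane -> Prop) (T : (line -> C) -> C) : Prop :=
  forall psi, test_lines_in (meets V) psi -> T psi = RtoC 0.

(* Main.v *)
Require Import Defs.
From Stdlib Require Import Reals List Lra Lia.
From Stdlib Require Import FunctionalExtensionality ProofIrrelevance ClassicalEpsilon.
From Coquelicot Require Import Coquelicot.
Open Scope R_scope.

(** Write [u = div f], let [(s, a)] be the signed distance to the origin and the
    angle of an oriented line, and let [X^*] be the backprojection, which
    integrates a function of lines over the lines through a point. Differentiating
    under the integral gives [Xperp f (D_s h) = - u (X^* h)] for all smooth [h]
    ([Xperp_divergence]). Since every test function [psi] is [D_s h] for a smooth
    [h], the transform vanishes when [u = 0] ([Xperp_of_div_zero]).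

    The converse is a unique continuation property of the scalar X-ray transform
    ([divergence_zero]): [u] vanishes on [V] and kills the backprojections of
    functions supported on lines meeting [V]. Fix [x0] in [V], and let [z] be the
    complex coordinate centred at [x0] and [zb] its conjugate. For [h] a bump of
    width [delta] in the distance from the line to [x0], the substitution
    [s = r sin t] shows that [X^* h] is an average of [(|z|^2 - s^2)^(-1/2)] over
    [|s| <= delta] ([ridge_average]), and all its derivatives are backprojections of
    the same kind ([iter_backproj]). As [delta] tends to 0, [u] is seen to kill all
    derivatives of [1 / |z|] ([killed_sigma]). The singularity at [x0] does no harm,
    because [u] vanishes around [x0].

    Now [1 / |z| = z^(-1/2) zb^(-1/2)], so its Wirtinger derivatives are the
    functions [|z|^(-1) z^(-a) zb^(-b)] up to factors which are products of
    half-integers, hence nonzero ([killed_diag]). This is the point where the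
    nonlocality of the transform enters. They form [1 / |z|] times the polynomials
    in [1 / z] and [1 / zb]. On compact sets avoiding [x0] the function
    [|z|^2] is a limit of polynomials in [|z|^(-2)], by a geometric series, so [u]
    also kills [1 / |z|] times the polynomials in [z] and [zb]
    ([killed_descend], [killed_all]). Polynomials are dense in the smooth functions
    ([polynomials_dense], by Bernstein approximation in each coordinate), and
    therefore [u / |z| = 0], that is [u = 0] ([unique_continuation]).

    For the second claim, [X1 f] is the transverse transform of [(- f_2, f_1)], whose
    divergence is [- d f]. Thus both [div f] and [d f] vanish on the whole plane, and
    then [f_1 + i f_2] and [f_1 - i f_2] satisfy Cauchy-Riemann equations, which
    makes them kill every monomial in [z] and [zb] ([closed_coclosed_zero]). *)

(** * Calculus of smooth functions on the plane *)

Lemma slice_coord d p : slice d p (coord d p) = p.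
Proof. now destruct d, p. Qed.

Lemma coord_slice d p t : coord d (slice d p t) = t.
Proof. now destruct d. Qed.

Lemma slice_slice d p t t' : slice d (slice d p t) t' = slice d p t'.
Proof. now destruct d. Qed.

(** [partial] is built on the total [Derive], so it cannot assert
    differentiability; this relation does. *)
Definition is_partial (d : axis) (phi : plane -> C) (p : plane) (l : C) : Prop :=
  is_derive (V := C_R_NormedModule) (fun t => phi (slice d p t)) (coord d p) l.

Lemma continuous_pair {T U W : UniformSpace} (f : T -> U) (g : T -> W) (x : T) :
  continuous f x -> continuous g x ->
  continuous (U := prod_UniformSpace U W) (fun y => (f y, g y)) x.
Proof.
  intros Hf Hg.
  apply (continuous_comp_2 f g (fun a b => (a, b)) x Hf Hg).
  apply continuous_ext with (f := fun q => q).
  - now intros [a b].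
  - apply continuous_id.
Qed.

Lemma continuous_C {T : UniformSpace} (f : T -> C) (x : T) :
  continuous (U := C_UniformSpace) f x <->
  continuous (fun y => Re (f y)) x /\ continuous (fun y => Im (f y)) x.
Proof.
  split.
  - intros H; split.
    + apply (continuous_comp f (fst : C -> R)); [exact H | apply continuous_fst].
    + apply (continuous_comp f (snd : C -> R)); [exact H | apply continuous_snd].
  - intros [H1 H2].
    apply continuous_ext with (f := fun y => (Re (f y), Im (f y))).
    + intros y; now destruct (f y).
    + now apply (continuous_pair (fun y => Re (f y)) (fun y => Im (f y))).
Qed.

Lemma continuous_Cplus {T : UniformSpace} (f g : T -> C) (x : T) :
  continuous (U := C_UniformSpace) f x -> continuous (U := C_UniformSpace) g x ->
  continuous (U := C_UniformSpace) (fun y => (f y + g y)%C) x.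
Proof.
  intros [Hf Hf']%continuous_C [Hg Hg']%continuous_C; apply continuous_C; split.
  - now apply (continuous_plus (fun y => Re (f y)) (fun y => Re (g y))).
  - now apply (continuous_plus (fun y => Im (f y)) (fun y => Im (g y))).
Qed.

Lemma continuous_Cmult {T : UniformSpace} (f g : T -> C) (x : T) :
  continuous (U := C_UniformSpace) f x -> continuous (U := C_UniformSpace) g x ->
  continuous (U := C_UniformSpace) (fun y => (f y * g y)%C) x.
Proof.
  intros [Hf Hf']%continuous_C [Hg Hg']%continuous_C; apply continuous_C; split.
  - apply (continuous_minus (fun y => Re (f y) * Re (g y)) (fun y => Im (f y) * Im (g y)));
      now apply (continuous_mult (K := R_AbsRing)).
  - apply (continuous_plus (fun y => Re (f y) * Im (g y)) (fun y => Im (f y) * Re (g y)));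
      now apply (continuous_mult (K := R_AbsRing)).
Qed.

Lemma continuous_RtoC {T : UniformSpace} (f : T -> R) (x : T) :
  continuous f x -> continuous (U := C_UniformSpace) (fun y => RtoC (f y)) x.
Proof.
  intros H; apply continuous_C; split; [exact H | apply continuous_const].
Qed.

Lemma is_derive_C (f : R -> C) (x : R) (l : C) :
  is_derive (V := C_R_NormedModule) f x l <->
  is_derive (fun t => Re (f t)) x (Re l) /\ is_derive (fun t => Im (f t)) x (Im l).
Proof.
  split.
  - intros H; split.
    + apply (filterdiff_comp f (fst : C_R_NormedModule -> R) _ fst H).
      apply filterdiff_linear, is_linear_fst.
    + apply (filterdiff_comp f (snd : C_R_NormedModule -> R) _ snd H).
      apply filterdiff_linear, is_linear_snd.
  - intros [H1 H2].
    eapply filterdiff_ext_lin.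
    apply filterdiff_ext with (f := fun t => (Re (f t), Im (f t)) : C_R_NormedModule).
    { intros t; now destruct (f t). }
    apply (filterdiff_comp_2 (fun t => Re (f t)) (fun t => Im (f t))
             (fun a b => (a, b) : C_R_NormedModule) _ _ (fun a b => (a, b) : C_R_NormedModule) H1 H2).
    + apply filterdiff_linear.
      apply is_linear_ext with (l1 := fun q : prod_NormedModule R_AbsRing R_NormedModule R_NormedModule => q);
      [now intros [a b] | apply is_linear_id].
    + intros y; destruct l; reflexivity.
Qed.

Lemma is_partial_C d phi p l :
  is_partial d phi p l <->
  is_derive (fun t => Re (phi (slice d p t))) (coord d p) (Re l) /\
  is_derive (fun t => Im (phi (slice d p t))) (coord d p) (Im l).
Proof. apply is_derive_C. Qed.

Lemma is_partial_unique d phi p l : is_partial d phi p l -> partial d phi p = l.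
Proof.
  intros [H1%is_derive_unique H2%is_derive_unique]%is_partial_C.
  destruct l; exact (f_equal2 pair H1 H2).
Qed.

Lemma partial_correct d phi p :
  ex_derive (V := C_R_NormedModule) (fun t => phi (slice d p t)) (coord d p) ->
  is_partial d phi p (partial d phi p).
Proof.
  intros [l H]; now rewrite (is_partial_unique _ _ _ _ H).
Qed.

Lemma is_partial_plus d phi psi p l m :
  is_partial d phi p l -> is_partial d psi p m ->
  is_partial d (fun q => (phi q + psi q)%C) p (l + m)%C.
Proof.
  intros H1 H2; exact (is_derive_plus _ _ _ _ _ H1 H2).
Qed.

Lemma is_partial_mult d phi psi p l m :
  is_partial d phi p l -> is_partial d psi p m ->
  is_partial d (fun q => (phi q * psi q)%C) p (l * psi p + phi p * m)%C.
Proof.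
  intros [H1 H2]%is_partial_C [H3 H4]%is_partial_C; apply is_partial_C; split.
  - pose proof (is_derive_minus _ _ _ _ _
      (is_derive_mult _ _ _ _ _ H1 H3 Rmult_comm) (is_derive_mult _ _ _ _ _ H2 H4 Rmult_comm)) as H.
    eapply is_derive_ext; [|evar_last; [exact H|]]; [reflexivity|].
    cbv beta; rewrite slice_coord; unfold Re, Im; cbn; ring.
  - pose proof (is_derive_plus _ _ _ _ _
      (is_derive_mult _ _ _ _ _ H1 H4 Rmult_comm) (is_derive_mult _ _ _ _ _ H2 H3 Rmult_comm)) as H.
    eapply is_derive_ext; [|evar_last; [exact H|]]; [reflexivity|].
    cbv beta; rewrite slice_coord; unfold Re, Im; cbn; ring.
Qed.

Lemma is_partial_const d c p : is_partial d (fun _ => c) p (RtoC 0).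
Proof. exact (is_derive_const (V := C_R_NormedModule) c (coord d p)). Qed.

Lemma iter_partial_snoc w d phi :
  iter_partial (w ++ d :: nil) phi = iter_partial w (partial d phi).
Proof. unfold iter_partial; now rewrite fold_right_app. Qed.

Lemma repeat_snoc {T : Type} (x : T) k : repeat x (S k) = repeat x k ++ x :: nil.
Proof. induction k; simpl in *; [reflexivity | now rewrite <- IHk]. Qed.

Lemma iter_partial_app w w' phi :
  iter_partial (w ++ w') phi = iter_partial w (iter_partial w' phi).
Proof. unfold iter_partial; now rewrite fold_right_app. Qed.

Lemma iter_partial_repeat_S d k phi :
  iter_partial (repeat d (S k)) phi = iter_partial (repeat d k) (partial d phi).
Proof. now rewrite repeat_snoc, iter_partial_snoc. Qed.

Inductive generated (Q : (plane -> C) -> Prop) : (plane -> C) -> Prop :=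
| generated_in phi : Q phi -> generated Q phi
| generated_plus phi psi : generated Q phi -> generated Q psi -> generated Q (fun p => (phi p + psi p)%C)
| generated_mult phi psi : generated Q phi -> generated Q psi -> generated Q (fun p => (phi p * psi p)%C).

(** Smoothness by coinduction: by Leibniz' rule the first derivatives of the
    generators decide whether the algebra they generate is stable under
    differentiation, and then all derivatives exist and are continuous. Every
    smoothness proof below chooses a suitable class of generators. *)
Lemma smooth_generated (Q : (plane -> C) -> Prop) :
  (forall phi, Q phi -> (forall p, continuous phi p) /\
     forall d, exists psi, generated Q psi /\ forall p, is_partial d phi p (psi p)) ->
  forall phi, generated Q phi -> smooth phi.
Proof.
  intros HQ.
  assert (Hg : forall phi, generated Q phi -> (forall p, continuous (U := C_UniformSpace) phi p) /\
     forall d, exists psi, generated Q psi /\ forall p, is_partial d phi p (psi p)).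
  { induction 1 as [phi H | phi psi _ [C1 D1] _ [C2 D2] | phi psi G1 [C1 D1] G2 [C2 D2]].
    - now apply HQ.
    - split.
      + intros p; now apply continuous_Cplus.
      + intros d; destruct (D1 d) as (f & Hf & Df), (D2 d) as (g & Hg & Dg).
        exists (fun p => (f p + g p)%C); split; [now constructor|].
        intros p; now apply is_partial_plus.
    - split.
      + intros p; now apply continuous_Cmult.
      + intros d; destruct (D1 d) as (f & Hf & Df), (D2 d) as (g & Hg & Dg).
        exists (fun p => (f p * psi p + phi p * g p)%C); split.
        * apply generated_plus; now apply generated_mult.
        * intros p; now apply is_partial_mult. }
  intros phi Hphi w; revert phi Hphi.
  induction w as [|d w IH] using rev_ind; intros phi Hphi p.
  - simpl; destruct (Hg phi Hphi) as [Hc Hd]; split; [apply Hc|].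
    intros d; destruct (Hd d) as (psi & _ & H); exists (psi p); apply H.
  - rewrite iter_partial_snoc; apply IH.
    destruct (Hg phi Hphi) as [_ Hd]; destruct (Hd d) as (psi & G & H).
    replace (partial d phi) with psi; [exact G|].
    apply functional_extensionality; intros q; symmetry; now apply is_partial_unique.
Qed.

Lemma smooth_continuous phi p : smooth phi -> continuous (U := C_UniformSpace) phi p.
Proof. intros H; exact (proj1 (H nil p)). Qed.

Lemma smooth_is_partial d phi p : smooth phi -> is_partial d phi p (partial d phi p).
Proof. intros H; apply partial_correct, (proj2 (H nil p)). Qed.

Lemma smooth_partial d phi : smooth phi -> smooth (partial d phi).
Proof.
  intros H w p; rewrite <- iter_partial_snoc; apply H.
Qed.

Lemma smooth_iter w phi : smooth phi -> smooth (iter_partial w phi).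
Proof. induction w; simpl; auto using smooth_partial. Qed.

Lemma generated_smooth phi : generated smooth phi -> smooth phi.
Proof.
  apply smooth_generated; intros psi H; split.
  - intros p; now apply smooth_continuous.
  - intros d; exists (partial d psi); split.
    + now apply generated_in, smooth_partial.
    + intros p; now apply smooth_is_partial.
Qed.

Lemma smooth_plus phi psi :
  smooth phi -> smooth psi -> smooth (fun p => (phi p + psi p)%C).
Proof. intros; apply generated_smooth; apply generated_plus; now apply generated_in. Qed.

Lemma smooth_mult phi psi :
  smooth phi -> smooth psi -> smooth (fun p => (phi p * psi p)%C).
Proof. intros; apply generated_smooth; apply generated_mult; now apply generated_in. Qed.

Lemma smooth_const c : smooth (fun _ => c).
Proof.
  apply (smooth_generated (fun phi => exists c, phi = fun _ => c)).
  - intros phi [c' ->]; split.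
    + intros p; apply continuous_const.
    + intros d; exists (fun _ => RtoC 0); split; [apply generated_in; now exists (RtoC 0)|].
      intros p; apply is_partial_const.
  - apply generated_in; now exists c.
Qed.

Lemma smooth_scal c phi : smooth phi -> smooth (fun p => (c * phi p)%C).
Proof. intros; now apply smooth_mult; [apply smooth_const|]. Qed.

Lemma smooth_ext phi psi : (forall p, phi p = psi p) -> smooth phi -> smooth psi.
Proof. intros H; now rewrite (functional_extensionality _ _ H). Qed.

Lemma smooth_opp phi : smooth phi -> smooth (fun p => (- phi p)%C).
Proof.
  intros H; apply smooth_ext with (fun p => (- RtoC 1 * phi p)%C).
  - intros p; ring.
  - now apply smooth_scal.
Qed.

Lemma smooth_minus phi psi :
  smooth phi -> smooth psi -> smooth (fun p => (phi p - psi p)%C).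
Proof. intros; unfold Cminus; auto using smooth_plus, smooth_opp. Qed.

Lemma smooth_pow phi n : smooth phi -> smooth (fun p => (phi p ^ n)%C).
Proof.
  intros H; induction n; simpl; [apply smooth_const | now apply smooth_mult].
Qed.

Definition kron (d d' : axis) : R :=
  match d, d' with axis1, axis1 | axis2, axis2 => 1 | _, _ => 0 end.

Lemma is_partial_coord d d' p :
  is_partial d (fun q => RtoC (coord d' q)) p (RtoC (kron d d')).
Proof.
  apply is_partial_C; simpl; split.
  - destruct d, d'; simpl;
      first [exact (is_derive_id (K := R_AbsRing) _)
            | exact (is_derive_const (K := R_AbsRing) (V := R_NormedModule) _ _)].
  - exact (is_derive_const (K := R_AbsRing) (V := R_NormedModule) _ _).
Qed.

Lemma continuous_coord d p : continuous (coord d) p.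
Proof. destruct d; [apply continuous_fst | apply continuous_snd]. Qed.

Lemma smooth_coord d : smooth (fun p => RtoC (coord d p)).
Proof.
  apply (smooth_generated (fun phi => (exists d, phi = fun p => RtoC (coord d p)) \/ smooth phi)).
  - intros phi [[d' ->]|H]; split.
    + intros p; apply continuous_RtoC, continuous_coord.
    + intros d''; exists (fun _ => RtoC (kron d'' d')); split.
      * apply generated_in; right; apply smooth_const.
      * intros p; apply is_partial_coord.
    + intros p; now apply smooth_continuous.
    + intros d''; exists (partial d'' phi); split.
      * apply generated_in; right; now apply smooth_partial.
      * intros p; now apply smooth_is_partial.
  - apply generated_in; left; now exists d.
Qed.

Lemma partial_plus d phi psi : smooth phi -> smooth psi ->
  partial d (fun p => (phi p + psi p)%C) = (fun p => (partial d phi p + partial d psi p)%C).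
Proof.
  intros; apply functional_extensionality; intros p.
  apply is_partial_unique, is_partial_plus; now apply smooth_is_partial.
Qed.

Lemma partial_mult d phi psi : smooth phi -> smooth psi ->
  partial d (fun p => (phi p * psi p)%C) =
  (fun p => (partial d phi p * psi p + phi p * partial d psi p)%C).
Proof.
  intros; apply functional_extensionality; intros p.
  apply is_partial_unique, is_partial_mult; now apply smooth_is_partial.
Qed.

Lemma partial_const d c : partial d (fun _ => c) = (fun _ => RtoC 0).
Proof.
  apply functional_extensionality; intros p; apply is_partial_unique, is_partial_const.
Qed.

Lemma iter_partial_zero w : iter_partial w (fun _ => RtoC 0) = fun _ => RtoC 0.
Proof. induction w as [|d w IH]; simpl; [reflexivity | now rewrite IH, partial_const]. Qed.

Lemma partial_scal d c phi : smooth phi ->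
  partial d (fun p => (c * phi p)%C) = (fun p => (c * partial d phi p)%C).
Proof.
  intros H; rewrite (partial_mult d (fun _ => c) phi) by (auto using smooth_const).
  rewrite partial_const; apply functional_extensionality; intros p; ring.
Qed.

Lemma partial_coord d d' :
  partial d (fun p => RtoC (coord d' p)) = (fun _ => RtoC (kron d d')).
Proof.
  apply functional_extensionality; intros p; apply is_partial_unique, is_partial_coord.
Qed.

Lemma partial_coord_pow d k :
  partial d (fun p => (RtoC (coord d p) ^ S k)%C) =
  fun p => (RtoC (INR (S k)) * RtoC (coord d p) ^ k)%C.
Proof.
  induction k as [|k IH].
  - replace (fun p => (RtoC (coord d p) ^ 1)%C) with (fun p => RtoC (coord d p))
      by (apply functional_extensionality; intros; simpl; ring).
    rewrite partial_coord; apply functional_extensionality; intros p; destruct d; simpl; ring.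
  - change (fun p => (RtoC (coord d p) ^ S (S k))%C)
      with (fun p => (RtoC (coord d p) * RtoC (coord d p) ^ S k)%C).
    rewrite (partial_mult d (fun p => RtoC (coord d p)) (fun p => (RtoC (coord d p) ^ S k)%C)
      (smooth_coord d) (smooth_pow _ (S k) (smooth_coord d))).
    rewrite IH, partial_coord; apply functional_extensionality; intros p.
    rewrite (S_INR (S k)), RtoC_plus.
    replace (kron d d) with 1 by now destruct d.
    simpl Cpow; ring.
Qed.

Lemma iter_partial_plus w phi psi : smooth phi -> smooth psi ->
  iter_partial w (fun p => (phi p + psi p)%C) =
  (fun p => (iter_partial w phi p + iter_partial w psi p)%C).
Proof.
  intros H1 H2; induction w as [|d w IH]; simpl; [reflexivity|].
  rewrite IH; apply partial_plus; now apply smooth_iter.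
Qed.

Lemma iter_partial_scal w c phi : smooth phi ->
  iter_partial w (fun p => (c * phi p)%C) = (fun p => (c * iter_partial w phi p)%C).
Proof.
  intros H1; induction w as [|d w IH]; simpl; [reflexivity|].
  rewrite IH; apply partial_scal; now apply smooth_iter.
Qed.

Lemma minus_as_scal (phi psi : plane -> C) :
  (fun p => (phi p - psi p)%C) = (fun p => (phi p + - RtoC 1 * psi p)%C).
Proof. apply functional_extensionality; intros p; ring. Qed.

Lemma iter_partial_minus w phi psi : smooth phi -> smooth psi ->
  iter_partial w (fun p => (phi p - psi p)%C) =
  (fun p => (iter_partial w phi p - iter_partial w psi p)%C).
Proof.
  intros H1 H2; rewrite minus_as_scal, iter_partial_plus, iter_partial_scal;
    auto using smooth_scal.
  now rewrite <- minus_as_scal.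
Qed.

Lemma iter_partial_local (U : plane -> Prop) phi psi : open U ->
  (forall p, U p -> phi p = psi p) ->
  forall w p, U p -> iter_partial w phi p = iter_partial w psi p.
Proof.
  intros HU H w; induction w as [|d w IH]; simpl; [exact H|].
  intros p Hp; unfold partial.
  assert (L : locally (coord d p) (fun t => U (slice d p t))).
  { apply (continuous_comp (fun t => slice d p t) (fun q => q)).
    - destruct d; simpl; apply continuous_pair;
        first [apply continuous_id | apply continuous_const].
    - apply continuous_id.
    - rewrite slice_coord; now apply HU. }
  f_equal; apply Derive_ext_loc; revert L; apply filter_imp; intros t Ht; now rewrite (IH _ Ht).
Qed.

(** * Bounds on squares *)

Definition box (M : R) (p : plane) : Prop := Rabs (fst p) <= M /\ Rabs (snd p) <= M.

(** The segment from the origin to a point of the square is walked in a fixed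
    number of steps, across each of which uniform continuity bounds the
    increment by 1. *)
Lemma continuous_bounded_real (g : plane -> R) (M : R) :
  (forall p, continuous g p) ->
  exists B, 0 <= B /\ forall p, box M p -> Rabs (g p) <= B.
Proof.
  intros Hg.
  destruct (uniform_continuity_2d (fun x y => g (x, y)) (- M) M (- M) M)
    with (eps := mkposreal 1 Rlt_0_1) as [delta Hd].
  { intros x y _ _; apply continuity_2d_pt_filterlim.
    apply filterlim_ext with (f := g); [now intros [a b] | apply Hg]. }
  destruct (archimed_cor1 (delta / (Rabs M + 1))) as (n & Hn & Hn0).
  { apply Rdiv_lt_0_compat; [apply cond_pos | pose proof (Rabs_pos M); lra]. }
  assert (Hn1 : 0 < INR n) by now apply lt_0_INR.
  exists (Rabs (g (0, 0)) + INR n); split.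
  { pose proof (Rabs_pos (g (0, 0))); lra. }
  intros [x y] [Hx Hy]; simpl in Hx, Hy.
  assert (HM : 0 <= M) by (pose proof (Rabs_pos x); lra).
  rewrite (Rabs_pos_eq M) in Hn by assumption.
  assert (Hk : forall k, (k <= n)%nat ->
    Rabs (g (x * (INR k / INR n), y * (INR k / INR n))) <= Rabs (g (0, 0)) + INR k).
  { assert (Hfr : forall k, (k <= n)%nat -> 0 <= INR k / INR n <= 1).
    { intros k Hk; apply le_INR in Hk; pose proof (pos_INR k); split.
      - apply Rdiv_le_0_compat; lra.
      - apply Rmult_le_reg_r with (INR n); [lra|]; field_simplify; lra. }
    assert (Hin : forall z k, Rabs z <= M -> (k <= n)%nat -> - M <= z * (INR k / INR n) <= M).
    { intros z k Hz Hk; specialize (Hfr k Hk).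
      apply Rabs_le_between; rewrite Rabs_mult, (Rabs_pos_eq (INR k / INR n)) by lra.
      pose proof (Rabs_pos z); nra. }
    assert (Hst : forall z k, Rabs z <= M ->
      Rabs (z * (INR (S k) / INR n) - z * (INR k / INR n)) < delta).
    { intros z k Hz; rewrite S_INR.
      replace (z * ((INR k + 1) / INR n) - z * (INR k / INR n)) with (z * / INR n) by (field; lra).
      rewrite Rabs_mult, (Rabs_pos_eq (/ INR n)) by (left; now apply Rinv_0_lt_compat).
      apply Rle_lt_trans with ((M + 1) * / INR n).
      - apply Rmult_le_compat_r; [left; now apply Rinv_0_lt_compat | lra].
      - apply Rmult_lt_compat_r with (r := M + 1) in Hn; [|lra].
        unfold Rdiv in Hn; rewrite Rmult_assoc, Rinv_l, Rmult_1_r in Hn by lra; lra. }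
    induction k as [|k IH]; intros Hk.
    - simpl; unfold Rdiv; rewrite !Rmult_0_l, !Rmult_0_r; lra.
    - specialize (IH ltac:(lia)).
      assert (Hd' := Hd _ _ _ _ (Hin x k Hx ltac:(lia)) (Hin y k Hy ltac:(lia))
        (Hin x (S k) Hx Hk) (Hin y (S k) Hy Hk) (Hst x k Hx) (Hst y k Hy)).
      cbn [pos] in Hd'; rewrite (S_INR k) in *.
      set (a := g (x * ((INR k + 1) / INR n), y * ((INR k + 1) / INR n))) in *.
      set (b := g (x * (INR k / INR n), y * (INR k / INR n))) in *.
      pose proof (Rabs_triang (a - b) b) as Ht; replace (a - b + b) with a in Ht by ring; lra. }
  specialize (Hk n (le_n n)).
  replace (INR n / INR n) with 1 in Hk by (field; lra); rewrite !Rmult_1_r in Hk; exact Hk.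
Qed.

Lemma Cmod_le_sum (c : C) : Cmod c <= Rabs (Re c) + Rabs (Im c).
Proof.
  destruct c as [a b]; simpl.
  replace ((a, b) : C) with (RtoC a + Ci * RtoC b)%C
    by (unfold RtoC, Ci, Cmult, Cplus; simpl; f_equal; ring).
  eapply Rle_trans; [apply Cmod_triangle|].
  rewrite Cmod_mult, !Cmod_R, Cmod_Ci; lra.
Qed.

Lemma Ci_sq : (Ci * Ci)%C = (- RtoC 1)%C.
Proof. unfold Ci, RtoC, Cmult, Copp; simpl; f_equal; ring. Qed.

Lemma RtoC_neq_0 x : x <> 0 -> RtoC x <> RtoC 0.
Proof. intros H E; apply H; injection E; trivial. Qed.

Lemma im_le_Cmod (c : C) : Rabs (Im c) <= Cmod c.
Proof.
  eapply Rle_trans; [|apply Rmax_Cmod]; apply Rmax_r.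
Qed.

Lemma continuous_bounded (phi : plane -> C) (M : R) :
  (forall p, continuous (U := C_UniformSpace) phi p) ->
  exists B, 0 <= B /\ forall p, box M p -> Cmod (phi p) <= B.
Proof.
  intros H.
  destruct (continuous_bounded_real (fun p => Re (phi p)) M) as (B1 & P1 & H1).
  { intros p; now apply (continuous_C phi p). }
  destruct (continuous_bounded_real (fun p => Im (phi p)) M) as (B2 & P2 & H2).
  { intros p; now apply (continuous_C phi p). }
  exists (B1 + B2); split; [lra|]; intros p Hp.
  eapply Rle_trans; [apply Cmod_le_sum|]; specialize (H1 p Hp); specialize (H2 p Hp); lra.
Qed.

(** A bound on the [C^N] norm over a square. *)
Definition jet_le (N : nat) (M B : R) (phi : plane -> C) : Prop :=
  forall w p, (length w <= N)%nat -> box M p -> Cmod (iter_partial w phi p) <= B.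

Lemma jet_le_partial N M B d phi : jet_le (S N) M B phi -> jet_le N M B (partial d phi).
Proof.
  intros H w p Hw Hp; rewrite <- iter_partial_snoc; apply H; [|exact Hp].
  rewrite length_app; simpl; lia.
Qed.

Lemma jet_le_iter N M B phi w : jet_le (N + length w) M B phi -> jet_le N M B (iter_partial w phi).
Proof.
  intros H w' p Hw Hp; rewrite <- iter_partial_app; apply H; [rewrite length_app; lia | exact Hp].
Qed.

Lemma jet_le_S N M B phi :
  (forall p, box M p -> Cmod (phi p) <= B) -> (forall d, jet_le N M B (partial d phi)) ->
  jet_le (S N) M B phi.
Proof.
  intros H0 Hd w p Hw Hp; destruct w as [|d w _] using rev_ind; [now apply H0|].
  rewrite iter_partial_snoc; rewrite length_app in Hw; simpl in Hw.
  apply Hd; [lia | exact Hp].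
Qed.

Lemma jet_le_weaken N M B N' M' B' phi : (N' <= N)%nat -> M' <= M -> B <= B' ->
  jet_le N M B phi -> jet_le N' M' B' phi.
Proof.
  intros HN HM HB H w p Hw [H1 H2]; apply Rle_trans with B; [|exact HB].
  apply H; [lia | split; lra].
Qed.

Lemma jet_le_plus N M B B' phi psi : smooth phi -> smooth psi ->
  jet_le N M B phi -> jet_le N M B' psi ->
  jet_le N M (B + B') (fun p => (phi p + psi p)%C).
Proof.
  intros S1 S2 H1 H2 w p Hw Hp; rewrite iter_partial_plus by assumption.
  eapply Rle_trans; [apply Cmod_triangle|]; apply Rplus_le_compat; auto.
Qed.

(** Leibniz' rule. The induction differentiates once before all other
    derivatives, so that the constant depends on [g] only. *)
Lemma jet_le_mult N M g : smooth g -> exists K, 0 <= K /\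
  forall phi B, smooth phi -> 0 <= B -> jet_le N M B phi ->
    jet_le N M (K * B) (fun p => (g p * phi p)%C).
Proof.
  revert g; induction N as [|N IH]; intros g Hg;
    destruct (continuous_bounded g M) as (G & G0 & HG);
    try (intros p; now apply smooth_continuous).
  - exists G; split; [exact G0|]; intros phi B _ B0 Hphi [|d w] p Hw Hp; simpl in Hw; [|lia].
    simpl; rewrite Cmod_mult; apply Rmult_le_compat; auto using Cmod_ge_0.
    now apply (Hphi nil p).
  - destruct (IH g Hg) as (K0 & P0 & H0).
    destruct (IH (partial axis1 g) (smooth_partial _ _ Hg)) as (K1 & P1 & H1).
    destruct (IH (partial axis2 g) (smooth_partial _ _ Hg)) as (K2 & P2 & H2).
    exists (G + (K0 + K1 + K2)); split; [lra|]; intros phi B Sphi B0 Hphi.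
    apply jet_le_S.
    + intros p Hp; rewrite Cmod_mult.
      apply Rle_trans with (G * B).
      * apply Rmult_le_compat; auto using Cmod_ge_0; now apply (Hphi nil p); [simpl; lia|].
      * apply Rmult_le_compat_r; lra.
    + intros d; rewrite partial_mult by assumption.
      apply jet_le_weaken with N M ((if d then K1 else K2) * B + K0 * B); auto with real.
      * destruct d; nra.
      * apply jet_le_plus; auto using smooth_mult, smooth_partial.
        -- destruct d; [apply H1 | apply H2]; auto;
             apply jet_le_weaken with (S N) M B; auto with real.
        -- apply H0; auto using smooth_partial, jet_le_partial.
Qed.

(** * Composition with functions of one variable *)

(** All derivatives at once: [h k] is the [k]-th derivative of [h 0] on
    [I]. *)
Definition chain (I : R -> Prop) (h : nat -> R -> R) : Prop :=
  forall k x, I x -> is_derive (h k) x (h (S k) x).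

Definition rsmooth (s : plane -> R) : Prop := smooth (fun p => RtoC (s p)).

Lemma is_partial_comp I h s k d p : chain I h -> rsmooth s -> I (s p) ->
  is_partial d (fun q => RtoC (h k (s q))) p
    (partial d (fun q => RtoC (s q)) p * RtoC (h (S k) (s p)))%C.
Proof.
  intros Hh Hs Hp.
  destruct (proj1 (is_partial_C _ _ _ _) (smooth_is_partial d _ p Hs)) as [H1 H2].
  cbv beta in H1, H2; cbn [Re Im fst snd RtoC] in H1, H2.
  assert (Hi : Im (partial d (fun q => RtoC (s q)) p) = 0).
  { rewrite <- (is_derive_unique _ _ _ H2). apply Derive_const. }
  set (l := partial d (fun q => RtoC (s q)) p) in *.
  apply is_partial_C; split; cbn [Re Im fst snd RtoC Cmult].
  - assert (H0 : is_derive (h k) (s (slice d p (coord d p))) (h (S k) (s p)))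
      by (rewrite slice_coord; apply Hh, Hp).
    evar_last; [exact (is_derive_comp (h k) (fun t => s (slice d p t)) _ _ _ H0 H1)|].
    cbn; unfold Re; ring.
  - unfold Im in Hi; rewrite Hi.
    evar_last; [exact (is_derive_const (K := R_AbsRing) (V := R_NormedModule) 0 _)|].
    cbn; unfold zero; cbn; ring.
Qed.

Lemma rsmooth_continuous s p : rsmooth s -> continuous s p.
Proof.
  intros H; exact (proj1 (proj1 (continuous_C _ p) (smooth_continuous _ p H))).
Qed.

Lemma rsmooth_comp I h s k : chain I h -> rsmooth s -> (forall p, I (s p)) ->
  rsmooth (fun p => h k (s p)).
Proof.
  intros Hh Hs HI; unfold rsmooth.
  apply (smooth_generated (fun phi => smooth phi \/ exists k, phi = fun p => RtoC (h k (s p)))).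
  - intros phi [H|[j ->]]; split.
    + intros p; now apply smooth_continuous.
    + intros d; exists (partial d phi); split.
      * apply generated_in; left; now apply smooth_partial.
      * intros p; now apply smooth_is_partial.
    + intros p; apply continuous_RtoC.
      apply (continuous_comp s (h j)); [now apply rsmooth_continuous|].
      apply (ex_derive_continuous (K := R_AbsRing) (V := R_NormedModule)).
      eexists; apply Hh, HI.
    + intros d; eexists; split.
      * apply generated_mult; apply generated_in; [left | right].
        -- exact (smooth_partial d _ Hs).
        -- now exists (S j).
      * intros p; now apply (is_partial_comp I).
  - apply generated_in; right; now exists k.
Qed.

Lemma rsmooth_plus f g : rsmooth f -> rsmooth g -> rsmooth (fun p => f p + g p).
Proof.
  intros Hf Hg; apply smooth_ext with (fun p => (RtoC (f p) + RtoC (g p))%C).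
  - intros p; now rewrite RtoC_plus.
  - now apply smooth_plus.
Qed.

Lemma rsmooth_mult f g : rsmooth f -> rsmooth g -> rsmooth (fun p => f p * g p).
Proof.
  intros Hf Hg; apply smooth_ext with (fun p => (RtoC (f p) * RtoC (g p))%C).
  - intros p; now rewrite RtoC_mult.
  - now apply smooth_mult.
Qed.

Lemma rsmooth_const c : rsmooth (fun _ => c).
Proof. exact (smooth_const (RtoC c)). Qed.

Lemma rsmooth_minus f g : rsmooth f -> rsmooth g -> rsmooth (fun p => f p - g p).
Proof.
  intros Hf Hg; apply smooth_ext with (fun p => (RtoC (f p) - RtoC (g p))%C).
  - intros p; now rewrite RtoC_minus.
  - now apply smooth_minus.
Qed.

(** By the chain rule the derivatives of [g * (h_m o s)] are combinations of
    the [h_k o s] whose coefficients depend on [g] and [s] only. Hence a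
    sequence of functions whose derivatives tend to 0 uniformly on the range
    of [s] remains so, in the [C^N] norm, after composition with [s]. *)
Lemma jet_le_comp I s N M g : rsmooth s -> (forall p, I (s p)) -> smooth g ->
  exists K, 0 <= K /\ forall h m B, chain I h -> 0 <= B ->
    (forall k p, (k <= m + N)%nat -> box M p -> Rabs (h k (s p)) <= B) ->
    jet_le N M (K * B) (fun p => (g p * RtoC (h m (s p)))%C).
Proof.
  intros Hs HI; revert g; induction N as [|N IH]; intros g Hg;
    destruct (continuous_bounded g M) as (G & G0 & HG);
    try (intros p; now apply smooth_continuous).
  - exists G; split; [exact G0|]; intros h m B _ B0 Hh [|d w] p Hw Hp; simpl in Hw; [|lia].
    simpl; rewrite Cmod_mult, Cmod_R; apply Rmult_le_compat; auto using Cmod_ge_0, Rabs_pos.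
    apply Hh; [lia | exact Hp].
  - destruct (IH (partial axis1 g) (smooth_partial _ _ Hg)) as (K1 & P1 & H1).
    destruct (IH (partial axis2 g) (smooth_partial _ _ Hg)) as (K2 & P2 & H2).
    assert (Sg : forall d, smooth (fun p => (g p * partial d (fun q => RtoC (s q)) p)%C)).
    { intros d; apply smooth_mult; [exact Hg | exact (smooth_partial d _ Hs)]. }
    destruct (IH _ (Sg axis1)) as (K3 & P3 & H3).
    destruct (IH _ (Sg axis2)) as (K4 & P4 & H4).
    exists (G + (K1 + K2 + K3 + K4)); split; [lra|]; intros h m B Hc B0 Hh.
    assert (Sh : forall k, smooth (fun p => RtoC (h k (s p)))).
    { intros k; now apply (rsmooth_comp I). }
    apply jet_le_S.
    + intros p Hp; rewrite Cmod_mult, Cmod_R.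
      apply Rle_trans with (G * B).
      * apply Rmult_le_compat; auto using Cmod_ge_0, Rabs_pos; apply Hh; [lia | exact Hp].
      * apply Rmult_le_compat_r; lra.
    + intros d; rewrite partial_mult by auto.
      replace (fun p => (partial d g p * RtoC (h m (s p)) +
                 g p * partial d (fun q => RtoC (h m (s q))) p)%C)
        with (fun p => (partial d g p * RtoC (h m (s p)) +
                 (g p * partial d (fun q => RtoC (s q)) p) * RtoC (h (S m) (s p)))%C).
      2:{ apply functional_extensionality; intros p.
          rewrite (is_partial_unique _ _ _ _ (is_partial_comp I h s m d p Hc Hs (HI p))); ring. }
      apply jet_le_weaken with N M ((if d then K1 else K2) * B + (if d then K3 else K4) * B);
        auto with real.
      * destruct d; nra.
      * apply jet_le_plus; auto using smooth_mult, smooth_partial.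
        -- destruct d; [apply H1 | apply H2]; auto; intros k p Hk; apply Hh; lia.
        -- destruct d; [apply H3 | apply H4]; auto; intros k p Hk; apply Hh; lia.
Qed.

(** * Compactly supported distributions *)

Section CompactDistribution.
Variable u : functional.
Hypothesis Hu : compact_distribution u.

Lemma cd_plus phi psi : smooth phi -> smooth psi ->
  u (fun p => (phi p + psi p)%C) = (u phi + u psi)%C.
Proof. apply (proj1 Hu). Qed.

Lemma cd_scal c phi : smooth phi -> u (fun p => (c * phi p)%C) = (c * u phi)%C.
Proof. apply (proj1 (proj2 Hu)). Qed.

Lemma cd_minus phi psi : smooth phi -> smooth psi ->
  u (fun p => (phi p - psi p)%C) = (u phi - u psi)%C.
Proof.
  intros H1 H2; rewrite minus_as_scal, cd_plus, cd_scal by auto using smooth_scal; ring.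
Qed.

Lemma cd_order : exists N M K, 0 <= M /\ 0 <= K /\ forall phi B, smooth phi -> 0 <= B ->
  jet_le N M B phi -> Cmod (u phi) <= K * B.
Proof.
  destruct Hu as (_ & _ & N & M & K & HM & HK & H).
  exists N, M, K; repeat split; auto; intros phi B S0 B0 HB; apply H; auto.
  intros w p Hw H1 H2; apply HB; [exact Hw | now split].
Qed.

(** Limits in the [C^N] norm of a fixed square may be taken in identities
    [u psi = 0]; [N] and the square are those of the continuity estimate. *)
Lemma cd_limit : exists N M, 0 <= M /\ forall phi, smooth phi ->
  (forall eps, 0 < eps -> exists psi, smooth psi /\ u psi = RtoC 0 /\
     jet_le N M eps (fun p => (phi p - psi p)%C)) -> u phi = RtoC 0.
Proof.
  destruct cd_order as (N & M & K & HM & HK & H).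
  exists N, M; split; [exact HM|]; intros phi Sphi Happ.
  apply Cmod_eq_0, Rle_antisym; [|apply Cmod_ge_0].
  apply le_epsilon; intros eps Heps.
  destruct (Happ (eps / (K + 1))) as (psi & Spsi & Hpsi & Hj).
  { apply Rdiv_lt_0_compat; lra. }
  rewrite Rplus_0_l; replace (u phi) with (u (fun p => (phi p - psi p)%C)).
  2:{ rewrite cd_minus, Hpsi by assumption; ring. }
  eapply Rle_trans; [apply H with (B := eps / (K + 1))|]; auto using smooth_minus.
  - left; apply Rdiv_lt_0_compat; lra.
  - apply Rmult_le_reg_r with (K + 1); [lra|]; field_simplify; [nra|lra].
Qed.

End CompactDistribution.

Lemma cd_mult u g : compact_distribution u -> smooth g ->
  compact_distribution (fun phi => u (fun p => (g p * phi p)%C)).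
Proof.
  intros Hu Hg; repeat split.
  - intros phi psi H1 H2.
    rewrite <- (cd_plus u Hu) by auto using smooth_mult.
    f_equal; apply functional_extensionality; intros p; ring.
  - intros c phi H; rewrite <- (cd_scal u Hu) by auto using smooth_mult.
    f_equal; apply functional_extensionality; intros p; ring.
  - destruct (cd_order u Hu) as (N & M & K & HM & HK & H).
    destruct (jet_le_mult N M g Hg) as (L & HL & HgL).
    exists N, M, (K * L); split; [exact HM|]; split; [nra|].
    intros phi B Sphi B0 HB; rewrite Rmult_assoc; apply H; auto using smooth_mult; [nra|].
    apply HgL; auto; intros w p Hw [Hp1 Hp2]; auto.
Qed.

Lemma cd_add_scal u v (a : C) : compact_distribution u -> compact_distribution v ->
  compact_distribution (fun phi => (u phi + a * v phi)%C).
Proof.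
  intros Hu Hv; repeat split.
  - intros; rewrite (cd_plus u), (cd_plus v) by assumption; ring.
  - intros; rewrite (cd_scal u), (cd_scal v) by assumption; ring.
  - destruct (cd_order u Hu) as (N & M & K & HM & HK & H).
    destruct (cd_order v Hv) as (N' & M' & K' & HM' & HK' & H').
    exists (Nat.max N N'), (Rmax M M'), (K + Cmod a * K'); repeat split.
    + eapply Rle_trans; [exact HM | apply Rmax_l].
    + pose proof (Cmod_ge_0 a); nra.
    + intros phi B Sphi B0 HB.
      assert (HJ : jet_le (Nat.max N N') (Rmax M M') B phi).
      { intros w p Hw [? ?]; auto. }
      eapply Rle_trans; [apply Cmod_triangle|]; rewrite Cmod_mult.
      assert (Cmod (u phi) <= K * B).
      { apply H; auto; eapply jet_le_weaken; [| | |exact HJ];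
          [apply Nat.le_max_l | apply Rmax_l | lra]. }
      assert (Cmod (v phi) <= K' * B).
      { apply H'; auto; eapply jet_le_weaken; [| | |exact HJ];
          [apply Nat.le_max_r | apply Rmax_r | lra]. }
      pose proof (Cmod_ge_0 a); nra.
Qed.

Lemma cd_dist_partial u d : compact_distribution u -> compact_distribution (dist_partial d u).
Proof.
  intros Hu; unfold dist_partial; repeat split.
  - intros; rewrite partial_plus, (cd_plus u Hu) by auto using smooth_partial; ring.
  - intros; rewrite partial_scal, (cd_scal u Hu) by auto using smooth_partial; ring.
  - destruct (cd_order u Hu) as (N & M & K & HM & HK & H).
    exists (S N), M, K; repeat split; auto; intros phi B Sphi B0 HB.
    rewrite Cmod_opp; apply H; auto using smooth_partial.
    apply jet_le_partial; intros w p Hw [? ?]; auto.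
Qed.

Lemma cd_iter u w : compact_distribution u ->
  compact_distribution (fun phi => u (iter_partial w phi)).
Proof.
  intros Hu; repeat split.
  - intros; rewrite iter_partial_plus, (cd_plus u Hu) by auto using smooth_iter; ring.
  - intros; rewrite iter_partial_scal, (cd_scal u Hu) by auto using smooth_iter; ring.
  - destruct (cd_order u Hu) as (N & M & K & HM & HK & H).
    exists (N + length w)%nat, M, K; repeat split; auto; intros phi B Sphi B0 HB.
    apply H; auto using smooth_iter.
    apply jet_le_iter; intros w' p Hw [? ?]; auto.
Qed.

Lemma cd_divergence f : vcompact_distribution f -> compact_distribution (divergence f).
Proof.
  intros [H1 H2].
  replace (divergence f) with
    (fun phi => (dist_partial axis1 (fst f) phi + RtoC 1 * dist_partial axis2 (snd f) phi)%C).
  - apply cd_add_scal; now apply cd_dist_partial.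
  - apply functional_extensionality; intros phi; unfold divergence; ring.
Qed.

(** * Mixed derivatives *)

Definition other (d : axis) : axis := match d with axis1 => axis2 | axis2 => axis1 end.

Lemma Schwarz_real (f : plane -> R) (f1 f2 f12 f21 : plane -> R) (p : plane) :
  (forall q, is_derive (fun t => f (t, snd q)) (fst q) (f1 q)) ->
  (forall q, is_derive (fun t => f (fst q, t)) (snd q) (f2 q)) ->
  (forall q, is_derive (fun t => f2 (t, snd q)) (fst q) (f12 q)) ->
  (forall q, is_derive (fun t => f1 (fst q, t)) (snd q) (f21 q)) ->
  continuous f12 p -> continuous f21 p -> f12 p = f21 p.
Proof.
  intros H1 H2 H12 H21 C12 C21; destruct p as [x y].
  assert (D1 : forall u v, Derive (fun t => f (t, v)) u = f1 (u, v)).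
  { intros u v; exact (is_derive_unique _ _ _ (H1 (u, v))). }
  assert (D2 : forall u v, Derive (fun t => f (u, t)) v = f2 (u, v)).
  { intros u v; exact (is_derive_unique _ _ _ (H2 (u, v))). }
  assert (D12 : forall u v, Derive (fun z => Derive (fun t => f (z, t)) v) u = f12 (u, v)).
  { intros u v; rewrite (Derive_ext _ (fun z => f2 (z, v))) by (intros; apply D2).
    exact (is_derive_unique _ _ _ (H12 (u, v))). }
  assert (D21 : forall u v, Derive (fun z => Derive (fun t => f (t, z)) u) v = f21 (u, v)).
  { intros u v; rewrite (Derive_ext _ (fun z => f1 (u, z))) by (intros; apply D1).
    exact (is_derive_unique _ _ _ (H21 (u, v))). }
  rewrite <- D12, <- D21; apply (Schwarz (fun u v => f (u, v))).
  - exists (mkposreal 1 Rlt_0_1); intros u v _ _; repeat split.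
    + exists (f1 (u, v)); apply (H1 (u, v)).
    + exists (f2 (u, v)); apply (H2 (u, v)).
    + exists (f12 (u, v)); apply is_derive_ext with (fun z => f2 (z, v));
        [intros; symmetry; apply D2 | apply (H12 (u, v))].
    + exists (f21 (u, v)); apply is_derive_ext with (fun z => f1 (u, z));
        [intros; symmetry; apply D1 | apply (H21 (u, v))].
  - apply continuity_2d_pt_ext with (fun u v => f12 (u, v)); [intros; symmetry; apply D12|].
    apply continuity_2d_pt_filterlim, filterlim_ext with f12; [now intros []| exact C12].
  - apply continuity_2d_pt_ext with (fun u v => f21 (u, v)); [intros; symmetry; apply D21|].
    apply continuity_2d_pt_filterlim, filterlim_ext with f21; [now intros []| exact C21].
Qed.

Lemma partial_comm phi : smooth phi ->
  partial axis1 (partial axis2 phi) = partial axis2 (partial axis1 phi).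
Proof.
  intros H; apply functional_extensionality; intros p.
  assert (HP : forall d psi, smooth psi -> forall q,
    is_derive (fun t => Re (psi (slice d q t))) (coord d q) (Re (partial d psi q)) /\
    is_derive (fun t => Im (psi (slice d q t))) (coord d q) (Im (partial d psi q))).
  { intros d psi Hpsi q; apply is_partial_C; now apply smooth_is_partial. }
  assert (HC : forall psi, smooth psi -> forall q,
    continuous (fun y => Re (psi y)) q /\ continuous (fun y => Im (psi y)) q).
  { intros psi Hpsi q; apply continuous_C; now apply smooth_continuous. }
  assert (S1 := smooth_partial axis1 _ H); assert (S2 := smooth_partial axis2 _ H).
  apply injective_projections.
  - apply (Schwarz_real (fun q => Re (phi q)) (fun q => Re (partial axis1 phi q))
      (fun q => Re (partial axis2 phi q)) (fun q => Re (partial axis1 (partial axis2 phi) q))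
      (fun q => Re (partial axis2 (partial axis1 phi) q))).
    + exact (fun q => proj1 (HP axis1 _ H q)).
    + exact (fun q => proj1 (HP axis2 _ H q)).
    + exact (fun q => proj1 (HP axis1 _ S2 q)).
    + exact (fun q => proj1 (HP axis2 _ S1 q)).
    + exact (proj1 (HC _ (smooth_partial axis1 _ S2) p)).
    + exact (proj1 (HC _ (smooth_partial axis2 _ S1) p)).
  - apply (Schwarz_real (fun q => Im (phi q)) (fun q => Im (partial axis1 phi q))
      (fun q => Im (partial axis2 phi q)) (fun q => Im (partial axis1 (partial axis2 phi) q))
      (fun q => Im (partial axis2 (partial axis1 phi) q))).
    + exact (fun q => proj2 (HP axis1 _ H q)).
    + exact (fun q => proj2 (HP axis2 _ H q)).
    + exact (fun q => proj2 (HP axis1 _ S2 q)).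
    + exact (fun q => proj2 (HP axis2 _ S1 q)).
    + exact (proj2 (HC _ (smooth_partial axis1 _ S2) p)).
    + exact (proj2 (HC _ (smooth_partial axis2 _ S1) p)).
Qed.

Lemma partial_other d phi : smooth phi ->
  partial d (partial (other d) phi) = partial (other d) (partial d phi).
Proof. intros H; destruct d; simpl; now rewrite (partial_comm phi). Qed.

Lemma partial_iter_other d l phi : smooth phi ->
  partial d (iter_partial (repeat (other d) l) phi) =
  iter_partial (repeat (other d) l) (partial d phi).
Proof.
  intros H; induction l as [|l IH]; simpl; [reflexivity|].
  rewrite <- IH; apply partial_other; now apply smooth_iter.
Qed.

Lemma axis_cases d d' : d' = d \/ d' = other d.
Proof. destruct d, d'; auto. Qed.

Lemma coord_slice_other d p t : coord d (slice (other d) p t) = coord d p.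
Proof. now destruct d. Qed.

(** Mixed derivatives commute, so a word only matters through its numbers of
    letters. *)
Lemma iter_partial_sort d w : exists k l, (k <= length w)%nat /\ (l <= length w)%nat /\
  forall phi, smooth phi ->
    iter_partial w phi = iter_partial (repeat (other d) l) (iter_partial (repeat d k) phi).
Proof.
  induction w as [|a w (k & l & Hk & Hl & H)].
  - now exists 0%nat, 0%nat.
  - destruct (axis_cases d a) as [-> | ->].
    + exists (S k), l; simpl; repeat split; try lia; intros phi Hphi.
      rewrite H by assumption; now rewrite partial_iter_other by now apply smooth_iter.
    + exists k, (S l); simpl; repeat split; try lia; intros phi Hphi.
      now rewrite H by assumption.
Qed.

(** * Freezing one coordinate *)

Definition freeze (d : axis) (c : R) (phi : plane -> C) : plane -> C :=
  fun p => phi (slice d p c).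

Lemma is_partial_freeze d c phi p l :
  is_partial (other d) phi (slice d p c) l -> is_partial (other d) (freeze d c phi) p l.
Proof. now destruct d. Qed.

Lemma is_partial_frozen d c phi p : is_partial d (freeze d c phi) p (RtoC 0).
Proof.
  unfold is_partial, freeze.
  apply (is_derive_ext (V := C_R_NormedModule) (fun _ => phi (slice d p c)));
    [intros t; now rewrite slice_slice|].
  exact (is_derive_const (V := C_R_NormedModule) _ _).
Qed.

Lemma continuous_slice d c p : continuous (fun q => slice d q c) p.
Proof.
  destruct d; simpl; apply continuous_pair;
    first [apply continuous_const | apply continuous_fst | apply continuous_snd].
Qed.

Lemma smooth_freeze d c phi : smooth phi -> smooth (freeze d c phi).
Proof.
  intros H; apply (smooth_generated (fun psi => exists phi, smooth phi /\ psi = freeze d c phi)).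
  - intros psi (f & Hf & ->); split.
    + intros p; apply (continuous_comp (fun q => slice d q c) f);
        [apply continuous_slice | now apply smooth_continuous].
    + intros d'; destruct (axis_cases d d') as [-> | ->].
      * exists (fun _ => RtoC 0); split; [|intros p; apply is_partial_frozen].
        apply generated_in; exists (fun _ => RtoC 0); split; [apply smooth_const | reflexivity].
      * exists (freeze d c (partial (other d) f)); split.
        -- apply generated_in; exists (partial (other d) f); auto using smooth_partial.
        -- intros p; now apply is_partial_freeze, smooth_is_partial.
  - apply generated_in; now exists phi.
Qed.

Lemma iter_freeze d c l phi : smooth phi ->
  iter_partial (repeat (other d) l) (freeze d c phi) =
  freeze d c (iter_partial (repeat (other d) l) phi).
Proof.
  intros H; induction l as [|l IH]; simpl; [reflexivity|].
  rewrite IH; apply functional_extensionality; intros p; apply is_partial_unique.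
  now apply is_partial_freeze, smooth_is_partial, smooth_iter.
Qed.

(** * Mean value inequality *)

Lemma mean_value d phi p B a b : smooth phi ->
  (forall t, Rmin a b <= t <= Rmax a b -> Cmod (partial d phi (slice d p t)) <= B) ->
  Cmod (phi (slice d p b) - phi (slice d p a)) <= 2 * B * Rabs (b - a).
Proof.
  intros H HB.
  assert (HP : forall t,
    is_derive (fun t => Re (phi (slice d p t))) t (Re (partial d phi (slice d p t))) /\
    is_derive (fun t => Im (phi (slice d p t))) t (Im (partial d phi (slice d p t)))).
  { intros t; pose proof (smooth_is_partial d phi (slice d p t) H) as HH.
    apply is_partial_C in HH; rewrite coord_slice in HH.
    split; [apply is_derive_ext with (2 := proj1 HH) | apply is_derive_ext with (2 := proj2 HH)];
      intros s; now rewrite slice_slice. }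
  destruct (MVT_gen (fun t => Re (phi (slice d p t))) a b (fun t => Re (partial d phi (slice d p t))))
    as (c1 & Hc1 & E1).
  { exact (fun t _ => proj1 (HP t)). }
  { intros t _; apply continuity_pt_filterlim.
    apply (ex_derive_continuous (K := R_AbsRing) (V := R_NormedModule)); eexists;
      exact (proj1 (HP t)). }
  destruct (MVT_gen (fun t => Im (phi (slice d p t))) a b (fun t => Im (partial d phi (slice d p t))))
    as (c2 & Hc2 & E2).
  { exact (fun t _ => proj2 (HP t)). }
  { intros t _; apply continuity_pt_filterlim.
    apply (ex_derive_continuous (K := R_AbsRing) (V := R_NormedModule)); eexists;
      exact (proj2 (HP t)). }
  eapply Rle_trans; [apply Cmod_le_sum|].
  change (Re (phi (slice d p b) - phi (slice d p a))%C)
    with (Re (phi (slice d p b)) - Re (phi (slice d p a))).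
  change (Im (phi (slice d p b) - phi (slice d p a))%C)
    with (Im (phi (slice d p b)) - Im (phi (slice d p a))).
  rewrite E1, E2, !Rabs_mult.
  pose proof (Rle_trans _ _ _ (re_le_Cmod _) (HB c1 Hc1)).
  pose proof (Rle_trans _ _ _ (im_le_Cmod _) (HB c2 Hc2)).
  pose proof (Rabs_pos (b - a)); nra.
Qed.

(** * Bernstein operators in one variable *)

(** The Bernstein polynomial of the nodal values [g 0], ..., [g n] at [t]: the
    expectation of [g] at the number of successes in [n] trials of probability
    [t]. Conditioning on the first trial gives a recursion free of binomial
    coefficients. *)
Fixpoint bern (n : nat) (g : nat -> C) (t : R) : C :=
  match n with
  | O => g O
  | S m => (RtoC (1 - t) * bern m g t + RtoC t * bern m (fun i => g (S i)) t)%C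
  end.

Fixpoint bernR (n : nat) (g : nat -> R) (t : R) : R :=
  match n with
  | O => g O
  | S m => (1 - t) * bernR m g t + t * bernR m (fun i => g (S i)) t
  end.

Lemma bern_error n g c t : 0 <= t <= 1 ->
  Cmod (bern n g t - c) <= bernR n (fun i => Cmod (g i - c)) t.
Proof.
  intros Ht; revert g; induction n as [|n IH]; intros g; simpl; [lra|].
  replace (RtoC (1 - t) * bern n g t + RtoC t * bern n (fun i => g (S i)) t - c)%C
    with (RtoC (1 - t) * (bern n g t - c) + RtoC t * (bern n (fun i => g (S i)) t - c))%C
    by (rewrite RtoC_minus; ring).
  eapply Rle_trans; [apply Cmod_triangle|].
  rewrite !Cmod_mult, !Cmod_R, !Rabs_pos_eq by lra.
  apply Rplus_le_compat; apply Rmult_le_compat_l; try lra; [apply IH | apply (IH (fun i => g (S i)))].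
Qed.

Lemma bernR_le n f g t : 0 <= t <= 1 -> (forall i, (i <= n)%nat -> f i <= g i) ->
  bernR n f t <= bernR n g t.
Proof.
  intros Ht; revert f g; induction n as [|n IH]; intros f g H; simpl; [now apply H|].
  apply Rplus_le_compat; apply Rmult_le_compat_l; try lra; apply IH; intros i Hi; apply H; lia.
Qed.

(** The variance of the binomial law; the shift [c] absorbs the outcome of the
    first trial in the induction. *)
Lemma bernR_variance n a b c t :
  bernR n (fun i => a + b * (INR i + c - INR n * t) ^ 2) t = a + b * (INR n * t * (1 - t) + c ^ 2).
Proof.
  revert c; induction n as [|n IH]; intros c; [simpl; ring|].
  cbn [bernR]; rewrite S_INR.
  assert (E1 := IH (c - t)); assert (E2 := IH (c + 1 - t)).
  replace (bernR n (fun i => a + b * (INR i + c - (INR n + 1) * t) ^ 2) t)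
    with (a + b * (INR n * t * (1 - t) + (c - t) ^ 2)).
  2:{ rewrite <- E1; f_equal; apply functional_extensionality; intros i; ring. }
  replace (bernR n (fun i => a + b * (INR (S i) + c - (INR n + 1) * t) ^ 2) t)
    with (a + b * (INR n * t * (1 - t) + (c + 1 - t) ^ 2)).
  2:{ rewrite <- E2; f_equal; apply functional_extensionality; intros i; rewrite S_INR; ring. }
  ring.
Qed.

Section Bernstein.
Variable d : axis.
Variable M : R.
Hypothesis HM : 0 < M.

Definition node (n i : nat) : R := 2 * M * (INR i / INR n) - M.
Definition bern_var (x : R) : R := (x + M) / (2 * M).

Definition bern_op (n : nat) (phi : plane -> C) : plane -> C :=
  fun p => bern n (fun i => phi (slice d p (node n i))) (bern_var (coord d p)).

Lemma bern_partial n (g : nat -> plane -> C) (g' : nat -> C) p :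
  (forall i, is_partial (other d) (g i) p (g' i)) ->
  is_partial (other d) (fun q => bern n (fun i => g i q) (bern_var (coord d q))) p
    (bern n g' (bern_var (coord d p))).
Proof.
  revert g g'; induction n as [|n IH]; intros g g' H; simpl; [apply H|].
  assert (Hc : forall f : R -> R, is_partial (other d) (fun q => RtoC (f (coord d q))) p (RtoC 0)).
  { intros f; unfold is_partial.
    apply (is_derive_ext (V := C_R_NormedModule) (fun _ => RtoC (f (coord d p))));
      [intros t; now rewrite coord_slice_other|].
    exact (is_derive_const (V := C_R_NormedModule) _ _). }
  pose proof (is_partial_plus _ _ _ _ _ _
    (is_partial_mult _ _ _ _ _ _ (Hc (fun x => 1 - bern_var x)) (IH g g' H))
    (is_partial_mult _ _ _ _ _ _ (Hc bern_var) (IH (fun i => g (S i)) (fun i => g' (S i))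
       (fun i => H (S i))))) as E.
  cbv beta in E; rewrite !Cmult_0_l, !Cplus_0_l in E; exact E.
Qed.

Lemma iter_bern_op n l phi : smooth phi ->
  iter_partial (repeat (other d) l) (bern_op n phi) =
  bern_op n (iter_partial (repeat (other d) l) phi).
Proof.
  intros H; induction l as [|l IH]; simpl; [reflexivity|].
  rewrite IH; apply functional_extensionality; intros p; apply is_partial_unique.
  apply (bern_partial n (fun i q => iter_partial (repeat (other d) l) phi (slice d q (node n i)))).
  intros i; apply (is_partial_freeze d (node n i)); now apply smooth_is_partial, smooth_iter.
Qed.

Lemma box_slice p t : box M p -> - M <= t <= M -> box M (slice d p t).
Proof.
  intros [H1 H2] Ht; assert (Rabs t <= M) by now apply Rabs_le_between.
  destruct d; split; simpl; assumption.
Qed.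

Lemma box_coord p : box M p -> - M <= coord d p <= M.
Proof. intros [H1 H2]; destruct d; simpl; now apply Rabs_le_between. Qed.

(** The mean value inequality bounds the error by a multiple of the mean
    distance from the node to the point, which the variance controls. With
    [m * m] trials this distance is of order [1 / m]. *)
Lemma bern_op_error phi : smooth phi -> exists K, 0 <= K /\
  forall m p, (0 < m)%nat -> box M p ->
    Cmod (bern_op (m * m) phi p - phi p) <= K / INR m.
Proof.
  intros H; destruct (continuous_bounded (partial d phi) M) as (L & HL0 & HL).
  { intros p; now apply smooth_continuous, smooth_partial. }
  exists (4 * L * M); split; [nra|]; intros m p Hm Hp.
  pose proof (box_coord p Hp) as Hx; set (x := coord d p) in *.
  assert (Hm0 : 0 < INR m) by now apply lt_0_INR.
  set (t := bern_var x).
  assert (Ht : 0 <= t <= 1).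
  { unfold t, bern_var; split.
    - apply Rdiv_le_0_compat; lra.
    - apply Rmult_le_reg_r with (2 * M); [lra|]; field_simplify; lra. }
  assert (Hn : INR (m * m) = INR m * INR m) by apply mult_INR.
  assert (Hnode : forall i, (i <= m * m)%nat -> - M <= node (m * m) i <= M).
  { intros i Hi; unfold node; apply le_INR in Hi; rewrite Hn in *; pose proof (pos_INR i).
    assert (0 <= INR i / (INR m * INR m) <= 1).
    { split; [apply Rdiv_le_0_compat; nra|].
      apply Rmult_le_reg_r with (INR m * INR m); [nra|]; field_simplify; lra. }
    nra. }
  eapply Rle_trans; [apply bern_error; exact Ht|].
  fold x t.
  apply Rle_trans with (bernR (m * m) (fun i =>
     (2 * L * (2 * M)) / INR m / 2 +
     (2 * L * (2 * M)) / (INR m * INR m * INR m) / 2 * (INR i + 0 - INR (m * m) * t) ^ 2) t).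
  - apply bernR_le; [exact Ht|]; intros i Hi.
    rewrite <- (slice_coord d p) at 2; fold x.
    eapply Rle_trans; [apply (mean_value d phi p L); [exact H|]|].
    { intros y Hy; apply HL, box_slice; [exact Hp|].
      pose proof (Hnode i Hi).
      unfold Rmin, Rmax in Hy; destruct (Rle_dec x (node (m * m) i)); lra. }
    replace (node (m * m) i - x) with (2 * M / (INR m * INR m) * (INR i + 0 - INR (m * m) * t)).
    2:{ unfold node, t, bern_var; rewrite Hn; field; lra. }
    set (e := INR i + 0 - INR (m * m) * t).
    rewrite Rabs_mult, Rabs_pos_eq by (apply Rdiv_le_0_compat; nra).
    (* [m] is the order of the standard deviation, so both terms have the same order *)
    assert (He : Rabs e <= INR m / 2 + e ^ 2 / INR m / 2).
    { apply Rmult_le_reg_r with (2 * INR m); [lra|].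
      replace ((INR m / 2 + e ^ 2 / INR m / 2) * (2 * INR m)) with (INR m * INR m + e ^ 2)
        by (field; lra).
      rewrite <- (pow2_abs e); pose proof (pow2_ge_0 (Rabs e - INR m)); nra. }
    apply Rle_trans with (2 * L * (2 * M / (INR m * INR m) * (INR m / 2 + e ^ 2 / INR m / 2))).
    + apply Rmult_le_compat_l; [lra|]; apply Rmult_le_compat_l; [|exact He].
      apply Rdiv_le_0_compat; nra.
    + right; field; lra.
  - rewrite bernR_variance, Hn.
    replace (4 * L * M / INR m) with
      (2 * L * (2 * M) / INR m / 2 +
       2 * L * (2 * M) / (INR m * INR m * INR m) / 2 * (INR m * INR m * 1)) by (field; lra).
    apply Rplus_le_compat_l, Rmult_le_compat_l.
    + apply Rdiv_le_0_compat; [|lra]; apply Rdiv_le_0_compat; [nra|].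
      repeat apply Rmult_lt_0_compat; lra.
    + nra.
Qed.

End Bernstein.

(** * Density of polynomials *)

(** Polynomials in the coordinate [d] with coefficients in [Q]. *)
Inductive poly_over (d : axis) (Q : (plane -> C) -> Prop) : (plane -> C) -> Prop :=
| poly_over_mono k g : Q g -> poly_over d Q (fun p => (RtoC (coord d p) ^ k * g p)%C)
| poly_over_plus phi psi :
    poly_over d Q phi -> poly_over d Q psi -> poly_over d Q (fun p => (phi p + psi p)%C).

Section PolyOver.
Variable d : axis.
Variable Q : (plane -> C) -> Prop.
Hypothesis Qsmooth : forall g, Q g -> smooth g.
Hypothesis Qscal : forall c g, Q g -> Q (fun p => (c * g p)%C).
Hypothesis Qpartial : forall g, Q g -> partial d g = fun _ => RtoC 0.

Lemma poly_over_ext phi psi : poly_over d Q phi -> (forall p, phi p = psi p) -> poly_over d Q psi.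
Proof. intros H E; now rewrite <- (functional_extensionality _ _ E). Qed.

Lemma poly_over_smooth phi : poly_over d Q phi -> smooth phi.
Proof.
  induction 1; [|now apply smooth_plus].
  apply smooth_mult; [apply smooth_pow, smooth_coord | now apply Qsmooth].
Qed.

Lemma poly_over_in g : Q g -> poly_over d Q g.
Proof.
  intros H; apply poly_over_ext with (1 := poly_over_mono d Q 0 g H); intros p; simpl; ring.
Qed.

Lemma poly_over_scal c phi : poly_over d Q phi -> poly_over d Q (fun p => (c * phi p)%C).
Proof.
  induction 1 as [k g H | f g _ IHf _ IHg].
  - apply poly_over_ext with (1 := poly_over_mono d Q k _ (Qscal c g H)); intros p; ring.
  - apply poly_over_ext with (1 := poly_over_plus d Q _ _ IHf IHg); intros p; ring.
Qed.

Lemma poly_over_mul_coord phi : poly_over d Q phi -> poly_over d Q (fun p => (RtoC (coord d p) * phi p)%C).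
Proof.
  induction 1 as [k g H | f g _ IHf _ IHg].
  - apply poly_over_ext with (1 := poly_over_mono d Q (S k) g H); intros p; simpl; ring.
  - apply poly_over_ext with (1 := poly_over_plus d Q _ _ IHf IHg); intros p; ring.
Qed.

Lemma poly_over_primitive phi : poly_over d Q phi -> exists psi, poly_over d Q psi /\
  partial d psi = phi /\ forall p, psi (slice d p 0) = RtoC 0.
Proof.
  induction 1 as [k g H | f g Hf (F & F1 & F2 & F3) Hg (G & G1 & G2 & G3)].
  - set (g' := fun p => (RtoC (/ INR (S k)) * g p)%C).
    assert (Hg' : Q g') by now apply Qscal.
    exists (fun p => (RtoC (coord d p) ^ S k * g' p)%C); split; [now constructor|]; split.
    + rewrite partial_mult by (auto; apply smooth_pow, smooth_coord).
      rewrite partial_coord_pow, (Qpartial _ Hg').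
      apply functional_extensionality; intros p; unfold g'.
      replace (g p) with (RtoC (INR (S k) * / INR (S k)) * g p)%C at 2
        by (rewrite Rinv_r by (apply not_0_INR; lia); ring).
      rewrite RtoC_mult; ring.
    + intros p; rewrite coord_slice; simpl; ring.
  - exists (fun p => (F p + G p)%C); split; [now constructor|]; split.
    + rewrite partial_plus by now apply poly_over_smooth. now rewrite F2, G2.
    + intros p; rewrite F3, G3; ring.
Qed.

Lemma poly_over_bern M n phi : (forall c, Q (freeze d c phi)) -> poly_over d Q (bern_op d M n phi).
Proof.
  intros H.
  assert (G : forall m (g : nat -> R), poly_over d Q
    (fun p => bern m (fun i => phi (slice d p (g i))) (bern_var M (coord d p)))).
  { induction m as [|m IH]; intros g; simpl; [apply poly_over_in, H|].
    assert (A1 := IH g); assert (A2 := IH (fun i => g (S i))); simpl in A2.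
    assert (HT : forall f, poly_over d Q f ->
      poly_over d Q (fun p => (RtoC (bern_var M (coord d p)) * f p)%C)).
    { intros f Hf; unfold bern_var, Rdiv.
      eapply poly_over_ext;
        [apply poly_over_plus; [apply poly_over_scal with (c := RtoC (/ (2 * M))); apply poly_over_mul_coord, Hf
                          | apply poly_over_scal with (c := RtoC (M * / (2 * M))); exact Hf]|].
      intros p; cbv beta; rewrite !RtoC_mult, RtoC_plus; ring. }
    eapply poly_over_ext;
      [apply poly_over_plus; [exact A1 | apply poly_over_plus;
         [exact (HT _ A2) | apply poly_over_scal with (c := (- RtoC 1)%C); exact (HT _ A1)]]|].
    intros p; cbv beta; rewrite RtoC_minus; ring. }
  apply G.
Qed.

(** A Bernstein approximation of [D_d^N phi] is integrated [N] times in the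
    coordinate [d], each time adding the restriction to coordinate 0 of the
    lower derivative, which is a coefficient in [Q]. Derivatives in the other
    coordinate commute with all these operations. *)
Lemma poly_over_approx M L N : 0 < M -> forall phi, smooth phi ->
  (forall k c, Q (freeze d c (iter_partial (repeat d k) phi))) ->
  forall eps, 0 < eps -> exists P, poly_over d Q P /\
    forall k l p, (k <= N)%nat -> (l <= L)%nat -> box M p ->
      Cmod (iter_partial (repeat (other d) l) (iter_partial (repeat d k)
              (fun q => (phi q - P q)%C)) p) <= eps.
Proof.
  intros HM; induction N as [|N IH]; intros phi Sphi HQ eps Heps.
  - assert (HK : exists K, 0 <= K /\ forall l m p, (l <= L)%nat -> (0 < m)%nat -> box M p ->
      Cmod (bern_op d M (m * m) (iter_partial (repeat (other d) l) phi) p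
              - iter_partial (repeat (other d) l) phi p) <= K / INR m).
    { clear HQ; induction L as [|L' (K & HK0 & HK)].
      - destruct (bern_op_error d M HM phi Sphi) as (K & HK0 & HK).
        exists K; split; [exact HK0|]; intros l m p Hl; replace l with O by lia; apply HK.
      - destruct (bern_op_error d M HM (iter_partial (repeat (other d) (S L')) phi)
                    (smooth_iter _ _ Sphi)) as (K' & HK0' & HK').
        exists (K + K'); split; [lra|]; intros l m p Hl Hm Hp.
        assert (0 < / INR m) by now apply Rinv_0_lt_compat, lt_0_INR.
        destruct (Nat.eq_dec l (S L')) as [-> | Hne].
        + eapply Rle_trans; [now apply HK'|]; unfold Rdiv; nra.
        + eapply Rle_trans; [apply HK; auto; lia|]; unfold Rdiv; nra. }
    destruct HK as (K & HK0 & HK).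
    destruct (archimed_cor1 (eps / (K + 1))) as (m & Hm & Hm0); [apply Rdiv_lt_0_compat; lra|].
    assert (HP : poly_over d Q (bern_op d M (m * m) phi)) by exact (poly_over_bern M (m * m) phi (HQ O)).
    exists (bern_op d M (m * m) phi); split; [exact HP|].
    intros k l p Hk Hl Hp; replace k with O by lia; simpl.
    rewrite iter_partial_minus by auto using poly_over_smooth.
    rewrite iter_bern_op by assumption.
    rewrite <- Cmod_opp.
    match goal with |- Cmod ?z <= _ => replace z with
      (bern_op d M (m * m) (iter_partial (repeat (other d) l) phi) p
              - iter_partial (repeat (other d) l) phi p)%C by ring end.
    eapply Rle_trans; [now apply HK|].
    apply Rmult_lt_compat_r with (r := K + 1) in Hm; [|lra].
    unfold Rdiv in *; rewrite Rmult_assoc, Rinv_l, Rmult_1_r in Hm by lra.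
    assert (0 < / INR m) by now apply Rinv_0_lt_compat, lt_0_INR. nra.
  - destruct (IH (partial d phi) (smooth_partial _ _ Sphi)) with (eps := Rmin eps (eps / (2 * M)))
      as (R0 & HR & HRe).
    { intros k c; rewrite <- iter_partial_repeat_S; apply HQ. }
    { apply Rmin_glb_lt; [exact Heps | apply Rdiv_lt_0_compat; lra]. }
    destruct (poly_over_primitive R0 HR) as (P & HP & HP1 & HP0).
    set (P' := fun p => (freeze d 0 phi p + P p)%C).
    assert (HP' : poly_over d Q P').
    { apply poly_over_plus; [apply poly_over_in, (HQ O) | exact HP]. }
    assert (SP' := poly_over_smooth _ HP').
    assert (HD : partial d (fun q => (phi q - P' q)%C) = fun q => (partial d phi q - R0 q)%C).
    { apply functional_extensionality; intros p; apply is_partial_unique.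
      rewrite minus_as_scal.
      replace (partial d phi p - R0 p)%C with
        (partial d phi p + (RtoC 0 * P' p + - RtoC 1 * (RtoC 0 + R0 p)))%C by ring.
      apply is_partial_plus; [now apply smooth_is_partial|].
      apply (is_partial_mult d (fun _ => (- RtoC 1)%C)); [apply is_partial_const|].
      apply is_partial_plus; [apply is_partial_frozen|].
      rewrite <- HP1; apply smooth_is_partial; now apply poly_over_smooth. }
    assert (SD : smooth (fun q => (phi q - P' q)%C)) by now apply smooth_minus.
    exists P'; split; [exact HP'|]; intros [|k] l p Hk Hl Hp.
    + cbn [repeat]; change (iter_partial nil (fun q => (phi q - P' q)%C)) with (fun q => (phi q - P' q)%C).
      set (D := fun q => (phi q - P' q)%C) in *.
      assert (HD0 : freeze d 0 D = fun _ => RtoC 0).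
      { apply functional_extensionality; intros q; unfold freeze, D, P'.
        rewrite HP0; unfold freeze; rewrite slice_slice; ring. }
      assert (HZ : iter_partial (repeat (other d) l) D (slice d p 0) = RtoC 0).
      { change (freeze d 0 (iter_partial (repeat (other d) l) D) p = RtoC 0).
        now rewrite <- iter_freeze, HD0, iter_partial_zero by assumption. }
      pose proof (box_coord d M p Hp) as Hx.
      rewrite <- (slice_coord d p).
      replace (iter_partial (repeat (other d) l) D (slice d p (coord d p)))
        with (iter_partial (repeat (other d) l) D (slice d p (coord d p)) -
              iter_partial (repeat (other d) l) D (slice d p 0))%C by (rewrite HZ; ring).
      eapply Rle_trans; [apply (mean_value d _ p (eps / (2 * M))); [now apply smooth_iter|]|].
      * intros t Ht; rewrite partial_iter_other, HD by assumption.
        eapply Rle_trans; [apply (HRe O l); [lia | lia |] | apply Rmin_r].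
        apply box_slice; [exact Hp|].
        unfold Rmin, Rmax in Ht; destruct (Rle_dec 0 (coord d p)); lra.
      * rewrite Rminus_0_r; apply Rabs_le_between in Hx.
        apply Rle_trans with (2 * (eps / (2 * M)) * M).
        -- apply Rmult_le_compat_l; [|exact Hx].
           assert (0 < eps / (2 * M)) by (apply Rdiv_lt_0_compat; lra); lra.
        -- right; field; lra.
    + rewrite iter_partial_repeat_S, HD.
      eapply Rle_trans; [apply HRe; auto; lia | apply Rmin_l].
Qed.

Lemma poly_over_dense u phi : compact_distribution u -> smooth phi ->
  (forall k c, Q (freeze d c (iter_partial (repeat d k) phi))) ->
  (forall k g, Q g -> u (fun p => (RtoC (coord d p) ^ k * g p)%C) = RtoC 0) ->
  u phi = RtoC 0.
Proof.
  intros Hu Sphi HQ H0.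
  destruct (cd_limit u Hu) as (N & M & HM & Hlim); apply Hlim; [exact Sphi|].
  intros eps Heps.
  destruct (poly_over_approx (M + 1) N N ltac:(lra) phi Sphi HQ eps Heps) as (P & HP & He).
  exists P; split; [now apply poly_over_smooth|]; split.
  - clear He; induction HP; [now apply H0|].
    rewrite (cd_plus u Hu), IHHP1, IHHP2 by now apply poly_over_smooth. ring.
  - intros w p Hw [Hp1 Hp2].
    destruct (iter_partial_sort d w) as (k & l & Hk & Hl & E).
    rewrite E by (apply smooth_minus; [exact Sphi | now apply poly_over_smooth]).
    apply He; [lia | lia | split; lra].
Qed.

End PolyOver.

Lemma partial_indep d g : (forall c, freeze d c g = g) -> partial d g = fun _ => RtoC 0.
Proof.
  intros H; rewrite <- (H 0); apply functional_extensionality; intros p.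
  apply is_partial_unique, is_partial_frozen.
Qed.

Lemma iter_repeat_smooth_mult_indep d f g k : smooth f -> smooth g ->
  partial d f = (fun _ => RtoC 0) ->
  iter_partial (repeat d k) (fun p => (f p * g p)%C) =
  fun p => (f p * iter_partial (repeat d k) g p)%C.
Proof.
  intros Sf Sg Hf; induction k as [|k IH]; simpl; [reflexivity|].
  rewrite IH, partial_mult, Hf by auto using smooth_iter.
  apply functional_extensionality; intros p; ring.
Qed.

(** Approximation in one coordinate, used twice: functions are limits of
    polynomials in the first coordinate whose coefficients depend on the
    second one only, and these coefficients are in turn limits of
    polynomials. *)
Lemma polynomials_dense u : compact_distribution u ->
  (forall k l, u (fun p => (RtoC (fst p) ^ k * RtoC (snd p) ^ l)%C) = RtoC 0) ->
  dist_zero u.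
Proof.
  intros Hu H0.
  assert (Sx : forall k, smooth (fun p => (RtoC (fst p) ^ k)%C)).
  { intros k; apply smooth_pow, (smooth_coord axis1). }
  assert (H1 : forall k g, smooth g -> (forall c, freeze axis1 c g = g) ->
    u (fun p => (RtoC (fst p) ^ k * g p)%C) = RtoC 0).
  { intros k g Sg Hg.
    assert (Hx : partial axis2 (fun p => (RtoC (fst p) ^ k)%C) = fun _ => RtoC 0)
      by now apply partial_indep.
    apply (poly_over_dense axis2 (fun h => exists c, h = fun p => (c * RtoC (fst p) ^ k)%C)).
    - intros h [c ->]; now apply smooth_scal.
    - intros c h [c' ->]; exists (c * c')%C; apply functional_extensionality; intros; ring.
    - intros h [c ->]; now apply partial_indep.
    - exact Hu.
    - now apply smooth_mult.
    - intros j c; rewrite iter_repeat_smooth_mult_indep by auto.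
      exists (iter_partial (repeat axis2 j) g (0, c)).
      apply functional_extensionality; intros p; unfold freeze; simpl.
      rewrite Cmult_comm; f_equal.
      pose proof (iter_freeze axis1 0 j g Sg) as E; rewrite (Hg 0) in E.
      exact (f_equal (fun h => h (fst p, c)) E).
    - intros j h [c ->]; simpl.
      replace (fun p : plane => (RtoC (snd p) ^ j * (c * RtoC (fst p) ^ k))%C)
        with (fun p : plane => (c * (RtoC (fst p) ^ k * RtoC (snd p) ^ j))%C)
        by (apply functional_extensionality; intros; ring).
      rewrite (cd_scal u Hu), H0; [ring|].
      apply smooth_mult; [apply Sx | apply smooth_pow, (smooth_coord axis2)]. }
  intros phi Sphi.
  apply (poly_over_dense axis1 (fun g => smooth g /\ forall c, freeze axis1 c g = g)); auto.
  - now intros g [Hg _].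
  - intros c g [Sg Hg]; split; [now apply smooth_scal|]; intros c'.
    apply functional_extensionality; intros p; unfold freeze.
    change (g (slice axis1 p c')) with (freeze axis1 c' g p); now rewrite Hg.
  - intros g [_ Hg]; now apply partial_indep.
  - intros k c; split; [now apply smooth_freeze, smooth_iter|]; intros c'; reflexivity.
  - intros k g [Sg Hg]; now apply H1.
Qed.

(** * A smooth bump function *)

(** The functions [x^(-n) exp (-1/x)], extended by 0, have derivatives in
    their own linear span; [bump_comb] encodes an element of this span by its
    list of coefficients and exponents. *)
Definition bump_term (n : nat) (x : R) : R :=
  if Rlt_dec 0 x then (/ x) ^ n * exp (- / x) else 0.

Lemma exp_ge_pow n x : 0 <= x -> x ^ n / INR (Factorial.fact n) <= exp x.
Proof.
  intros Hx; eapply Rle_trans; [|apply (exp_ge_taylor x n Hx)].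
  assert (Hp : forall k, 0 <= x ^ k / INR (Factorial.fact k)).
  { intros k; apply Rdiv_le_0_compat; [now apply pow_le | apply INR_fact_lt_0]. }
  destruct n; [right; reflexivity|]; rewrite tech5.
  pose proof (cond_pos_sum (fun k => x ^ k / INR (Factorial.fact k)) n Hp); lra.
Qed.

Lemma pow_exp_le n y : 0 < y -> y ^ n * exp (- y) <= INR (Factorial.fact (n + 2)) / y ^ 2.
Proof.
  intros Hy; pose proof (exp_ge_pow (n + 2) y (Rlt_le _ _ Hy)) as H.
  assert (Hf := INR_fact_lt_0 (n + 2)).
  assert (0 < y ^ 2) by now apply pow_lt. assert (0 < y ^ n) by now apply pow_lt.
  rewrite exp_Ropp.
  assert (0 < exp y) by apply exp_pos.
  apply Rmult_le_reg_r with (exp y * y ^ 2); [nra|].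
  replace (y ^ n * / exp y * (exp y * y ^ 2)) with (y ^ (n + 2)) by (rewrite pow_add; field; lra).
  replace (INR (Factorial.fact (n + 2)) / y ^ 2 * (exp y * y ^ 2))
    with (INR (Factorial.fact (n + 2)) * exp y) by (field; lra).
  apply Rmult_le_compat_l with (r := INR (Factorial.fact (n + 2))) in H; [|lra].
  replace (INR (Factorial.fact (n + 2)) * (y ^ (n + 2) / INR (Factorial.fact (n + 2))))
    with (y ^ (n + 2)) in H by (field; lra).
  exact H.
Qed.

Lemma bump_term_le n x : Rabs (bump_term n x) <= INR (Factorial.fact (n + 2)) * x ^ 2.
Proof.
  unfold bump_term; destruct (Rlt_dec 0 x) as [Hx|Hx].
  - rewrite Rabs_pos_eq.
    + eapply Rle_trans; [apply pow_exp_le; now apply Rinv_0_lt_compat|].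
      right; field; lra.
    + apply Rmult_le_pos; [apply pow_le; left; now apply Rinv_0_lt_compat | left; apply exp_pos].
  - rewrite Rabs_R0; apply Rmult_le_pos; [left; apply INR_fact_lt_0 | apply pow2_ge_0].
Qed.

Lemma is_derive_bump_term n x :
  is_derive (bump_term n) x (- INR n * bump_term (S n) x + bump_term (S (S n)) x).
Proof.
  destruct (total_order_T x 0) as [[Hx|Hx]|Hx].
  - apply is_derive_ext_loc with (fun _ => 0).
    + exists (mkposreal (- x) ltac:(lra)); intros y Hy.
      apply Rabs_lt_between' in Hy; simpl in Hy; unfold bump_term.
      destruct (Rlt_dec 0 y); [lra | reflexivity].
    + unfold bump_term; destruct (Rlt_dec 0 x); [lra|].
      replace (- INR n * 0 + 0) with 0 by ring.
      exact (is_derive_const (K := R_AbsRing) (V := R_NormedModule) _ _).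
  - subst x; unfold bump_term at 2 3; destruct (Rlt_dec 0 0); [lra|].
    replace (- INR n * 0 + 0) with 0 by ring.
    apply is_derive_Reals; intros eps Heps.
    set (K := INR (Factorial.fact (n + 2))).
    assert (HK : 0 < K) by apply INR_fact_lt_0.
    exists (mkposreal (eps / K) ltac:(now apply Rdiv_lt_0_compat)); intros h Hh Hd; simpl in Hd.
    rewrite Rplus_0_l; replace (bump_term n 0) with 0
      by (unfold bump_term; destruct (Rlt_dec 0 0); [lra | reflexivity]).
    rewrite !Rminus_0_r; unfold Rdiv; rewrite Rabs_mult, Rabs_inv.
    assert (Hp : 0 < Rabs h) by now apply Rabs_pos_lt.
    apply Rle_lt_trans with (K * Rabs h ^ 2 * / Rabs h).
    + apply Rmult_le_compat_r; [left; now apply Rinv_0_lt_compat|].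
      rewrite pow2_abs; apply bump_term_le.
    + replace (K * Rabs h ^ 2 * / Rabs h) with (K * Rabs h) by (field; lra).
      apply Rmult_lt_compat_l with (r := K) in Hd; [|exact HK].
      replace (K * (eps / K)) with eps in Hd by (field; lra); exact Hd.
  - apply is_derive_ext_loc with (fun y => (/ y) ^ n * exp (- / y)).
    + exists (mkposreal x Hx); intros y Hy.
      apply Rabs_lt_between' in Hy; simpl in Hy; unfold bump_term.
      destruct (Rlt_dec 0 y); [reflexivity | lra].
    + unfold bump_term; destruct (Rlt_dec 0 x); [|lra].
      auto_derive; [repeat split; lra|].
      destruct n; simpl pred; [simpl; field; lra|].
      rewrite S_INR; simpl; field; lra.
Qed.

Definition bump_comb (l : list (R * nat)) (x : R) : R :=
  fold_right (fun q acc => fst q * bump_term (snd q) x + acc) 0 l.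

Definition bump_step (l : list (R * nat)) : list (R * nat) :=
  flat_map (fun q => (- (fst q * INR (snd q)), S (snd q)) :: (fst q, S (S (snd q))) :: nil) l.

(** [bump 0] is [exp (-1/x)] for positive [x], and 0 otherwise; [bump k] is
    its [k]-th derivative. *)
Definition bump (k : nat) : R -> R := bump_comb (Nat.iter k bump_step ((1, O) :: nil)).

Lemma is_derive_bump_comb l x : is_derive (bump_comb l) x (bump_comb (bump_step l) x).
Proof.
  induction l as [|[c n] l IH]; simpl.
  - exact (is_derive_const (K := R_AbsRing) (V := R_NormedModule) _ _).
  - evar_last; [exact (is_derive_plus _ _ _ _ _ (is_derive_scal _ _ c _ (is_derive_bump_term n x)) IH)|].
    unfold plus; simpl; ring.
Qed.

Lemma bump_chain I : chain I bump.
Proof. intros k x _; apply is_derive_bump_comb. Qed.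

Lemma bump_0 x : x <= 0 -> bump 0 x = 0.
Proof.
  intros Hx; unfold bump, bump_comb, bump_term; simpl; destruct (Rlt_dec 0 x); [lra | ring].
Qed.

Lemma bump_pos_eq x : 0 < x -> bump 0 x = exp (- / x).
Proof.
  intros Hx; unfold bump, bump_comb, bump_term; simpl; destruct (Rlt_dec 0 x); [ring | lra].
Qed.

Lemma bump_pos x : 0 < x -> 0 < bump 0 x.
Proof. intros Hx; rewrite bump_pos_eq by exact Hx; apply exp_pos. Qed.

Lemma bump_ge0 x : 0 <= bump 0 x.
Proof.
  destruct (Rlt_le_dec 0 x) as [H|H]; [left; now apply bump_pos | now rewrite bump_0; [right|]].
Qed.

Lemma bump_le x y : x <= y -> bump 0 x <= bump 0 y.
Proof.
  intros H; destruct (Rlt_le_dec 0 x) as [Hx|Hx].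
  - rewrite !bump_pos_eq by lra; destruct (Rle_lt_or_eq_dec _ _ H) as [H' | ->]; [|lra].
    left; apply exp_increasing, Ropp_lt_contravar, Rinv_lt_contravar; nra.
  - rewrite (bump_0 x Hx); apply bump_ge0.
Qed.

Lemma bump_continuous x : continuous (bump 0) x.
Proof.
  apply (ex_derive_continuous (K := R_AbsRing) (V := R_NormedModule)).
  eexists; now apply (bump_chain (fun _ => True)).
Qed.

(** * The inverse square root and its averages *)

Fixpoint isqrt_coef (k : nat) : R :=
  match k with O => 1 | S j => - ((2 * INR j + 1) / 2) * isqrt_coef j end.

(** The [k]-th derivative of [x^(-1/2)]. *)
Definition isqrt (k : nat) (x : R) : R := isqrt_coef k * (/ sqrt x) ^ (2 * k + 1).

Lemma isqrt_0 x : isqrt 0 x = / sqrt x.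
Proof. unfold isqrt; simpl; ring. Qed.

Lemma isqrt_chain : chain (fun x => 0 < x) isqrt.
Proof.
  intros k x Hx; unfold isqrt.
  assert (Hs : 0 < sqrt x) by now apply sqrt_lt_R0.
  auto_derive; [repeat split; lra|].
  replace (2 * S k + 1)%nat with (S (S (2 * k + 1))) by lia.
  cbn [isqrt_coef]; replace (k + (k + 0) + 1)%nat with (S (2 * k)) by lia.
  replace (2 * k + 1)%nat with (S (2 * k)) by lia; rewrite S_INR, mult_INR.
  change (INR 2) with 2; cbn [Nat.pred]; generalize (2 * k)%nat; intros m; cbn [pow].
  generalize ((/ sqrt x) ^ m); intros y; field; lra.
Qed.

Lemma isqrt_bound N m : 0 < m -> exists A, 0 <= A /\
  forall k x, (k <= N)%nat -> m <= x -> Rabs (isqrt k x) <= A.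
Proof.
  intros Hm.
  assert (H1 : forall k x, m <= x ->
    Rabs (isqrt k x) <= Rabs (isqrt_coef k) * (/ sqrt m) ^ (2 * k + 1)).
  { intros k x Hx; unfold isqrt; rewrite Rabs_mult; apply Rmult_le_compat_l; [apply Rabs_pos|].
    assert (0 < sqrt m) by now apply sqrt_lt_R0.
    assert (0 < sqrt x) by (apply sqrt_lt_R0; lra).
    rewrite Rabs_pos_eq by (apply pow_le; left; now apply Rinv_0_lt_compat).
    apply pow_incr; split; [left; now apply Rinv_0_lt_compat|].
    apply Rinv_le_contravar; [assumption | apply sqrt_le_1; lra]. }
  induction N as [|N (A & HA & H)].
  - eexists; split; [|intros k x Hk Hx; replace k with O by lia; apply H1, Hx].
    apply Rmult_le_pos; [apply Rabs_pos|]; apply pow_le; left;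
      apply Rinv_0_lt_compat, sqrt_lt_R0, Hm.
  - exists (A + Rabs (isqrt_coef (S N)) * (/ sqrt m) ^ (2 * S N + 1)).
    assert (0 <= Rabs (isqrt_coef (S N)) * (/ sqrt m) ^ (2 * S N + 1)).
    { apply Rmult_le_pos; [apply Rabs_pos|]; apply pow_le; left;
      apply Rinv_0_lt_compat, sqrt_lt_R0, Hm. }
    split; [lra|]; intros k x Hk Hx; destruct (Nat.eq_dec k (S N)) as [-> | Hne].
    + specialize (H1 (S N) x Hx); lra.
    + specialize (H k x ltac:(lia) Hx); lra.
Qed.

(** A smooth even weight supported in the interval from [- delta] to [delta],
    of total integral [mass delta]. *)
Definition dens (delta s : R) : R := bump 0 (delta ^ 2 - s ^ 2).

Lemma dens_continuous delta s : continuous (dens delta) s.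
Proof.
  apply (continuous_comp (fun s => delta ^ 2 - s ^ 2) (bump 0)); [|apply bump_continuous].
  apply (ex_derive_continuous (K := R_AbsRing) (V := R_NormedModule)); auto_derive; trivial.
Qed.

Lemma dens_even delta s : dens delta (- s) = dens delta s.
Proof. unfold dens; f_equal; ring. Qed.

Lemma dens_supp delta s : 0 < delta -> delta < Rabs s -> dens delta s = 0.
Proof. intros Hd Hs; apply bump_0; rewrite <- (pow2_abs s); nra. Qed.

Definition mass (delta : R) : R := RInt (dens delta) (- delta) delta.

(** [avg delta 0 x] is the integral of [1 / sqrt (x - s^2)] against this
    weight, and [avg delta k] its [k]-th derivative. *)
Definition avg (delta : R) (k : nat) (x : R) : R :=
  RInt (fun s => dens delta s * isqrt k (x - s ^ 2)) (- delta) delta.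

Lemma mass_pos delta : 0 < delta -> 0 < mass delta.
Proof.
  intros Hd; unfold mass; apply RInt_gt_0; [lra | |].
  - intros s Hs; apply bump_pos; nra.
  - intros s _; apply dens_continuous.
Qed.

Lemma isqrt_continuous k x : 0 < x -> continuous (isqrt k) x.
Proof.
  intros Hx; apply (ex_derive_continuous (K := R_AbsRing) (V := R_NormedModule)).
  eexists; now apply isqrt_chain.
Qed.

Lemma avg_integrand_continuous delta k x s : s ^ 2 < x ->
  continuous (fun s => dens delta s * isqrt k (x - s ^ 2)) s.
Proof.
  intros Hx; apply (continuous_mult (K := R_AbsRing)); [apply dens_continuous|].
  apply (continuous_comp (fun s => x - s ^ 2) (isqrt k)).
  - apply (ex_derive_continuous (K := R_AbsRing) (V := R_NormedModule)); auto_derive; trivial.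
  - apply isqrt_continuous; lra.
Qed.

Lemma avg_ex_RInt delta k x : 0 < delta -> delta ^ 2 < x ->
  ex_RInt (fun s => dens delta s * isqrt k (x - s ^ 2)) (- delta) delta.
Proof.
  intros Hd Hx; apply (ex_RInt_continuous (V := R_CompleteNormedModule)); intros s Hs.
  rewrite Rmin_left, Rmax_right in Hs by lra.
  apply avg_integrand_continuous; nra.
Qed.

Lemma avg_chain delta : 0 < delta -> chain (fun x => delta ^ 2 < x) (avg delta).
Proof.
  intros Hd k x Hx; unfold avg.
  assert (HD : forall y s, s ^ 2 < y ->
    is_derive (fun u => dens delta s * isqrt k (u - s ^ 2)) y (dens delta s * isqrt (S k) (y - s ^ 2))).
  { intros y s Hs; apply is_derive_scal.
    evar_last; [apply (is_derive_comp (isqrt k) (fun u => u - s ^ 2));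
      [apply isqrt_chain; lra | auto_derive; [trivial | reflexivity]]|].
    cbn; unfold mult; simpl; ring. }
  assert (Hs2 : forall s, Rmin (- delta) delta <= s <= Rmax (- delta) delta -> s ^ 2 <= delta ^ 2).
  { intros s Hs; rewrite Rmin_left, Rmax_right in Hs by lra; nra. }
  assert (Hloc : locally x (fun y => delta ^ 2 < y)) by exact (open_gt (delta ^ 2) x Hx).
  evar_last.
  - apply (is_derive_RInt_param (fun u s => dens delta s * isqrt k (u - s ^ 2)) (- delta) delta x).
    + revert Hloc; apply filter_imp; intros y Hy s Hs; specialize (Hs2 s Hs).
      eexists; apply HD; lra.
    + intros s Hs; specialize (Hs2 s Hs).
      apply continuity_2d_pt_ext_loc with (fun u v => dens delta v * isqrt (S k) (u - v ^ 2)).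
      * assert (Hc : continuity_2d_pt (fun u v => u - v * v) x s)
          by (apply continuity_2d_pt_minus; [|apply continuity_2d_pt_mult];
              first [apply continuity_2d_pt_id1 | apply continuity_2d_pt_id2]).
        destruct (Hc (mkposreal (x - s * s) ltac:(nra))) as [eta Heta]; simpl in Heta.
        exists eta; intros u v Hu Hv; specialize (Heta u v Hu Hv).
        apply Rabs_lt_between in Heta; symmetry.
        apply is_derive_unique, HD; nra.
      * apply continuity_2d_pt_mult.
        -- apply (continuity_1d_2d_pt_comp (dens delta) (fun u v => v));
             [apply continuity_pt_filterlim, dens_continuous | apply continuity_2d_pt_id2].
        -- apply (continuity_1d_2d_pt_comp (isqrt (S k)) (fun u v => u - v ^ 2));
             [apply continuity_pt_filterlim, isqrt_continuous; lra|].
           apply continuity_2d_pt_minus; [apply continuity_2d_pt_id1|].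
           apply continuity_2d_pt_ext with (fun u v => v * v); [intros; simpl; ring|].
           apply continuity_2d_pt_mult; apply continuity_2d_pt_id2.
    + revert Hloc; apply filter_imp; intros y Hy; now apply avg_ex_RInt.
  - apply RInt_ext; intros s Hs; apply is_derive_unique, HD.
    assert (s ^ 2 <= delta ^ 2) by (apply Hs2; lra); lra.
Qed.

(** Replacing [x - s^2] by [x] costs at most [delta^2] times the next
    derivative. *)
Lemma avg_error delta k x A m : 0 < delta -> m + delta ^ 2 <= x -> 0 < m ->
  (forall y, m <= y -> Rabs (isqrt (S k) y) <= A) ->
  Rabs (isqrt k x - avg delta k x / mass delta) <= A * delta ^ 2.
Proof.
  intros Hd Hx Hm HA.
  assert (Hmass := mass_pos delta Hd).
  assert (Hpt : forall s, - delta <= s <= delta ->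
    Rabs (isqrt k x - isqrt k (x - s ^ 2)) <= A * delta ^ 2).
  { intros s Hs; assert (0 <= s ^ 2 <= delta ^ 2) by nra.
    destruct (MVT_gen (isqrt k) (x - s ^ 2) x (isqrt (S k))) as (c & Hc & E).
    - intros y Hy; rewrite Rmin_left, Rmax_right in Hy by lra; apply isqrt_chain; lra.
    - intros y Hy; rewrite Rmin_left, Rmax_right in Hy by lra.
      apply continuity_pt_filterlim, isqrt_continuous; lra.
    - rewrite Rmin_left, Rmax_right in Hc by lra.
      rewrite E, Rabs_mult, (Rabs_pos_eq (x - _)) by lra.
      apply Rmult_le_compat; try lra; [apply Rabs_pos | apply HA; lra]. }
  assert (E : isqrt k x - avg delta k x / mass delta =
    RInt (fun s => dens delta s * (isqrt k x - isqrt k (x - s ^ 2))) (- delta) delta / mass delta).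
  { transitivity ((isqrt k x * mass delta - avg delta k x) / mass delta); [field; lra|].
    f_equal; unfold mass, avg.
    assert (X1 : ex_RInt (dens delta) (- delta) delta)
      by (apply (ex_RInt_continuous (V := R_CompleteNormedModule)); intros; apply dens_continuous).
    assert (X2 := avg_ex_RInt delta k x Hd ltac:(lra)).
    rewrite <- (RInt_scal (V := R_CompleteNormedModule) (dens delta)) by exact X1.
    rewrite <- (RInt_minus (V := R_CompleteNormedModule));
      [|now apply (ex_RInt_scal (V := R_CompleteNormedModule)) | exact X2].
    apply RInt_ext; intros s _; unfold minus, plus, opp, scal; simpl; unfold mult; simpl; ring. }
  rewrite E; unfold Rdiv; rewrite Rabs_mult, (Rabs_pos_eq (/ mass delta))
    by (left; now apply Rinv_0_lt_compat).
  apply Rmult_le_reg_r with (mass delta); [exact Hmass|].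
  rewrite Rmult_assoc, Rinv_l, Rmult_1_r by lra.
  assert (X : forall s, - delta <= s <= delta ->
    continuous (fun s => dens delta s * (isqrt k x - isqrt k (x - s ^ 2))) s).
  { intros s Hs; apply (continuous_mult (K := R_AbsRing)); [apply dens_continuous|].
    apply (continuous_minus (V := R_NormedModule)); [apply continuous_const|].
    apply (continuous_comp (fun s => x - s ^ 2) (isqrt k)).
    - apply (ex_derive_continuous (K := R_AbsRing) (V := R_NormedModule)); auto_derive; trivial.
    - apply isqrt_continuous; nra. }
  eapply Rle_trans; [apply abs_RInt_le; [lra|]|].
  { apply (ex_RInt_continuous (V := R_CompleteNormedModule)); intros s Hs;
    rewrite Rmin_left, Rmax_right in Hs by lra; now apply X. }
  unfold mass; rewrite <- (RInt_scal (V := R_CompleteNormedModule) (dens delta))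
    by (apply (ex_RInt_continuous (V := R_CompleteNormedModule)); intros; apply dens_continuous).
  apply RInt_le; [lra | | |].
  - apply (ex_RInt_continuous (V := R_CompleteNormedModule)); intros s Hs.
    rewrite Rmin_left, Rmax_right in Hs by lra.
    apply (continuous_comp _ Rabs); [now apply X | apply continuous_Rabs].
  - apply (ex_RInt_scal (V := R_CompleteNormedModule)), (ex_RInt_continuous (V := R_CompleteNormedModule));
      intros; apply dens_continuous.
  - intros s Hs; unfold scal; simpl; unfold mult; simpl.
    rewrite Rabs_mult, (Rabs_pos_eq (dens delta s)) by apply bump_ge0.
    rewrite Rmult_comm; apply Rmult_le_compat_r; [apply bump_ge0 | apply Hpt; lra].
Qed.

(** * The complex coordinate centred at a point *)

Section Centre.
Variable x0 : plane.

Definition zc (p : plane) : C := (fst p - fst x0, snd p - snd x0).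
Definition zcb (p : plane) : C := (fst p - fst x0, - (snd p - snd x0)).
Definition nsq (p : plane) : R := (fst p - fst x0) ^ 2 + (snd p - snd x0) ^ 2.

Lemma zc_eq p : zc p = (RtoC (fst p) - RtoC (fst x0) + Ci * (RtoC (snd p) - RtoC (snd x0)))%C.
Proof. unfold zc, RtoC, Ci, Cplus, Cminus, Cmult, Copp, Cplus; simpl; f_equal; ring. Qed.

Lemma zcb_eq p : zcb p = (RtoC (fst p) - RtoC (fst x0) - Ci * (RtoC (snd p) - RtoC (snd x0)))%C.
Proof. unfold zcb, RtoC, Ci, Cplus, Cminus, Cmult, Copp, Cplus; simpl; f_equal; ring. Qed.

Lemma zc_zcb p : (zc p * zcb p)%C = RtoC (nsq p).
Proof. unfold zc, zcb, nsq, Cmult, RtoC; simpl; f_equal; ring. Qed.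

Lemma smooth_x d : smooth (fun p => (RtoC (coord d p) - RtoC (coord d x0))%C).
Proof. apply smooth_minus; [apply smooth_coord | apply smooth_const]. Qed.

Lemma partial_x d d' :
  partial d (fun p => (RtoC (coord d' p) - RtoC (coord d' x0))%C) = fun _ => RtoC (kron d d').
Proof.
  rewrite minus_as_scal, partial_plus, partial_scal, partial_const, partial_coord
    by auto using smooth_coord, smooth_const, smooth_scal.
  apply functional_extensionality; intros; ring.
Qed.

Lemma zc_sum : zc = fun p => ((RtoC (coord axis1 p) - RtoC (coord axis1 x0)) +
  Ci * (RtoC (coord axis2 p) - RtoC (coord axis2 x0)))%C.
Proof. apply functional_extensionality, zc_eq. Qed.

Lemma zcb_sum : zcb = fun p => ((RtoC (coord axis1 p) - RtoC (coord axis1 x0)) +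
  (- Ci) * (RtoC (coord axis2 p) - RtoC (coord axis2 x0)))%C.
Proof. apply functional_extensionality; intros p; rewrite zcb_eq; simpl; ring. Qed.

Lemma smooth_zc : smooth zc.
Proof. rewrite zc_sum; apply smooth_plus; [|apply smooth_scal]; apply smooth_x. Qed.

Lemma smooth_zcb : smooth zcb.
Proof. rewrite zcb_sum; apply smooth_plus; [|apply smooth_scal]; apply smooth_x. Qed.

Lemma rsmooth_nsq : rsmooth nsq.
Proof.
  unfold rsmooth; apply smooth_ext with (fun p => (zc p * zcb p)%C); [apply zc_zcb|].
  apply smooth_mult; [apply smooth_zc | apply smooth_zcb].
Qed.

(** For [c = -i] and [c = i] this is twice the Wirtinger derivative in [z] and
    in its conjugate. *)
Definition wirt (c : C) (phi : plane -> C) : plane -> C :=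
  fun p => (partial axis1 phi p + c * partial axis2 phi p)%C.

Lemma smooth_wirt c phi : smooth phi -> smooth (wirt c phi).
Proof. intros; apply smooth_plus; [|apply smooth_scal]; now apply smooth_partial. Qed.

Lemma wirt_mult c f g : smooth f -> smooth g ->
  wirt c (fun p => (f p * g p)%C) = fun p => (wirt c f p * g p + f p * wirt c g p)%C.
Proof.
  intros Hf Hg; apply functional_extensionality; intros p; unfold wirt.
  rewrite !partial_mult by assumption; ring.
Qed.

Lemma wirt_pow c f n : smooth f ->
  wirt c (fun p => (f p ^ n)%C) = fun p => (RtoC (INR n) * f p ^ (pred n) * wirt c f p)%C.
Proof.
  intros Hf; induction n as [|n IH].
  - simpl; unfold wirt; rewrite !partial_const; apply functional_extensionality; intros p; simpl; ring.
  - change (fun p => (f p ^ S n)%C) with (fun p => (f p * f p ^ n)%C).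
    rewrite wirt_mult, IH by auto using smooth_pow.
    apply functional_extensionality; intros p; rewrite S_INR, RtoC_plus.
    destruct n; simpl pred; simpl Cpow; [simpl INR|]; ring.
Qed.

Lemma wirt_zc c : wirt c zc = fun _ => (RtoC 1 + c * Ci)%C.
Proof.
  apply functional_extensionality; intros p; unfold wirt.
  rewrite zc_sum, !partial_plus, !partial_scal, !partial_x
    by auto using smooth_x, smooth_scal; simpl; ring.
Qed.

Lemma wirt_zcb c : wirt c zcb = fun _ => (RtoC 1 - c * Ci)%C.
Proof.
  apply functional_extensionality; intros p; unfold wirt.
  rewrite zcb_sum, !partial_plus, !partial_scal, !partial_x
    by auto using smooth_x, smooth_scal; simpl; ring.
Qed.

Lemma wirt_local (U : plane -> Prop) c phi psi : open U ->
  (forall p, U p -> phi p = psi p) -> forall p, U p -> wirt c phi p = wirt c psi p.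
Proof.
  intros HU H p Hp; unfold wirt.
  rewrite (iter_partial_local U phi psi HU H (axis1 :: nil) p Hp : partial axis1 phi p = _).
  now rewrite (iter_partial_local U phi psi HU H (axis2 :: nil) p Hp : partial axis2 phi p = _).
Qed.

Lemma wirt_nsq c p : wirt c (fun q => RtoC (nsq q)) p =
  ((RtoC 1 + c * Ci) * zcb p + (RtoC 1 - c * Ci) * zc p)%C.
Proof.
  replace (fun q => RtoC (nsq q)) with (fun q => (zc q * zcb q)%C)
    by (apply functional_extensionality, zc_zcb).
  rewrite wirt_mult, wirt_zc, wirt_zcb by auto using smooth_zc, smooth_zcb; ring.
Qed.

(** Each coordinate is an affine combination of [z] and its conjugate, so real
    monomials are combinations of the complex ones. *)
Lemma complex_polynomials_dense v : compact_distribution v ->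
  (forall a b, v (fun p => (zcb p ^ a * zc p ^ b)%C) = RtoC 0) -> dist_zero v.
Proof.
  intros Hv H0; apply polynomials_dense; [exact Hv|].
  assert (Hg : forall k l a b, v (fun p : plane => (RtoC (fst p) ^ k * RtoC (snd p) ^ l *
    (zcb p ^ a * zc p ^ b))%C) = RtoC 0).
  2:{ intros k l; rewrite <- (Hg k l O O); f_equal; apply functional_extensionality.
      intros p; simpl; ring. }
  assert (Sx : forall k, smooth (fun p : plane => (RtoC (fst p) ^ k)%C))
    by (intros; apply smooth_pow, (smooth_coord axis1)).
  assert (Sy : forall k, smooth (fun p : plane => (RtoC (snd p) ^ k)%C))
    by (intros; apply smooth_pow, (smooth_coord axis2)).
  assert (Sm : forall k l a b, smooth (fun p : plane => (RtoC (fst p) ^ k * RtoC (snd p) ^ l *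
    (zcb p ^ a * zc p ^ b))%C)).
  { intros; apply smooth_mult; apply smooth_mult; auto; apply smooth_pow;
      [apply smooth_zcb | apply smooth_zc]. }
  induction k as [|k IHk].
  - induction l as [|l IHl]; intros a b.
    + rewrite <- (H0 a b); f_equal; apply functional_extensionality; intros p; simpl; ring.
    + set (f := fun a b (p : plane) => (RtoC (fst p) ^ 0 * RtoC (snd p) ^ l * (zcb p ^ a * zc p ^ b))%C).
      replace (fun p : plane => (RtoC (fst p) ^ 0 * RtoC (snd p) ^ S l * (zcb p ^ a * zc p ^ b))%C)
        with (fun p : plane => (RtoC (snd x0) * f a b p +
           (RtoC (/ 2) * Ci * f (S a) b p + - (RtoC (/ 2) * Ci) * f a (S b) p))%C).
      * rewrite !(cd_plus v Hv), !(cd_scal v Hv)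
          by (unfold f; auto using smooth_plus, smooth_scal).
        unfold f; rewrite !IHl; ring.
      * apply functional_extensionality; intros p; unfold f; simpl Cpow.
        assert (E : RtoC (snd p) = (RtoC (snd x0) + RtoC (/2) * Ci * (zcb p - zc p))%C).
        { unfold zc, zcb, RtoC, Ci, Cplus, Cminus, Cmult, Copp, Cplus; simpl; f_equal; field. }
        generalize (RtoC (snd p) ^ l)%C; intros Y; rewrite E; ring.
  - intros l a b.
    set (f := fun a b (p : plane) => (RtoC (fst p) ^ k * RtoC (snd p) ^ l * (zcb p ^ a * zc p ^ b))%C).
    replace (fun p : plane => (RtoC (fst p) ^ S k * RtoC (snd p) ^ l * (zcb p ^ a * zc p ^ b))%C)
        with (fun p : plane => (RtoC (fst x0) * f a b p +
           (RtoC (/ 2) * f (S a) b p + RtoC (/ 2) * f a (S b) p))%C).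
    + rewrite !(cd_plus v Hv), !(cd_scal v Hv)
          by (unfold f; auto using smooth_plus, smooth_scal).
      unfold f; rewrite !IHk; ring.
    + apply functional_extensionality; intros p; unfold f; simpl Cpow.
      assert (E : RtoC (fst p) = (RtoC (fst x0) + RtoC (/2) * (zcb p + zc p))%C).
      { unfold zc, zcb, RtoC, Ci, Cplus, Cminus, Cmult, Copp, Cplus; simpl; f_equal; field. }
      generalize (RtoC (fst p) ^ k)%C; intros Y; rewrite E; ring.
Qed.

End Centre.

(** * Powers of a ratio less than 1 *)

(** [q^n = exp (- lam n)], and the exponential beats all powers. *)
Lemma pow_geom_small K q eps : 0 < q < 1 -> 0 < eps ->
  exists n, (K <= n)%nat /\ INR n ^ K * q ^ (n - K) < eps.
Proof.
  intros Hq Heps.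
  set (lam := - ln q).
  assert (Hl : 0 < lam) by (unfold lam; pose proof (ln_increasing q 1 ltac:(lra) ltac:(lra)); rewrite ln_1 in *; lra).
  assert (Eq : q = exp (- lam)) by (unfold lam; rewrite Ropp_involutive, exp_ln; lra).
  set (F := INR (Factorial.fact (K + 2))).
  assert (HF : 0 < F) by apply INR_fact_lt_0.
  (* [n^K q^n <= F lam^(-K-2) n^(-2)] *)
  set (A := F / lam ^ (K + 2) / q ^ K).
  assert (HA : 0 < A).
  { unfold A; apply Rdiv_lt_0_compat; [apply Rdiv_lt_0_compat; [exact HF|]|]; apply pow_lt; lra. }
  destruct (archimed_cor1 (eps / A)) as (n0 & Hn0 & Hp0); [now apply Rdiv_lt_0_compat|].
  set (n := Nat.max n0 K).
  assert (Hn : 0 < INR n0) by now apply lt_0_INR.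
  assert (Hnn : INR n0 <= INR n) by (apply le_INR; unfold n; lia).
  exists n; split; [unfold n; lia|].
  assert (H1 := pow_exp_le K (lam * INR n) ltac:(nra)); fold F in H1.
  assert (Hqn : exp (- (lam * INR n)) = q ^ n).
  { rewrite Eq; clear -n; induction n as [|m IH]; [simpl; rewrite Rmult_0_r, Ropp_0; apply exp_0|].
    rewrite S_INR; replace (- (lam * (INR m + 1))) with (- lam + - (lam * INR m)) by ring.
    rewrite exp_plus, IH; reflexivity. }
  rewrite Hqn in H1.
  assert (Hqk : q ^ n = q ^ (n - K) * q ^ K).
  { rewrite <- pow_add; f_equal; unfold n; lia. }
  rewrite Hqk, Rpow_mult_distr, Rpow_mult_distr in H1.
  assert (P1 : 0 < q ^ K) by (apply pow_lt; lra).
  assert (P2 : 0 < lam ^ K) by (apply pow_lt; lra).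
  assert (P3 : 0 < lam ^ 2) by (apply pow_lt; lra).
  assert (H2 : INR n ^ K * q ^ (n - K) <= A / INR n ^ 2).
  { apply Rmult_le_reg_r with (lam ^ K * q ^ K); [nra|].
    replace (A / INR n ^ 2 * (lam ^ K * q ^ K)) with (F / (lam ^ 2 * INR n ^ 2)).
    - eapply Rle_trans; [|exact H1]; right; ring.
    - unfold A; rewrite pow_add; field; lra. }
  eapply Rle_lt_trans; [exact H2|].
  assert (1 <= INR n) by (apply (le_INR 1); unfold n; lia).
  apply Rle_lt_trans with (A * / INR n0).
  - unfold Rdiv; apply Rmult_le_compat_l; [lra|]; apply Rinv_le_contravar; [exact Hn | simpl; nra].
  - apply Rmult_lt_compat_l with (r := A) in Hn0; [|exact HA].
    replace (A * (eps / A)) with eps in Hn0 by (field; lra); exact Hn0.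
Qed.

(** The [k]-th derivative of [(1 - x / T)^n]. *)
Fixpoint geom (T : R) (n k : nat) (x : R) : R :=
  match k with
  | O => (1 - x / T) ^ n
  | S j => - (INR n / T) * geom T (pred n) j x
  end.

Lemma geom_chain T n I : T <> 0 -> chain I (geom T n).
Proof.
  intros HT k x _; revert n; induction k as [|k IH]; intros n.
  - simpl; auto_derive; [trivial|].
    replace (1 + - (x * / T)) with (1 - x / T) by (unfold Rdiv; ring).
    generalize ((1 - x / T) ^ pred n); intros y; field; exact HT.
  - exact (is_derive_scal _ _ (- (INR n / T)) _ (IH (pred n))).
Qed.

Lemma geom_le T n k q x : 1 <= T -> Rabs (1 - x / T) <= q -> q <= 1 -> (k <= n)%nat ->
  Rabs (geom T n k x) <= INR n ^ k * q ^ (n - k).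
Proof.
  intros HT Hx Hq; revert n; induction k as [|k IH]; intros n Hk.
  - simpl; rewrite Nat.sub_0_r, Rmult_1_l, <- RPow_abs.
    apply pow_incr; split; [apply Rabs_pos | exact Hx].
  - cbn [geom]; destruct n as [|n]; [lia|]; cbn [pred].
    rewrite Rabs_mult, Rabs_Ropp; cbn [pow]; rewrite Rmult_assoc; apply Rmult_le_compat;
      try apply Rabs_pos.
    + unfold Rdiv; rewrite Rabs_mult, (Rabs_pos_eq (INR (S n))), Rabs_pos_eq
        by (try apply pos_INR; left; apply Rinv_0_lt_compat; lra).
      rewrite <- (Rmult_1_r (INR (S n))) at 2; apply Rmult_le_compat_l; [apply pos_INR|].
      rewrite <- Rinv_1; apply Rinv_le_contravar; lra.
    + eapply Rle_trans; [apply IH; lia|].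
      replace (S n - S k)%nat with (n - k)%nat by lia.
      apply Rmult_le_compat_r; [apply pow_le; pose proof (Rabs_pos (1 - x / T)); lra|].
      apply pow_incr; split; [apply pos_INR | apply le_INR; lia].
Qed.

(** * Unique continuation *)

Lemma open_nsq x0 c : open (fun p => c < nsq x0 p).
Proof.
  intros p Hp; apply (rsmooth_continuous (nsq x0) p (rsmooth_nsq x0)).
  exact (open_gt c _ Hp).
Qed.

Lemma nsq_le_abs x0 e p : 0 <= e -> nsq x0 p <= e ^ 2 ->
  Rabs (fst p - fst x0) <= e /\ Rabs (snd p - snd x0) <= e.
Proof.
  unfold nsq; intros He H; pose proof (pow2_ge_0 (fst p - fst x0)); pose proof (pow2_ge_0 (snd p - snd x0));
    split; rewrite <- (Rabs_pos_eq e) by exact He;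
    apply Rsqr_le_abs_0; unfold Rsqr; nra.
Qed.

Section UniqueContinuation.
Variables (u : functional) (V : plane -> Prop) (x0 : plane) (eps : R).
Hypothesis Hu : compact_distribution u.
Hypothesis HuV : dist_zero_on V u.
Hypothesis Heps : 0 < eps.
Hypothesis HV : forall p, nsq x0 p <= eps ^ 2 -> V p.

Notation nsq := (nsq x0).
Notation z := (zc x0).
Notation zb := (zcb x0).

Definition outer (p : plane) : Prop := eps ^ 2 < nsq p.

Lemma outer_open : open outer.
Proof. apply open_nsq. Qed.

(** As [u] vanishes on a neighbourhood of the closed disc, it only sees
    functions outside this disc. *)
Lemma eq_outer phi psi : smooth phi -> smooth psi ->
  (forall p, outer p -> phi p = psi p) -> u phi = u psi.
Proof.
  intros S1 S2 H.
  enough (E : u (fun p => (phi p - psi p)%C) = RtoC 0).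
  { rewrite (cd_minus u Hu) in E by assumption.
    replace (u phi) with ((u phi - u psi) + u psi)%C by ring; rewrite E; ring. }
  assert (Hsup : forall p, support (fun p => (phi p - psi p)%C) p -> nsq p <= eps ^ 2).
  { intros p Hp; apply Rnot_lt_le; intros Hlt.
    destruct (outer_open p Hlt) as [r Hr], (Hp r) as (y & Hy & Hne).
    apply Hne; rewrite H by (now apply Hr); ring. }
  apply HuV; split; [now apply smooth_minus|]; split.
  - exists x0, (eps + 1); intros p Hp.
    destruct (nsq_le_abs x0 eps p (Rlt_le _ _ Heps) (Hsup p Hp)) as [A1 A2].
    split; [apply (Rle_lt_trans _ _ (eps + 1) A1) | apply (Rle_lt_trans _ _ (eps + 1) A2)]; lra.
  - intros p Hp; now apply HV, Hsup.
Qed.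

(** Equal to [|p - x0|^2] outside the disc, but positive everywhere: its
    inverse square root [sigma] is a globally smooth substitute for
    [1 / |p - x0|] where [u] sees it. *)
Definition sq (p : plane) : R := nsq p + bump 0 (eps ^ 2 - nsq p).

Lemma sq_outer p : outer p -> sq p = nsq p.
Proof. unfold outer, sq; intros H; rewrite bump_0; lra. Qed.

Lemma sq_lower : exists m, 0 < m /\ forall p, m <= sq p.
Proof.
  exists (Rmin (eps ^ 2 / 2) (bump 0 (eps ^ 2 / 2))); split.
  - apply Rmin_glb_lt; [nra | apply bump_pos; nra].
  - intros p; unfold sq.
    assert (0 <= nsq p) by (apply Rplus_le_le_0_compat; apply pow2_ge_0).
    destruct (Rle_lt_dec (eps ^ 2 / 2) (nsq p)).
    + eapply Rle_trans; [apply Rmin_l|]; pose proof (bump_ge0 (eps ^ 2 - nsq p)); lra.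
    + eapply Rle_trans; [apply Rmin_r|].
      pose proof (bump_le (eps ^ 2 / 2) (eps ^ 2 - nsq p) ltac:(lra)); lra.
Qed.

Lemma sq_pos p : 0 < sq p.
Proof. destruct sq_lower as (m & H0 & H); specialize (H p); lra. Qed.

Lemma rsmooth_sq : rsmooth sq.
Proof.
  apply rsmooth_plus; [apply rsmooth_nsq|].
  apply (rsmooth_comp (fun _ => True) bump (fun p => eps ^ 2 - nsq p)); auto using bump_chain.
  apply rsmooth_minus; [apply rsmooth_const | apply rsmooth_nsq].
Qed.

Definition sigma (p : plane) : C := RtoC (isqrt 0 (sq p)).

Lemma smooth_sigma : smooth sigma.
Proof.
  apply (rsmooth_comp (fun x => 0 < x) isqrt sq 0); auto using isqrt_chain, rsmooth_sq, sq_pos.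
Qed.

Lemma sigma_sq p : (RtoC (sq p) * (sigma p * sigma p))%C = RtoC 1.
Proof.
  unfold sigma; rewrite <- !RtoC_mult, isqrt_0; f_equal.
  pose proof (sq_pos p) as Hp; assert (0 < sqrt (sq p)) by now apply sqrt_lt_R0.
  rewrite <- (sqrt_sqrt (sq p)) at 1 by lra; field; lra.
Qed.

Lemma wirt_sigma c p : wirt c sigma p =
  (RtoC (- / 2) * sigma p ^ 3 * wirt c (fun q => RtoC (sq q)) p)%C.
Proof.
  assert (Hd : forall d, partial d sigma p =
    (RtoC (- / 2) * sigma p ^ 3 * partial d (fun q => RtoC (sq q)) p)%C).
  { intros d; unfold sigma at 1.
    rewrite (is_partial_unique _ _ _ _ (is_partial_comp _ isqrt sq 0 d p isqrt_chain rsmooth_sq (sq_pos p))).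
    replace (RtoC (isqrt 1 (sq p))) with (RtoC (- / 2) * sigma p ^ 3)%C; [ring|].
    unfold sigma; rewrite <- RtoC_pow, <- RtoC_mult; f_equal.
    unfold isqrt; simpl; field; apply Rgt_not_eq, sqrt_lt_R0, sq_pos. }
  unfold wirt; rewrite !Hd; ring.
Qed.

(** What the vanishing of the ray transform provides: [u] kills all
    derivatives of averages of [(|p - x0|^2 - s^2)^(-1/2)] over small [s]. *)
Hypothesis Havg : forall delta, 0 < delta < eps -> exists Psi,
  smooth Psi /\ (forall w, u (iter_partial w Psi) = RtoC 0) /\
  forall p, outer p -> Psi p = RtoC (avg delta 0 (nsq p)).

(** Let [delta] tend to 0: the averages divided by their mass converge to
    [sigma] in every [C^N] norm, because all derivatives of [avg delta]
    converge and [jet_le_comp] transfers this to the plane. *)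
Lemma killed_sigma w : u (iter_partial w sigma) = RtoC 0.
Proof.
  set (v := fun phi => u (iter_partial w phi)).
  assert (Hv : compact_distribution v) by now apply cd_iter.
  destruct (cd_limit v Hv) as (N & M & HM & Hlim).
  apply (Hlim sigma smooth_sigma); intros e He.
  destruct sq_lower as (m & Hm & Hsq).
  destruct (isqrt_bound (S N) (m / 2) ltac:(lra)) as (A & HA0 & HA).
  destruct (jet_le_comp (fun x => m / 2 < x) sq N M (fun _ => RtoC 1)) as (K & HK0 & HK);
    [apply rsmooth_sq | intros p; specialize (Hsq p); lra | apply smooth_const |].
  assert (Hdl : exists delta, 0 < delta < eps /\ delta ^ 2 <= m / 4 /\ K * (A * delta ^ 2) <= e).
  { set (delta := Rmin (eps / 2) (Rmin (m / 4) (Rmin 1 (e / (K * A + 1))))).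
    assert (HKA : 0 < K * A + 1) by nra.
    assert (0 < e / (K * A + 1)) by now apply Rdiv_lt_0_compat.
    assert (D0 : 0 < delta) by (unfold delta; repeat apply Rmin_glb_lt; lra).
    assert (D1 : delta <= eps / 2) by apply Rmin_l.
    assert (D2 : delta <= m / 4).
    { eapply Rle_trans; [apply Rmin_r | apply Rmin_l]. }
    assert (D3 : delta <= 1).
    { eapply Rle_trans; [apply Rmin_r|]; eapply Rle_trans; [apply Rmin_r | apply Rmin_l]. }
    assert (D4 : delta <= e / (K * A + 1)).
    { eapply Rle_trans; [apply Rmin_r|]; eapply Rle_trans; [apply Rmin_r | apply Rmin_r]. }
    exists delta; split; [lra|]; split; [nra|].
    assert (delta ^ 2 <= e / (K * A + 1)) by nra.
    apply Rle_trans with ((K * A + 1) * (e / (K * A + 1))); [nra|].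
    right; field; lra. }
  destruct Hdl as (delta & Hd & Hd2 & HdK).
  destruct (Havg delta Hd) as (Psi & SPsi & HPsi & EPsi).
  assert (Hmass := mass_pos delta (proj1 Hd)).
  assert (Hrange : forall p, delta ^ 2 < sq p) by (intros p; specialize (Hsq p); lra).
  assert (Savg : rsmooth (fun p => avg delta 0 (sq p))).
  { apply (rsmooth_comp (fun x => delta ^ 2 < x) (avg delta) sq 0);
      auto using avg_chain, rsmooth_sq; apply avg_chain; lra. }
  exists (fun p => (RtoC (/ mass delta) * RtoC (avg delta 0 (sq p)))%C).
  assert (Sm : smooth (fun p => (RtoC (/ mass delta) * RtoC (avg delta 0 (sq p)))%C))
    by now apply smooth_scal.
  split; [exact Sm|]; split.
  - unfold v; rewrite (eq_outer _ (iter_partial w (fun p => (RtoC (/ mass delta) * Psi p)%C))).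
    + rewrite iter_partial_scal, (cd_scal u Hu), HPsi by auto using smooth_iter; ring.
    + now apply smooth_iter.
    + now apply smooth_iter, smooth_scal.
    + apply iter_partial_local; [exact outer_open|]; intros p Hp.
      now rewrite EPsi, sq_outer.
  - apply jet_le_weaken with N M (K * (A * delta ^ 2)); auto with real.
    replace (fun p => (sigma p - RtoC (/ mass delta) * RtoC (avg delta 0 (sq p)))%C) with
      (fun p => (RtoC 1 * RtoC (isqrt 0 (sq p) - avg delta 0 (sq p) / mass delta))%C).
    2:{ apply functional_extensionality; intros p; unfold sigma, Rdiv.
        rewrite RtoC_minus, RtoC_mult; ring. }
    apply (HK (fun k x => isqrt k x - avg delta k x / mass delta) 0%nat).
    + intros k x Hx; apply (is_derive_minus (K := R_AbsRing) (V := R_NormedModule)).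
      * apply isqrt_chain; lra.
      * unfold Rdiv; rewrite (Rmult_comm (avg delta (S k) x)).
        apply is_derive_ext with (fun x => / mass delta * avg delta k x);
          [intros t; apply Rmult_comm|].
        apply is_derive_scal, (avg_chain delta); lra.
    + apply Rmult_le_pos; [exact HA0 | apply pow2_ge_0].
    + intros k p Hk Hp; apply (avg_error delta k (sq p) A (m / 2)); try lra.
      * specialize (Hsq p); lra.
      * intros y Hy; apply HA; [lia | exact Hy].
Qed.

(** Outside the disc this is [zb^a z^b |z|^(-2c-1)]; on the diagonal
    [c = a + b] it is [|z|^(-1) z^(-a) zb^(-b)], and for [c = 0] it is
    [1 / |z|] times a polynomial. *)
Definition monom (a b c : nat) (p : plane) : C := (zb p ^ a * z p ^ b * sigma p ^ (2 * c + 1))%C.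

Lemma smooth_monom a b c : smooth (monom a b c).
Proof.
  apply smooth_mult; [apply smooth_mult|]; apply smooth_pow;
    [apply smooth_zcb | apply smooth_zc | apply smooth_sigma].
Qed.

Lemma sigma_outer p : outer p -> (zb p * z p * (sigma p * sigma p))%C = RtoC 1.
Proof.
  intros H; rewrite <- (sigma_sq p), sq_outer by exact H.
  rewrite (Cmult_comm (zb p)), zc_zcb; reflexivity.
Qed.

Lemma monom_outer a b c p : outer p -> monom (S a) (S b) (S c) p = monom a b c p.
Proof.
  intros H; unfold monom.
  replace (2 * S c + 1)%nat with (S (S (2 * c + 1))) by lia.
  generalize (2 * c + 1)%nat; intros n; cbn [Cpow].
  transitivity ((zb p * z p * (sigma p * sigma p)) * (zb p ^ a * z p ^ b * sigma p ^ n))%C;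
    [ring | rewrite sigma_outer by exact H; ring].
Qed.

Lemma wirt_monom c a b n p : outer p -> wirt c (monom a b n) p =
  ((RtoC 1 - c * Ci) * (RtoC (INR a) * zb p ^ pred a * z p ^ b * sigma p ^ (2 * n + 1))
   + (RtoC 1 + c * Ci) * (RtoC (INR b) * zb p ^ a * z p ^ pred b * sigma p ^ (2 * n + 1))
   + RtoC (- (INR n + / 2)) * ((RtoC 1 + c * Ci) * monom (S a) b (S n) p
                               + (RtoC 1 - c * Ci) * monom a (S b) (S n) p))%C.
Proof.
  intros Hp; unfold monom.
  rewrite !wirt_mult, !wirt_pow, wirt_zc, wirt_zcb, wirt_sigma
    by auto using smooth_mult, smooth_pow, smooth_zc, smooth_zcb, smooth_sigma.
  rewrite (wirt_local outer c (fun q => RtoC (sq q)) (fun q => RtoC (nsq q)) outer_open)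
    by (auto; intros; now rewrite sq_outer).
  rewrite wirt_nsq.
  replace (pred (2 * n + 1)) with (2 * n)%nat by lia.
  replace (2 * S n + 1)%nat with (2 * n + 3)%nat by lia.
  rewrite !Cpow_add_r; simpl Cpow.
  replace (RtoC (- (INR n + / 2))) with (RtoC (INR (2 * n + 1)) * RtoC (- / 2))%C.
  2:{ rewrite <- RtoC_mult, plus_INR, mult_INR; f_equal; simpl; field. }
  ring.
Qed.

Lemma killed_wirt c phi : smooth phi -> (forall w, u (iter_partial w phi) = RtoC 0) ->
  forall w, u (iter_partial w (wirt c phi)) = RtoC 0.
Proof.
  intros Hs H w; unfold wirt.
  rewrite iter_partial_plus, iter_partial_scal by auto using smooth_scal, smooth_partial.
  rewrite (cd_plus u Hu), (cd_scal u Hu) by auto using smooth_iter, smooth_scal, smooth_partial.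
  rewrite <- !iter_partial_snoc, !H; ring.
Qed.

Lemma killed_outer_scal c phi psi : smooth phi -> smooth psi -> c <> RtoC 0 ->
  (forall p, outer p -> psi p = (c * phi p)%C) ->
  (forall w, u (iter_partial w psi) = RtoC 0) -> forall w, u (iter_partial w phi) = RtoC 0.
Proof.
  intros S1 S2 Hc H Hpsi w.
  assert (E : (c * u (iter_partial w phi))%C = RtoC 0).
  { rewrite <- (Hpsi w), <- (cd_scal u Hu), <- iter_partial_scal by auto using smooth_iter.
    apply eq_outer; auto using smooth_iter, smooth_scal.
    apply iter_partial_local; [exact outer_open|]; intros p Hp; now rewrite H. }
  replace (u (iter_partial w phi)) with (/ c * (c * u (iter_partial w phi)))%C
    by (field; exact Hc).
  rewrite E; ring.
Qed.

(** Outside the disc [1 / |z| = z^(-1/2) zb^(-1/2)], so the Wirtinger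
    derivatives multiply the diagonal monomial by [-(2 a + 1)] or [-(2 b + 1)]
    while raising [a] or [b] by one. The half-integral exponent is what keeps
    these factors from vanishing. *)
Lemma killed_diag a b w : u (iter_partial w (monom a b (a + b))) = RtoC 0.
Proof.
  revert w; induction a as [|a IHa].
  - induction b as [|b IHb].
    + intros w; replace (monom 0 0 (0 + 0)) with sigma; [apply killed_sigma|].
      apply functional_extensionality; intros p; unfold monom; simpl; ring.
    + apply (killed_outer_scal (RtoC (- (2 * INR b + 1))) _ (wirt Ci (monom 0 b (0 + b))));
        auto using smooth_monom, smooth_wirt, killed_wirt.
      * apply RtoC_neq_0; pose proof (pos_INR b); lra.
      * intros p Hp; rewrite wirt_monom, Ci_sq by exact Hp.
        replace (RtoC (- (2 * INR b + 1))) with (RtoC 2 * RtoC (- (INR b + / 2)))%C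
          by (rewrite <- RtoC_mult; f_equal; field).
        replace (RtoC 2) with (RtoC 1 + RtoC 1)%C by (rewrite <- RtoC_plus; f_equal; ring).
        change (0 + S b)%nat with (S b); change (0 + b)%nat with b; change (INR 0) with 0; ring.
  - apply (killed_outer_scal (RtoC (- (2 * INR a + 1))) _ (wirt (- Ci) (monom a b (a + b))));
        auto using smooth_monom, smooth_wirt, killed_wirt.
    + apply RtoC_neq_0; pose proof (pos_INR a); lra.
    + intros p Hp; rewrite wirt_monom by exact Hp.
      replace (- Ci * Ci)%C with (RtoC 1) by (transitivity (- (Ci * Ci))%C; [rewrite Ci_sq|]; ring).
      assert (E : (RtoC (INR b) * zb p ^ a * z p ^ pred b * sigma p ^ (2 * (a + b) + 1))%C =
        (RtoC (INR b) * monom (S a) b (S a + b) p)%C).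
      { destruct b as [|b]; [simpl INR; ring|].
        replace (S a + S b)%nat with (S (a + S b)) by lia.
        rewrite monom_outer by exact Hp; unfold monom; simpl pred; ring. }
      rewrite E; replace (S (a + b)) with (S a + b)%nat by lia.
      replace (RtoC (- (2 * INR a + 1))) with
        ((RtoC 1 + RtoC 1) * (RtoC (INR b) + RtoC (- (INR (a + b) + / 2))))%C.
      * ring.
      * rewrite <- !RtoC_plus, <- RtoC_mult, plus_INR; f_equal; field.
Qed.

(** [|z|^2 sigma^2 = 1] outside the disc. *)
Lemma killed_shift j a b c : u (monom a b c) = u (monom (a + j) (b + j) (c + j)).
Proof.
  induction j as [|j IH].
  - now rewrite !Nat.add_0_r.
  - rewrite IH, !Nat.add_succ_r; apply eq_outer; auto using smooth_monom.
    intros p Hp; now rewrite monom_outer.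
Qed.

Lemma killed_high a b c : (a + b <= c)%nat -> u (monom a b c) = RtoC 0.
Proof.
  intros H; rewrite (killed_shift (c - (a + b))).
  replace (c + (c - (a + b)))%nat with (a + (c - (a + b)) + (b + (c - (a + b))))%nat by lia.
  apply (killed_diag _ _ nil).
Qed.

(** Dividing by [x = sigma^2] lowers the last index by one. As [x] stays
    between two positive constants on the square, [1 / x] is the limit in
    [C^N] of the partial sums of [sum_i (1 - x / T)^i / T], which are
    polynomials in [x]; the products of these with monomials of larger index
    are killed by [u]. *)
Lemma killed_descend a b c : (forall c', (c < c')%nat -> u (monom a b c') = RtoC 0) ->
  u (monom a b c) = RtoC 0.
Proof.
  intros H.
  set (g := fun p => (RtoC (sq p) * monom a b (S c) p)%C).
  assert (Sg : smooth g) by (apply smooth_mult; [apply rsmooth_sq | apply smooth_monom]).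
  replace (monom a b c) with g.
  2:{ apply functional_extensionality; intros p; unfold g, monom.
      replace (2 * S c + 1)%nat with (S (S (2 * c + 1))) by lia.
      generalize (2 * c + 1)%nat; intros n; cbn [Cpow].
      transitivity ((RtoC (sq p) * (sigma p * sigma p)) *
         (zb p ^ a * z p ^ b * sigma p ^ n))%C; [ring|].
      rewrite sigma_sq; ring. }
  destruct (cd_order u Hu) as (N & M & K & HM & HK & Hord).
  set (xr := fun p => isqrt 0 (sq p) * isqrt 0 (sq p)).
  assert (Ex : forall p, RtoC (xr p) = (sigma p * sigma p)%C) by (intros p; apply RtoC_mult).
  assert (Sx : rsmooth xr) by (apply rsmooth_mult; apply smooth_sigma).
  assert (Exs : forall p, xr p = / sq p).
  { intros p; unfold xr; rewrite isqrt_0, <- Rinv_mult, sqrt_sqrt; [reflexivity|].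
    left; apply sq_pos. }
  destruct (continuous_bounded_real sq M) as (B1 & B10 & HB1).
  { intros p; apply rsmooth_continuous, rsmooth_sq. }
  destruct sq_lower as (m & Hm & Hsq).
  set (T := Rmax 1 (/ m)).
  assert (HT1 : 1 <= T) by apply Rmax_l.
  assert (HTm : / m <= T) by apply Rmax_r.
  set (q := fun p => (RtoC 1 - RtoC (/ T) * RtoC (xr p))%C).
  assert (Sq : smooth q) by (apply smooth_minus; [apply smooth_const | now apply smooth_scal]).
  assert (Eq : forall p, q p = (RtoC 1 - RtoC (/ T) * (sigma p * sigma p))%C)
    by (intros p; unfold q; now rewrite Ex).
  (* expanding [q^i] only produces monomials of larger last index *)
  assert (Hq : forall i c', (c < c')%nat -> u (fun p => (q p ^ i * monom a b c' p)%C) = RtoC 0).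
  { induction i as [|i IH]; intros c' Hc'.
    - rewrite <- (H c' Hc'); f_equal; apply functional_extensionality; intros p; simpl; ring.
    - replace (fun p => (q p ^ S i * monom a b c' p)%C) with
        (fun p => (q p ^ i * monom a b c' p - RtoC (/ T) * (q p ^ i * monom a b (S c') p))%C).
      + rewrite (cd_minus u Hu), (cd_scal u Hu), !IH
          by (try lia; auto using smooth_mult, smooth_pow, smooth_monom, smooth_scal); ring.
      + apply functional_extensionality; intros p; unfold monom.
        replace (2 * S c' + 1)%nat with (S (S (2 * c' + 1))) by lia.
        generalize (2 * c' + 1)%nat; intros n; cbn [Cpow].
        generalize (q p ^ i)%C; intros Y; rewrite Eq; ring. }
  assert (Hn : forall n, u (fun p => (g p * q p ^ n)%C) = u g).
  { induction n as [|n IH].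
    - f_equal; apply functional_extensionality; intros p; simpl; ring.
    - rewrite <- IH.
      replace (fun p => (g p * q p ^ n)%C) with
        (fun p => (g p * q p ^ S n + RtoC (/ T) * (q p ^ n * monom a b (S c) p))%C).
      + rewrite (cd_plus u Hu), (cd_scal u Hu), Hq
          by (try lia; auto using smooth_mult, smooth_pow, smooth_monom, smooth_scal); ring.
      + apply functional_extensionality; intros p; cbn [Cpow]; unfold g.
        generalize (q p ^ n)%C; intros Y; rewrite Eq.
        transitivity (RtoC (sq p) * monom a b (S c) p * Y
           - RtoC (/ T) * (RtoC (sq p) * (sigma p * sigma p)) * monom a b (S c) p * Y
           + RtoC (/ T) * (Y * monom a b (S c) p))%C; [ring|].
        rewrite sigma_sq; ring. }
  destruct (jet_le_comp (fun _ => True) xr N M g) as (K' & HK' & Hjet); auto.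
  (* [r] bounds the ratio of the geometric series on the square; [1 / 2] only
     keeps it positive *)
  set (r := Rmax (/ 2) (1 - / ((B1 + 1) * T))).
  assert (Hinv : 0 < / ((B1 + 1) * T)) by (apply Rinv_0_lt_compat; nra).
  assert (Hr : 0 < r < 1).
  { unfold r; split; [eapply Rlt_le_trans; [|apply Rmax_l]; lra | apply Rmax_lub_lt; lra]. }
  assert (Hxr : forall p, box M p -> Rabs (1 - xr p / T) <= r).
  { intros p Hp; specialize (HB1 p Hp); specialize (Hsq p); rewrite Exs.
    pose proof (sq_pos p); rewrite Rabs_pos_eq in HB1 by lra.
    assert (X1 : / sq p <= T) by exact (Rle_trans _ _ _ (Rinv_le_contravar m (sq p) Hm Hsq) HTm).
    assert (X2 : / ((B1 + 1) * T) <= / sq p / T).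
    { rewrite Rinv_mult; apply Rmult_le_compat_r; [left; apply Rinv_0_lt_compat; lra|].
      apply Rinv_le_contravar; [assumption | lra]. }
    assert (X3 : / sq p / T <= 1).
    { apply Rmult_le_reg_r with T; [lra|]; unfold Rdiv; rewrite Rmult_assoc, Rinv_l by lra; lra. }
    rewrite Rabs_pos_eq by lra; eapply Rle_trans; [|apply Rmax_r]; lra. }
  apply Cmod_eq_0, Rle_antisym; [|apply Cmod_ge_0].
  apply le_epsilon; intros e He; rewrite Rplus_0_l.
  destruct (pow_geom_small N r (e / (K * K' + 1)) Hr) as (n & HnN & Hsmall).
  { apply Rdiv_lt_0_compat; nra. }
  rewrite <- (Hn n).
  replace (fun p => (g p * q p ^ n)%C) with (fun p => (g p * RtoC (geom T n 0 (xr p)))%C).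
  2:{ apply functional_extensionality; intros p; f_equal.
      replace (q p) with (RtoC (1 - xr p / T)); [apply RtoC_pow|].
      unfold q, Rdiv; rewrite RtoC_minus, RtoC_mult; ring. }
  set (B := INR n ^ N * r ^ (n - N)) in *.
  assert (HB : 0 <= B).
  { apply Rmult_le_pos; apply pow_le; [apply pos_INR | lra]. }
  apply Rle_trans with (K * (K' * B)).
  - apply Hord; [| nra |].
    + apply smooth_mult; [exact Sg|].
      apply (rsmooth_comp (fun _ => True) (geom T n) xr 0); auto.
      apply geom_chain; lra.
    + apply Hjet; [apply geom_chain; lra | exact HB |].
      intros k p Hk Hp; simpl in Hk.
      eapply Rle_trans; [apply (geom_le T n k r); [exact HT1 | now apply Hxr | lra | lia]|].
      destruct (Nat.eq_dec N 0) as [HN0|HN0].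
      { unfold B; replace k with N by lia; lra. }
      assert (1 <= INR n) by (apply (le_INR 1); lia).
      apply Rmult_le_compat; try (apply pow_le; first [apply pos_INR | lra]).
      * now apply Rle_pow.
      * replace (n - k)%nat with (n - N + (N - k))%nat by lia; rewrite pow_add.
        rewrite <- (Rmult_1_r (r ^ (n - N))) at 2; apply Rmult_le_compat_l; [apply pow_le; lra|].
        rewrite <- (pow1 (N - k)); apply pow_incr; lra.
  - assert (Hlt : B * (K * K' + 1) < e).
    { apply Rmult_lt_compat_r with (r := K * K' + 1) in Hsmall; [|nra].
      replace (e / (K * K' + 1) * (K * K' + 1)) with e in Hsmall by (field; nra); exact Hsmall. }
    nra.
Qed.

Lemma killed_all a b c : u (monom a b c) = RtoC 0.
Proof.
  assert (H : forall k c, (a + b <= c + k)%nat -> u (monom a b c) = RtoC 0).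
  { induction k as [|k IH]; intros c' Hc'; [apply killed_high; lia|].
    apply killed_descend; intros c'' Hc''; apply IH; lia. }
  apply (H (a + b)%nat); lia.
Qed.

(** The distribution [sigma u] kills all polynomials, hence vanishes, and
    [sigma] has no zero. *)
Lemma unique_continuation : dist_zero u.
Proof.
  set (v := fun phi => u (fun p => (sigma p * phi p)%C)).
  assert (Hv : compact_distribution v) by (apply cd_mult; [exact Hu | apply smooth_sigma]).
  assert (Hz : dist_zero v).
  { apply (complex_polynomials_dense x0); [exact Hv|]; intros a b.
    rewrite <- (killed_all a b 0); unfold v; f_equal.
    apply functional_extensionality; intros p; unfold monom; simpl; ring. }
  intros phi Sphi; rewrite <- (Hz (fun p => (RtoC (sq p) * sigma p * phi p)%C)).
  - unfold v; f_equal; apply functional_extensionality; intros p.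
    transitivity ((RtoC (sq p) * (sigma p * sigma p)) * phi p)%C; [rewrite sigma_sq|]; ring.
  - apply smooth_mult; [apply smooth_mult|]; [apply rsmooth_sq | apply smooth_sigma | exact Sphi].
Qed.

End UniqueContinuation.

(** * Integrals of complex functions depending on a parameter *)

Notation CRInt := (RInt (V := C_R_CompleteNormedModule)).

Lemma ex_CRInt (f : R -> C) a b : (forall t, continuous (U := C_UniformSpace) f t) ->
  ex_RInt (V := C_R_NormedModule) f a b.
Proof. intros H; apply (ex_RInt_continuous (V := C_R_CompleteNormedModule)); intros t _; apply H. Qed.

Lemma CRInt_components (f : R -> C) a b : (forall t, continuous (U := C_UniformSpace) f t) ->
  Re (CRInt f a b) = RInt (fun t => Re (f t)) a b /\
  Im (CRInt f a b) = RInt (fun t => Im (f t)) a b.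
Proof.
  intros H; pose proof (RInt_correct (V := C_R_CompleteNormedModule) f a b (ex_CRInt f a b H)) as E.
  split; symmetry; apply is_RInt_unique.
  - exact (is_RInt_fct_extend_fst (U := R_NormedModule) (V := R_NormedModule) f a b _ E).
  - exact (is_RInt_fct_extend_snd (U := R_NormedModule) (V := R_NormedModule) f a b _ E).
Qed.

Lemma CRInt_RtoC (f : R -> R) a b : (forall t, continuous f t) ->
  CRInt (fun t => RtoC (f t)) a b = RtoC (RInt f a b).
Proof.
  intros H; destruct (CRInt_components (fun t => RtoC (f t)) a b) as [E1 E2].
  { intros t; now apply continuous_RtoC. }
  apply injective_projections; simpl; [exact E1|].
  etransitivity; [exact E2|]; simpl; rewrite RInt_const; apply Rmult_0_r.
Qed.

(** Compactness of the interval makes the continuity in the parameter uniform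
    in the variable of integration. *)
Lemma param_close (f : plane -> R -> R) a b p (eps : posreal) :
  (forall t, continuous (fun q : plane * R => f (fst q) (snd q)) (p, t)) ->
  locally p (fun q => forall t, a <= t <= b -> Rabs (f q t - f p t) <= eps).
Proof.
  intros Hf.
  assert (Hd : forall t, exists d : posreal, forall q t', ball p d q -> ball t d t' ->
    Rabs (f q t' - f p t) < eps / 2).
  { intros t; destruct (Hf t (ball (f p t) (mkposreal (eps / 2) ltac:(pose proof (cond_pos eps); lra))))
      as [d Hd]; [apply locally_ball|].
    exists d; intros q t' Hq Ht; exact (Hd (q, t') (conj Hq Ht)). }
  set (delta := fun t => proj1_sig (constructive_indefinite_description _ (Hd t))).
  assert (Hdelta := fun t => proj2_sig (constructive_indefinite_description _ (Hd t))).
  destruct (compactness_value_1d a b delta) as [d Hc].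
  exists d; intros q Hq t Ht.
  apply Rnot_lt_le; intros Hlt; apply (Hc t Ht); intros (t0 & Ht0 & Hclose & Hle).
  assert (B1 : ball t0 (delta t0) t) by exact Hclose.
  assert (E1 : Rabs (f q t - f p t0) < eps / 2).
  { apply (Hdelta t0 q t); [now apply (ball_le p d) | exact B1]. }
  assert (E2 : Rabs (f p t - f p t0) < eps / 2).
  { apply (Hdelta t0 p t); [apply ball_center | exact B1]. }
  apply (Rlt_irrefl eps), (Rlt_le_trans _ _ _ Hlt).
  replace (f q t - f p t) with ((f q t - f p t0) + - (f p t - f p t0)) by ring.
  eapply Rle_trans; [apply Rabs_triang|]; rewrite Rabs_Ropp; lra.
Qed.

Definition jointly_continuous {T : UniformSpace} (H : plane -> R -> T) : Prop :=
  forall p t, continuous (fun q : plane * R => H (fst q) (snd q)) (p, t).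

Lemma joint_snd {T : UniformSpace} (H : plane -> R -> T) p t :
  jointly_continuous H -> continuous (H p) t.
Proof.
  intros HH; apply (continuous_comp (fun t => (p, t)) (fun q : plane * R => H (fst q) (snd q)));
    [apply continuous_pair; [apply continuous_const | apply continuous_id] | apply HH].
Qed.

Lemma param_continuous_real (f : plane -> R -> R) a b p : a <= b -> jointly_continuous f ->
  continuous (fun q => RInt (f q) a b) p.
Proof.
  intros Hab Hf; apply filterlim_locally; intros eps.
  assert (He : 0 < eps / (b - a + 1)) by (apply Rdiv_lt_0_compat; [apply cond_pos | lra]).
  generalize (param_close f a b p (mkposreal _ He) (fun t => Hf p t)); apply filter_imp; intros q Hq.
  assert (X : forall q, ex_RInt (f q) a b).
  { intros q'; apply (ex_RInt_continuous (V := R_CompleteNormedModule)); intros t _; now apply joint_snd. }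
  change (Rabs (RInt (f q) a b - RInt (f p) a b) < eps).
  rewrite <- (RInt_minus (V := R_CompleteNormedModule) (f q) (f p)) by apply X.
  eapply Rle_lt_trans.
  - apply abs_RInt_le_const with (M := eps / (b - a + 1)); [exact Hab | now apply (ex_RInt_minus (V := R_NormedModule))|].
    intros t Ht; exact (Hq t Ht).
  - apply Rmult_lt_reg_r with (b - a + 1); [lra|]; field_simplify; [|lra].
    pose proof (cond_pos eps); nra.
Qed.

Lemma joint_components (H : plane -> R -> C) : jointly_continuous (T := C_UniformSpace) H ->
  jointly_continuous (fun p t => Re (H p t)) /\ jointly_continuous (fun p t => Im (H p t)).
Proof.
  intros HH; split; intros p t;
    [exact (proj1 (proj1 (continuous_C _ _) (HH p t)))
    | exact (proj2 (proj1 (continuous_C _ _) (HH p t)))].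
Qed.

Lemma param_continuous (H : plane -> R -> C) a b p : a <= b ->
  jointly_continuous (T := C_UniformSpace) H ->
  continuous (U := C_UniformSpace) (fun q => CRInt (H q) a b) p.
Proof.
  intros Hab HH; destruct (joint_components H HH) as [HR HI].
  assert (E := fun q => CRInt_components (H q) a b (fun t => joint_snd H q t HH)).
  apply continuous_C; split.
  - apply continuous_ext with (fun q => RInt (fun t => Re (H q t)) a b);
      [intros q; symmetry; apply E | now apply param_continuous_real].
  - apply continuous_ext with (fun q => RInt (fun t => Im (H q t)) a b);
      [intros q; symmetry; apply E | now apply param_continuous_real].
Qed.

Lemma param_derive_real (f f' : plane -> R -> R) d a b p :
  jointly_continuous f -> jointly_continuous f' ->
  (forall q t, is_derive (fun s => f (slice d q s) t) (coord d q) (f' q t)) ->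
  is_derive (fun s => RInt (f (slice d p s)) a b) (coord d p) (RInt (f' p) a b).
Proof.
  intros Hf Hf' HD.
  assert (HD' : forall u t, is_derive (fun s => f (slice d p s) t) u (f' (slice d p u) t)).
  { intros u t; pose proof (HD (slice d p u) t) as E; rewrite coord_slice in E.
    apply is_derive_ext with (2 := E); intros s; now rewrite slice_slice. }
  evar_last.
  - apply (is_derive_RInt_param (fun s t => f (slice d p s) t) a b (coord d p)).
    + apply filter_forall; intros u t _; eexists; apply HD'.
    + intros t _; apply continuity_2d_pt_ext with (fun u v => f' (slice d p u) v).
      { intros u v; symmetry; apply is_derive_unique, HD'. }
      apply continuity_2d_pt_filterlim.
      apply (continuous_comp (fun z : R * R => (slice d p (fst z), snd z))
               (fun q : plane * R => f' (fst q) (snd q)) (coord d p, t)); [|apply Hf'].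
      apply continuous_pair; [|apply continuous_snd].
      destruct d; simpl; apply continuous_pair;
        first [apply continuous_const | apply continuous_fst].
    + apply filter_forall; intros u; apply (ex_RInt_continuous (V := R_CompleteNormedModule));
        intros t _; now apply (joint_snd f).
  - apply RInt_ext; intros t _; rewrite <- (slice_coord d p) at 2.
    apply is_derive_unique, HD'.
Qed.

Lemma param_partial (H H' : plane -> R -> C) d a b p :
  jointly_continuous (T := C_UniformSpace) H -> jointly_continuous (T := C_UniformSpace) H' ->
  (forall q t, is_partial d (fun r => H r t) q (H' q t)) ->
  is_partial d (fun q => CRInt (H q) a b) p (CRInt (H' p) a b).
Proof.
  intros HH HH' HD.
  destruct (joint_components H HH) as [HR HI], (joint_components H' HH') as [HR' HI'].
  assert (E := fun q => CRInt_components (H q) a b (fun t => joint_snd H q t HH)).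
  destruct (CRInt_components (H' p) a b (fun t => joint_snd H' p t HH')) as [E1 E2].
  apply is_partial_C; rewrite E1, E2; split.
  - apply is_derive_ext with (fun s => RInt (fun t => Re (H (slice d p s) t)) a b);
      [intros s; symmetry; apply E|].
    apply (param_derive_real (fun q t => Re (H q t)) (fun q t => Re (H' q t))); auto.
    intros q t; exact (proj1 (proj1 (is_partial_C _ _ _ _) (HD q t))).
  - apply is_derive_ext with (fun s => RInt (fun t => Im (H (slice d p s) t)) a b);
      [intros s; symmetry; apply E|].
    apply (param_derive_real (fun q t => Im (H q t)) (fun q t => Im (H' q t))); auto.
    intros q t; exact (proj2 (proj1 (is_partial_C _ _ _ _) (HD q t))).
Qed.

(** Differentiation under the integral sign keeps such integrals within their
    class. *)
Lemma smooth_param (K : (plane -> R -> C) -> Prop) a b : a <= b ->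
  (forall H, K H -> jointly_continuous (T := C_UniformSpace) H /\
     forall d, exists H', K H' /\ forall p t, is_partial d (fun q => H q t) p (H' p t)) ->
  forall H, K H -> smooth (fun p => CRInt (H p) a b).
Proof.
  intros Hab HK H HH.
  apply (smooth_generated (fun phi => exists H, K H /\ phi = fun p => CRInt (H p) a b));
    [|apply generated_in; now exists H].
  intros phi (F & HF & ->); destruct (HK F HF) as [HC HD]; split.
  - intros p; now apply param_continuous.
  - intros d; destruct (HD d) as (F' & HF' & HP).
    exists (fun p => CRInt (F' p) a b); split; [apply generated_in; now exists F'|].
    intros p; apply param_partial; auto; now apply HK.
Qed.

Lemma is_derive_slice h d q (g : R -> R) x dg : smooth h -> is_derive g x dg ->
  is_derive (V := C_R_NormedModule) (fun t => h (slice d q (g t))) x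
    (RtoC dg * partial d h (slice d q (g x)))%C.
Proof.
  intros Hh Hg.
  pose proof (smooth_is_partial d h (slice d q (g x)) Hh) as HP.
  unfold is_partial in HP; rewrite coord_slice in HP.
  assert (HP' : is_derive (V := C_R_NormedModule) (fun t => h (slice d q t)) (g x)
                 (partial d h (slice d q (g x)))).
  { apply is_derive_ext with (2 := HP); intros t; now rewrite slice_slice. }
  evar_last; [exact (is_derive_comp (V := C_R_NormedModule) _ g x _ dg HP' Hg)|].
  unfold scal; simpl; unfold prod_scal, scal; simpl; unfold mult; simpl.
  unfold RtoC, Cmult; simpl; f_equal; ring.
Qed.

(** * Backprojection *)

(** The first coordinate [s] of the line through [y] of direction [unit_dir a]
    in the parametrization [line_of]. *)
Definition perp (y : plane) (a : R) : R := fst y * - sin a + snd y * cos a.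

Definition normal (d : axis) (a : R) : R :=
  match d with axis1 => - sin a | axis2 => cos a end.

(** The adjoint of the X-ray transform of functions, in the coordinates
    [(s, a)] of lines. *)
Definition backproj (h : plane -> C) (y : plane) : C :=
  CRInt (fun a => h (perp y a, a)) 0 (2 * PI).

(** All derivatives of the sine are translates of it. *)
Lemma sin_chain I : chain I (fun k x => sin (x + INR k * (PI / 2))).
Proof.
  intros k x _; auto_derive; [trivial|].
  rewrite S_INR.
  replace (x + (INR k + 1) * (PI / 2)) with (PI / 2 + (x + INR k * (PI / 2))) by field.
  rewrite <- cos_sin; ring.
Qed.

Lemma rsmooth_normal d : rsmooth (fun p => normal d (snd p)).
Proof.
  assert (H := fun k => rsmooth_comp (fun _ => True) _ (fun p => snd p) k (sin_chain _)
    (smooth_coord axis2) (fun _ => I)).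
  destruct d; simpl.
  - apply smooth_ext with (2 := H 2%nat); intros p; f_equal; simpl.
    replace (snd p + (1 + 1) * (PI / 2)) with (snd p + PI) by field; apply neg_sin.
  - apply smooth_ext with (2 := H 1%nat); intros p; f_equal; simpl.
    rewrite cos_sin; f_equal; field.
Qed.

(** [unit_dir a] turned by a right angle is the gradient of [perp _ a]; hence
    this operator on functions of lines corresponds to [D_d] under
    backprojection. *)
Definition normal_deriv (d : axis) (h : plane -> C) : plane -> C :=
  fun p => (RtoC (normal d (snd p)) * partial axis1 h p)%C.

Lemma smooth_normal_deriv d h : smooth h -> smooth (normal_deriv d h).
Proof. intros H; apply smooth_mult; [apply rsmooth_normal | now apply smooth_partial]. Qed.

Lemma is_partial_perp h d y a : smooth h ->
  is_partial d (fun q => h (perp q a, a)) y (normal_deriv d h (perp y a, a)).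
Proof.
  intros Hh.
  assert (Hg : is_derive (fun t => perp (slice d y t) a) (coord d y) (normal d a)).
  { unfold perp; destruct d; simpl; auto_derive; trivial; ring. }
  pose proof (is_derive_slice h axis1 (0, a) _ _ _ Hh Hg) as E; cbv beta in E.
  rewrite slice_coord in E; exact E.
Qed.

Lemma joint_perp h : smooth h ->
  jointly_continuous (T := C_UniformSpace) (fun y a => h (perp y a, a)).
Proof.
  intros Hh p t.
  apply (continuous_comp (fun q : plane * R => (perp (fst q) (snd q), snd q)) h);
    [|now apply smooth_continuous].
  apply (continuous_pair (fun q : plane * R => perp (fst q) (snd q)) (fun q : plane * R => snd q));
    [|apply continuous_snd].
  assert (C1 : continuous (fun q : plane * R => fst (fst q)) (p, t))
    by (apply (continuous_comp fst fst); apply continuous_fst).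
  assert (C2 : continuous (fun q : plane * R => snd (fst q)) (p, t))
    by (apply (continuous_comp fst snd); [apply continuous_fst | apply continuous_snd]).
  assert (C3 : continuous (fun q : plane * R => snd q) (p, t)) by apply continuous_snd.
  assert (C4 : continuous (fun q : plane * R => - sin (snd q)) (p, t)).
  { apply (continuous_comp (fun q : plane * R => snd q) (fun a => - sin a)); [exact C3|].
    apply (ex_derive_continuous (K := R_AbsRing) (V := R_NormedModule)); auto_derive; trivial. }
  assert (C5 : continuous (fun q : plane * R => cos (snd q)) (p, t)).
  { apply (continuous_comp (fun q : plane * R => snd q) cos); [exact C3 | apply continuous_cos]. }
  exact (continuous_plus (V := R_NormedModule) _ _ _
    (continuous_mult (K := R_AbsRing) _ _ _ C1 C4) (continuous_mult (K := R_AbsRing) _ _ _ C2 C5)).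
Qed.

Lemma two_pi_ge0 : 0 <= 2 * PI.
Proof. pose proof PI_RGT_0; lra. Qed.

Lemma smooth_backproj h : smooth h -> smooth (backproj h).
Proof.
  intros Hh; unfold backproj.
  apply (smooth_param (fun H => exists h, smooth h /\ H = fun y a => h (perp y a, a)));
    [apply two_pi_ge0 | | now exists h].
  clear h Hh; intros H (h & Hh & ->); split; [now apply joint_perp|].
  intros d; exists (fun y a => normal_deriv d h (perp y a, a)); split.
  - exists (normal_deriv d h); auto using smooth_normal_deriv.
  - intros y a; now apply is_partial_perp.
Qed.

Lemma partial_backproj d h : smooth h -> partial d (backproj h) = backproj (normal_deriv d h).
Proof.
  intros Hh; apply functional_extensionality; intros y; apply is_partial_unique.
  apply (param_partial (fun y a => h (perp y a, a)) (fun y a => normal_deriv d h (perp y a, a)));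
    auto using joint_perp, smooth_normal_deriv, is_partial_perp.
Qed.

(** * Primitives in the first variable *)

(** The integral of [g (_, a)] from 0 to [s], scaled to a fixed interval of
    integration. *)
Definition primitive (g : plane -> C) (p : plane) : C :=
  (RtoC (fst p) * CRInt (fun t => g ((fst p * t)%R, snd p)) 0 1)%C.

Lemma smooth_primitive g : smooth g -> smooth (primitive g).
Proof.
  intros Hg; apply smooth_mult; [apply (smooth_coord axis1)|].
  apply (smooth_param (fun H => exists k h, smooth h /\
    H = fun p t => (RtoC (t ^ k) * h ((fst p * t)%R, snd p))%C)); [lra| |].
  2:{ exists O, g; split; [exact Hg|]; apply functional_extensionality; intros p.
      apply functional_extensionality; intros t; simpl; ring. }
  intros H (k & h & Hh & ->); split.
  - intros p t; apply (continuous_Cmult (fun q : plane * R => RtoC (snd q ^ k))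
      (fun q : plane * R => h (fst (fst q) * snd q, snd (fst q)))).
    + apply (continuous_RtoC (fun q : plane * R => snd q ^ k));
      apply (continuous_comp (fun q : plane * R => snd q) (fun t => t ^ k));
        [apply continuous_snd|].
      apply (ex_derive_continuous (K := R_AbsRing) (V := R_NormedModule)); auto_derive; trivial.
    + apply (continuous_comp (fun q : plane * R => (fst (fst q) * snd q, snd (fst q))) h);
        [|now apply smooth_continuous].
      apply (continuous_pair (fun q : plane * R => fst (fst q) * snd q)
               (fun q : plane * R => snd (fst q))).
      * assert (C1 : continuous (fun q : plane * R => fst (fst q)) (p, t))
          by (apply (continuous_comp fst fst); apply continuous_fst).
        assert (C2 : continuous (fun q : plane * R => snd q) (p, t)) by apply continuous_snd.
        exact (continuous_mult (K := R_AbsRing) _ _ _ C1 C2).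
      * apply (continuous_comp fst snd); [apply continuous_fst | apply continuous_snd].
  - assert (HD : forall d dg p t, is_derive (fun s => match d with axis1 => s * t | axis2 => s end) (coord d p) dg ->
      is_partial d (fun q => h (fst q * t, snd q)) p (RtoC dg * partial d h ((fst p * t)%R, snd p))%C).
    { intros d dg p t Hdg.
      pose proof (is_derive_slice h d (fst p * t, snd p) _ _ _ Hh Hdg) as E.
      destruct d; exact E. }
    intros [|].
    + exists (fun p t => (RtoC (t ^ S k) * partial axis1 h ((fst p * t)%R, snd p))%C); split.
      { exists (S k), (partial axis1 h); auto using smooth_partial. }
      intros p t; replace (RtoC (t ^ S k) * partial axis1 h ((fst p * t)%R, snd p))%C with
        (RtoC 0 * h ((fst p * t)%R, snd p) + RtoC (t ^ k) * (RtoC t * partial axis1 h ((fst p * t)%R, snd p)))%C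
        by (simpl; rewrite RtoC_mult; ring).
      apply (is_partial_mult axis1 (fun _ => RtoC (t ^ k)) (fun q : plane => h ((fst q * t)%R, snd q))); [apply is_partial_const|].
      apply HD; auto_derive; [trivial | ring].
    + exists (fun p t => (RtoC (t ^ k) * partial axis2 h ((fst p * t)%R, snd p))%C); split.
      { exists k, (partial axis2 h); auto using smooth_partial. }
      intros p t; replace (RtoC (t ^ k) * partial axis2 h ((fst p * t)%R, snd p))%C with
        (RtoC 0 * h ((fst p * t)%R, snd p) + RtoC (t ^ k) * (RtoC 1 * partial axis2 h ((fst p * t)%R, snd p)))%C
        by ring.
      apply (is_partial_mult axis2 (fun _ => RtoC (t ^ k)) (fun q : plane => h ((fst q * t)%R, snd q))); [apply is_partial_const|].
      apply HD; auto_derive; [trivial | ring].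
Qed.

Lemma partial_primitive g : smooth g -> partial axis1 (primitive g) = g.
Proof.
  intros Hg; apply functional_extensionality; intros [x a]; apply is_partial_unique.
  assert (Hc : forall s, continuous (U := C_UniformSpace) (fun s => g (s, a)) s).
  { intros s; apply (continuous_comp (fun s => (s, a)) g); [|now apply smooth_continuous].
    apply continuous_pair; [apply continuous_id | apply continuous_const]. }
  unfold is_partial; simpl.
  apply (is_derive_ext (V := C_R_NormedModule) (fun s => CRInt (fun t => g (t, a)) 0 s)).
  - intros s; unfold primitive; simpl.
    pose proof (RInt_comp_lin (V := C_R_CompleteNormedModule) (fun t => g (t, a)) s 0 0 1) as E.
    rewrite Rmult_0_r, Rmult_1_r, !Rplus_0_r in E.
    etransitivity; [symmetry; apply E; now apply ex_CRInt|].
    rewrite (RInt_scal (V := C_R_CompleteNormedModule) (fun y => g (s * y + 0, a))).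
    + rewrite (RInt_ext (V := C_R_CompleteNormedModule) (fun y => g (s * y + 0, a)) (fun y => g (s * y, a)))
        by (intros; now rewrite Rplus_0_r).
      destruct (CRInt (fun y => g (s * y, a)) 0 1) as [u v].
      unfold scal; simpl; unfold prod_scal, scal; simpl; unfold mult; simpl.
      unfold RtoC, Cmult; simpl; f_equal; ring.
    + apply ex_CRInt; intros t; apply (continuous_comp (fun y => s * y + 0) (fun t => g (t, a)));
        [|apply Hc].
      apply (ex_derive_continuous (K := R_AbsRing) (V := R_NormedModule)); auto_derive; trivial.
  - apply (is_derive_RInt (V := C_R_NormedModule) (fun t => g (t, a)) _ 0 x); [|apply Hc].
    apply filter_forall; intros s.
    apply (RInt_correct (V := C_R_CompleteNormedModule)); now apply ex_CRInt.
Qed.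

(** * The transverse ray transform and the divergence *)

Lemma line_eq (l l' : line) : base l = base l' -> dir l = dir l' -> l = l'.
Proof.
  destruct l as [b v Hv Hb], l' as [b' v' Hv' Hb']; simpl; intros -> ->.
  f_equal; apply proof_irrelevance.
Qed.

Lemma line_through_perp y a : line_through y a = line_of (perp y a) a.
Proof.
  apply line_eq; [|reflexivity].
  pose proof (sin2_cos2 a) as H; unfold Rsqr in H.
  unfold line_through, line_of, foot, dot, unit_dir, perp; simpl; f_equal; apply Rminus_diag_uniq.
  - transitivity (fst y * (1 - (sin a * sin a + cos a * cos a))); [ring | rewrite H; ring].
  - transitivity (snd y * (1 - (sin a * sin a + cos a * cos a))); [ring | rewrite H; ring].
Qed.

Definition pullback (psi : line -> C) : plane -> C := fun p => psi (line_of (fst p) (snd p)).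

Lemma X1_adjoint_backproj d psi : X1_adjoint_comp d psi =
  backproj (fun p => (RtoC (coord d (unit_dir (snd p))) * pullback psi p)%C).
Proof.
  apply functional_extensionality; intros y.
  unfold X1_adjoint_comp, backproj, pullback; apply (RInt_ext (V := C_R_CompleteNormedModule)).
  intros a _; simpl; now rewrite line_through_perp.
Qed.

(** If [D_s h = psi], the pair that [f] is tested against in [Xperp f psi] is
    the gradient of the backprojection of [h]: differentiating
    [h (perp y a, a)] in [y] produces [psi] times the normal of the line. *)
Lemma Xperp_divergence f psi h : vcompact_distribution f -> smooth h ->
  partial axis1 h = pullback psi -> Xperp f psi = (- divergence f (backproj h))%C.
Proof.
  intros [Hf1 Hf2] Sh Hh.
  assert (S1 := smooth_partial axis1 _ Sh).
  unfold Xperp, X1, pairing, rotateB, X1_adjoint, divergence, dist_partial; simpl.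
  rewrite !partial_backproj, !X1_adjoint_backproj by assumption.
  replace (backproj (fun p => (RtoC (coord axis1 (unit_dir (snd p))) * pullback psi p)%C))
    with (backproj (normal_deriv axis2 h)) by (rewrite <- Hh; reflexivity).
  replace (backproj (fun p => (RtoC (coord axis2 (unit_dir (snd p))) * pullback psi p)%C))
    with (fun y => ((- RtoC 1) * backproj (normal_deriv axis1 h) y)%C).
  - rewrite (cd_scal _ Hf1) by auto using smooth_backproj, smooth_normal_deriv; ring.
  - rewrite <- Hh; apply functional_extensionality; intros y; unfold backproj, normal_deriv; simpl.
    transitivity (opp (G := C_R_CompleteNormedModule) (CRInt (fun a => (RtoC (- sin a) * partial axis1 h (perp y a, a))%C) 0 (2 * PI))).
    + set (c := CRInt _ 0 (2 * PI)); change (- RtoC 1 * c = - c)%C; ring.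
    + rewrite <- (RInt_opp (V := C_R_CompleteNormedModule)).
      * apply (RInt_ext (V := C_R_CompleteNormedModule)); intros a _.
        change (- (RtoC (- sin a) * partial axis1 h (perp y a, a)) = RtoC (sin a) * partial axis1 h (perp y a, a))%C.
        rewrite RtoC_opp; ring.
      * apply ex_CRInt; intros a; apply (joint_snd (fun y a => normal_deriv axis1 h (perp y a, a))).
        now apply joint_perp, smooth_normal_deriv.
Qed.

(** The primitive of [psi] in [s] need not have compact support, but compactly
    supported distributions act on all smooth functions. *)
Lemma Xperp_of_div_zero f psi : vcompact_distribution f -> dist_zero (divergence f) ->
  smooth_lines psi -> Xperp f psi = RtoC 0.
Proof.
  intros Hf Hdiv Hpsi.
  rewrite (Xperp_divergence f psi (primitive (pullback psi)) Hf).
  - rewrite Hdiv by (apply smooth_backproj; now apply smooth_primitive); ring.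
  - now apply smooth_primitive.
  - now apply partial_primitive.
Qed.

(** * Angles *)

Definition angle (v : plane) : R :=
  if Rle_dec 0 (snd v) then acos (fst v) else - acos (fst v).

Lemma unit_dir_angle v : dot v v = 1 -> unit_dir (angle v) = v.
Proof.
  destruct v as [x y]; unfold dot, angle, unit_dir; simpl; intros H.
  assert (Hx : -1 <= x <= 1) by nra.
  assert (Hs : sin (acos x) = sqrt (y ^ 2)) by (rewrite sin_acos by exact Hx; f_equal; unfold Rsqr; nra).
  destruct (Rle_dec 0 y) as [Hy|Hy].
  - rewrite cos_acos, Hs, sqrt_pow2 by assumption; reflexivity.
  - rewrite cos_neg, sin_neg, cos_acos, Hs by exact Hx.
    replace (y ^ 2) with ((- y) ^ 2) by ring; rewrite sqrt_pow2 by lra.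
    now rewrite Ropp_involutive.
Qed.

(** * Rotation averages of ridge functions *)

(** The integrals over the two ends cancel after a translation by the
    period. *)
Lemma RInt_periodic (K : R -> R) T c : (forall t, continuous K t) -> (forall t, K (t + T) = K t) ->
  RInt K c (c + T) = RInt K 0 T.
Proof.
  intros Hc HT.
  assert (X : forall a b, ex_RInt K a b)
    by (intros; apply (ex_RInt_continuous (V := R_CompleteNormedModule)); auto).
  assert (E : RInt K T (c + T) = RInt K 0 c).
  { pose proof (RInt_comp_lin (V := R_CompleteNormedModule) K 1 T 0 c (X _ _)) as E.
    rewrite !Rmult_1_l, Rplus_0_l in E; rewrite <- E; apply RInt_ext; intros t _.
    change (1 * K (1 * t + T) = K t); now rewrite !Rmult_1_l, HT. }
  pose proof (RInt_Chasles (V := R_CompleteNormedModule) K 0 c (c + T) (X _ _) (X _ _)) as E1.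
  pose proof (RInt_Chasles (V := R_CompleteNormedModule) K 0 T (c + T) (X _ _) (X _ _)) as E2.
  unfold plus in E1, E2; simpl in E1, E2; lra.
Qed.

Section Ridge.
Variables (g : R -> R) (delta r : R).
Hypothesis gc : forall s, continuous g s.
Hypothesis geven : forall s, g (- s) = g s.
Hypothesis gsupp : forall s, delta < Rabs s -> g s = 0.
Hypothesis Hdelta : 0 < delta < r.

Let circ (t : R) : R := g (r * sin t).

Lemma circ_continuous t : continuous circ t.
Proof.
  apply (continuous_comp (fun t => r * sin t) g); [|apply gc].
  apply (ex_derive_continuous (K := R_AbsRing) (V := R_NormedModule)); auto_derive; trivial.
Qed.

Lemma circ_periodic t : circ (t + PI) = circ t.
Proof. unfold circ; rewrite neg_sin, <- geven; f_equal; ring. Qed.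

Lemma circ_ex a b : ex_RInt circ a b.
Proof. apply (ex_RInt_continuous (V := R_CompleteNormedModule)); intros; apply circ_continuous. Qed.

(** As [g] is even, [circ] has period [PI], so the full circle is twice a half
    circle. *)
Lemma circ_period c : RInt circ c (c + 2 * PI) = 2 * RInt circ (- (PI / 2)) (PI / 2).
Proof.
  rewrite <- (RInt_Chasles (V := R_CompleteNormedModule) circ c (c + PI) (c + 2 * PI)) by apply circ_ex.
  replace (c + 2 * PI) with (c + PI + PI) by ring.
  rewrite !(RInt_periodic circ PI) by auto using circ_continuous, circ_periodic.
  replace (PI / 2) with (- (PI / 2) + PI) at 2 by field.
  rewrite (RInt_periodic circ PI) by auto using circ_continuous, circ_periodic.
  unfold plus; simpl; ring.
Qed.

Let abel (s : R) : R := g s * isqrt 0 (r ^ 2 - s ^ 2).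

Lemma abel_zero s : delta < Rabs s -> abel s = 0.
Proof. intros H; unfold abel; rewrite gsupp by exact H; ring. Qed.

Lemma abel_continuous s : continuous abel s.
Proof.
  destruct (Rlt_le_dec (Rabs s) r) as [H|H].
  - unfold abel; apply (continuous_mult (K := R_AbsRing)); [apply gc|].
    apply (continuous_comp (fun s => r ^ 2 - s ^ 2) (isqrt 0)).
    + apply (ex_derive_continuous (K := R_AbsRing) (V := R_NormedModule)); auto_derive; trivial.
    + apply isqrt_continuous; rewrite <- (pow2_abs s); pose proof (Rabs_pos s); nra.
  - apply (continuous_ext_loc abel (fun _ => 0)); [|apply continuous_const].
    assert (L : locally s (fun y => delta < Rabs y)).
    { apply (continuous_Rabs s (fun y => delta < y)), (open_gt delta); lra. }
    revert L; apply filter_imp; intros y Hy; now rewrite abel_zero.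
Qed.

Lemma abel_ex a b : ex_RInt abel a b.
Proof. apply (ex_RInt_continuous (V := R_CompleteNormedModule)); intros; apply abel_continuous. Qed.

(** The substitution [s = r sin t]; the singularities of the kernel at
    [s = - r] and [s = r] lie outside the support of [g]. *)
Lemma ridge_half : RInt circ (- (PI / 2)) (PI / 2) = RInt abel (- delta) delta.
Proof.
  pose proof PI_RGT_0 as HPI.
  transitivity (RInt abel (- r) r).
  - pose proof (RInt_comp (V := R_CompleteNormedModule) abel (fun t => r * sin t) (fun t => r * cos t)
      (- (PI / 2)) (PI / 2)) as E.
    cbv beta in E; rewrite sin_neg, sin_PI2, !Rmult_1_r in E.
    replace (r * - (1)) with (- r) in E by ring.
    rewrite <- E.
    + apply RInt_ext; intros t Ht; rewrite Rmin_left, Rmax_right in Ht by lra.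
      assert (Hcos : 0 < cos t) by (apply cos_gt_0; lra).
      unfold circ, abel; unfold scal; simpl; unfold mult; simpl.
      rewrite isqrt_0.
      replace (r * (r * 1) - r * sin t * (r * sin t * 1)) with ((r * cos t) ^ 2).
      * rewrite sqrt_pow2 by nra; field; nra.
      * pose proof (sin2_cos2 t) as Hsc; unfold Rsqr in Hsc.
        transitivity (r * r * (1 - sin t * sin t)); [rewrite <- Hsc|]; ring.
    + intros; apply abel_continuous.
    + intros t _; split; [auto_derive; [trivial | ring]|].
      apply (ex_derive_continuous (K := R_AbsRing) (V := R_NormedModule)); auto_derive; trivial.
  - assert (Z : forall a b, (forall s, Rmin a b < s < Rmax a b -> delta < Rabs s) -> RInt abel a b = 0).
    { intros a b H; rewrite (RInt_ext abel (fun _ => 0)) by (intros; now apply abel_zero, H).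
      rewrite RInt_const; apply Rmult_0_r. }
    rewrite <- (RInt_Chasles (V := R_CompleteNormedModule) abel (- r) (- delta) r) by apply abel_ex.
    rewrite <- (RInt_Chasles (V := R_CompleteNormedModule) abel (- delta) delta r) by apply abel_ex.
    rewrite (Z (- r) (- delta)), (Z delta r).
    + unfold plus; simpl; ring.
    + intros s Hs; rewrite Rmin_left in Hs by lra; rewrite Rabs_pos_eq; lra.
    + intros s Hs; rewrite Rmax_right in Hs by lra; rewrite Rabs_left; lra.
Qed.

Lemma ridge_average phi :
  RInt (fun a => g (r * sin (phi - a))) 0 (2 * PI) = 2 * RInt abel (- delta) delta.
Proof.
  rewrite <- ridge_half, <- (circ_period (phi - 2 * PI)).
  replace (phi - 2 * PI + 2 * PI) with phi by ring.
  pose proof (RInt_comp_lin (V := R_CompleteNormedModule) circ (-1) phi 0 (2 * PI) (circ_ex _ _)) as E.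
  replace (-1 * 0 + phi) with phi in E by ring.
  replace (-1 * (2 * PI) + phi) with (phi - 2 * PI) in E by ring.
  rewrite <- (opp_RInt_swap (V := R_CompleteNormedModule) circ phi (phi - 2 * PI)) by apply circ_ex.
  rewrite <- E, <- (RInt_opp (V := R_CompleteNormedModule)).
  - apply RInt_ext; intros a _; unfold circ, scal, opp; simpl; unfold mult; simpl.
    replace (-1 * a + phi) with (phi - a) by ring; ring.
  - apply (ex_RInt_continuous (V := R_CompleteNormedModule)); intros t _.
    apply (continuous_scal_r (V := R_NormedModule)).
    apply (continuous_comp (fun y => -1 * y + phi) circ); [|apply circ_continuous].
    apply (ex_derive_continuous (K := R_AbsRing) (V := R_NormedModule)); auto_derive; trivial.
Qed.

End Ridge.

(** In polar coordinates centred at [x0] the weight is evaluated at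
    [r sin (phi - a)], and the rotation invariant average over [a] is an Abel
    integral in [r]. *)
Lemma backproj_ridge delta x0 y : 0 < delta -> delta ^ 2 < nsq x0 y ->
  RInt (fun a => dens delta (perp y a - perp x0 a)) 0 (2 * PI) = 2 * avg delta 0 (nsq x0 y).
Proof.
  intros Hd Hy.
  set (v1 := fst y - fst x0); set (v2 := snd y - snd x0); set (r := sqrt (nsq x0 y)).
  assert (Hr2 : r ^ 2 = nsq x0 y) by (apply pow2_sqrt; nra).
  assert (Hr0 : 0 < r) by (apply sqrt_lt_R0; nra).
  assert (Hr : delta < r) by nra.
  assert (Hn : v1 * v1 + v2 * v2 = r * r).
  { transitivity (nsq x0 y); [unfold nsq, v1, v2; ring | rewrite <- Hr2; ring]. }
  set (phi := angle (v1 / r, v2 / r)).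
  assert (Hphi : unit_dir phi = (v1 / r, v2 / r)).
  { apply unit_dir_angle; unfold dot; simpl.
    transitivity ((v1 * v1 + v2 * v2) / (r * r)); [field; lra | rewrite Hn; field; lra]. }
  assert (Hcos : cos phi = v1 / r) by (change (cos phi) with (fst (unit_dir phi)); now rewrite Hphi).
  assert (Hsin : sin phi = v2 / r) by (change (sin phi) with (snd (unit_dir phi)); now rewrite Hphi).
  rewrite <- Hr2; unfold avg.
  rewrite <- (ridge_average (dens delta) delta r (dens_continuous delta) (dens_even delta)
    (fun s => dens_supp delta s Hd) (conj Hd Hr) phi).
  apply RInt_ext; intros a _; f_equal.
  rewrite sin_minus, Hcos, Hsin; unfold perp, v1, v2; field; lra.
Qed.

(** * Test functions concentrated on the lines close to a point *)

Section NearPoint.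
Variables (V : plane -> Prop) (x0 : plane) (eps delta : R).
Hypothesis Hdelta : 0 < delta < eps.
Hypothesis HV : forall p, nsq x0 p <= eps ^ 2 -> V p.

(** [fst q - perp x0 (snd q)] is the signed distance from [x0] to the line of
    coordinates [q]. *)
Definition far (q : plane) : Prop := delta < Rabs (fst q - perp x0 (snd q)).

Lemma far_open : open far.
Proof.
  intros q Hq; unfold far in *.
  apply (continuous_comp (fun q : plane => fst q - perp x0 (snd q)) Rabs q); [|apply continuous_Rabs|].
  - apply (continuous_minus (V := R_NormedModule)); [apply continuous_fst|].
    apply (continuous_comp (fun q : plane => snd q) (perp x0)); [apply continuous_snd|].
    apply (ex_derive_continuous (K := R_AbsRing) (V := R_NormedModule)); unfold perp; auto_derive; trivial.
  - exact (open_gt delta _ Hq).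
Qed.

(** Functions of [(s, a)] which descend to the manifold of lines and are
    supported on lines at distance at most [delta] from [x0]. *)
Definition near_point (h : plane -> C) : Prop :=
  smooth h /\ (forall q, far q -> h q = RtoC 0) /\
  forall s a a', unit_dir a = unit_dir a' -> h (s, a) = h (s, a').

Lemma near_point_partial h : near_point h -> near_point (partial axis1 h).
Proof.
  intros (Sh & Zh & Ah); split; [now apply smooth_partial|]; split.
  - intros q Hq.
    rewrite (iter_partial_local far h (fun _ => RtoC 0) far_open Zh (axis1 :: nil) q Hq
              : partial axis1 h q = _); simpl.
    now rewrite partial_const.
  - intros s a a' Haa; unfold partial; simpl.
    rewrite (functional_extensionality _ _ (fun t => f_equal Re (Ah t a a' Haa))).
    rewrite (functional_extensionality _ _ (fun t => f_equal Im (Ah t a a' Haa))); reflexivity.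
Qed.

Lemma near_point_normal d h : near_point h -> near_point (normal_deriv d h).
Proof.
  intros Hh; destruct (near_point_partial h Hh) as (_ & Z & A).
  split; [apply smooth_normal_deriv, Hh|]; unfold normal_deriv; split.
  - intros q Hq; rewrite (Z q Hq); ring.
  - intros s a a' Haa; rewrite (A s a a' Haa); f_equal; f_equal; simpl.
    injection Haa; destruct d; simpl; congruence.
Qed.

(** The class [near_point] is stable under [normal_deriv], so derivatives of
    backprojections of test functions are of the same kind. *)
Lemma iter_backproj w h : near_point h ->
  exists h', near_point h' /\ iter_partial w (backproj h) = backproj h'.
Proof.
  intros Hh; induction w as [|d w (h' & Hh' & E)]; [now exists h|].
  exists (normal_deriv d h'); split; [now apply near_point_normal|].
  simpl; rewrite E; apply partial_backproj, Hh'.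
Qed.

Definition on_lines (h : plane -> C) (l : line) : C := h (perp (base l) (angle (dir l)), angle (dir l)).

Lemma pullback_on_lines h : near_point h -> pullback (on_lines h) = h.
Proof.
  intros (_ & _ & A); apply functional_extensionality; intros [s a]; unfold pullback, on_lines.
  assert (E : unit_dir (angle (dir (line_of s a))) = unit_dir a)
    by apply unit_dir_angle, unit_dir_unit.
  simpl fst in *; simpl snd in *.
  rewrite (A _ _ a E); f_equal; f_equal.
  unfold perp; injection E; intros Es Ec; simpl in *; rewrite Es, Ec.
  pose proof (sin2_cos2 a) as H; unfold Rsqr in H.
  transitivity (s * (sin a * sin a + cos a * cos a)); [ring | rewrite H; ring].
Qed.

(** The signed distance from [x0] to the line with this base point and
    direction. *)
Definition offset (q : plane * plane) : R :=
  (fst (fst q) - fst x0) * - snd (snd q) + (snd (fst q) - snd x0) * fst (snd q).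

Lemma offset_perp l : offset (line_coords l) =
  perp (base l) (angle (dir l)) - perp x0 (angle (dir l)).
Proof.
  destruct l as [b v Hv Hb]; pose proof (unit_dir_angle v Hv) as E; unfold unit_dir in E.
  unfold offset, perp, line_coords; simpl; rewrite <- E at 1 2; simpl; ring.
Qed.

Lemma offset_continuous q : continuous offset q.
Proof.
  assert (C : forall (pr : plane * plane -> plane), continuous pr q ->
    continuous (fun q => fst (pr q)) q /\ continuous (fun q => snd (pr q)) q).
  { intros pr Hpr; split; [apply (continuous_comp pr fst) | apply (continuous_comp pr snd)];
      auto; [apply continuous_fst | apply continuous_snd]. }
  destruct (C fst) as [C1 C2]; [destruct q; apply continuous_fst|].
  destruct (C snd) as [C3 C4]; [destruct q; apply continuous_snd|].
  exact (continuous_plus (V := R_NormedModule) _ _ _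
    (continuous_mult (K := R_AbsRing) _ _ _
       (continuous_minus (V := R_NormedModule) _ _ _ C1 (continuous_const _ _))
       (continuous_opp (V := R_NormedModule) _ _ C4))
    (continuous_mult (K := R_AbsRing) _ _ _
       (continuous_minus (V := R_NormedModule) _ _ _ C2 (continuous_const _ _)) C3)).
Qed.

Lemma support_offset h q : near_point h -> support_lines (on_lines h) q -> Rabs (offset q) <= delta.
Proof.
  intros (_ & Z & _) Hq; apply Rnot_lt_le; intros Hlt.
  assert (L : locally q (fun y => delta < Rabs (offset y))).
  { apply (continuous_comp offset Rabs q (offset_continuous q) (continuous_Rabs _)).
    exact (open_gt delta _ Hlt). }
  destruct L as [rho L], (Hq rho) as (y & Hy & l & <- & Hne).
  apply Hne, Z; unfold far; simpl; rewrite <- offset_perp; now apply L.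
Qed.

Lemma near_line_meets l : Rabs (offset (line_coords l)) <= delta -> meets V l.
Proof.
  intros H; exists (dot x0 (dir l)); apply HV.
  apply Rle_trans with (offset (line_coords l) ^ 2).
  - right; destruct l as [[b1 b2] [d1 d2] Hd Hb]; unfold dot, nsq, offset, line_point, line_coords in *;
      simpl in *; destruct x0 as [x1 x2]; simpl.
    set (v1 := b1 + (x1 * d1 + x2 * d2) * d1 - x1); set (v2 := b2 + (x1 * d1 + x2 * d2) * d2 - x2).
    (* Pythagoras in the orthonormal frame [(d1, d2)], [(- d2, d1)] *)
    assert (E1 : v1 * d1 + v2 * d2 = 0).
    { transitivity ((b1 * d1 + b2 * d2) + (x1 * d1 + x2 * d2) * (d1 * d1 + d2 * d2 - 1));
        [unfold v1, v2; ring | rewrite Hd, Hb; ring]. }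
    assert (E2 : v1 * - d2 + v2 * d1 = (b1 - x1) * - d2 + (b2 - x2) * d1) by (unfold v1, v2; ring).
    rewrite <- E2.
    transitivity ((v1 * v1 + v2 * v2) * (d1 * d1 + d2 * d2)); [rewrite Hd; ring|].
    transitivity ((v1 * - d2 + v2 * d1) * (v1 * - d2 + v2 * d1) +
                  (v1 * d1 + v2 * d2) * (v1 * d1 + v2 * d2)); [ring | rewrite E1; ring].
  - rewrite <- pow2_abs; pose proof (Rabs_pos (offset (line_coords l))); nra.
Qed.

Lemma dir_le l : Rabs (fst (dir l)) <= 1 /\ Rabs (snd (dir l)) <= 1.
Proof.
  pose proof (dir_unit l) as H; unfold dot in H.
  split; apply Rabs_le; nra.
Qed.

Lemma near_line_bounded l : Rabs (offset (line_coords l)) <= delta ->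
  Rabs (fst (base l)) <= delta + Rabs (fst x0) + Rabs (snd x0) /\
  Rabs (snd (base l)) <= delta + Rabs (fst x0) + Rabs (snd x0).
Proof.
  intros H; destruct (dir_le l) as [D1 D2].
  set (o := offset (line_coords l)) in *.
  set (k := o + (fst x0 * - snd (dir l) + snd x0 * fst (dir l))).
  assert (Hk : Rabs k <= delta + Rabs (fst x0) + Rabs (snd x0)).
  { unfold k; eapply Rle_trans; [apply Rabs_triang|].
    pose proof (Rabs_triang (fst x0 * - snd (dir l)) (snd x0 * fst (dir l))) as T.
    rewrite !Rabs_mult, Rabs_Ropp in T.
    pose proof (Rabs_pos (fst x0)); pose proof (Rabs_pos (snd x0)).
    pose proof (Rabs_pos (fst (dir l))); pose proof (Rabs_pos (snd (dir l))).
    assert (Rabs (fst x0) * Rabs (snd (dir l)) <= Rabs (fst x0) * 1) by now apply Rmult_le_compat_l.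
    assert (Rabs (snd x0) * Rabs (fst (dir l)) <= Rabs (snd x0) * 1) by now apply Rmult_le_compat_l.
    lra. }
  (* the base point is [k] times the normal direction *)
  assert (E : fst (base l) = k * - snd (dir l) /\ snd (base l) = k * fst (dir l)).
  { unfold k, o, offset, line_coords; destruct l as [[b1 b2] [d1 d2] Hd Hb]; simpl in *.
    unfold dot in *; simpl in *; split; apply Rminus_diag_uniq.
    - transitivity (b1 * (1 - (d1 * d1 + d2 * d2)) + d1 * (b1 * d1 + b2 * d2));
        [ring | rewrite Hd, Hb; ring].
    - transitivity (b2 * (1 - (d1 * d1 + d2 * d2)) + d2 * (b1 * d1 + b2 * d2));
        [ring | rewrite Hd, Hb; ring]. }
  destruct E as [-> ->]; rewrite !Rabs_mult, Rabs_Ropp.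
  pose proof (Rabs_pos k); pose proof (Rabs_pos (fst (dir l))); pose proof (Rabs_pos (snd (dir l))).
  split; nra.
Qed.

Lemma test_on_lines h : near_point h -> test_lines_in (meets V) (on_lines h).
Proof.
  intros Hh; split; [|split].
  - change (smooth (pullback (on_lines h))); rewrite pullback_on_lines by exact Hh; apply Hh.
  - set (B := delta + Rabs (fst x0) + Rabs (snd x0)).
    assert (HB : 0 < B) by (pose proof (Rabs_pos (fst x0)); pose proof (Rabs_pos (snd x0)); unfold B; lra).
    exists ((0, 0), (0, 0)), ((B + 1 + 1) + 1); intros q Hq.
    destruct (Hq (mkposreal 1 Rlt_0_1)) as (y & Hy & l & <- & Hne).
    assert (Hl : Rabs (offset (line_coords l)) <= delta).
    { apply (support_offset h); [exact Hh|]; intros e; exists (line_coords l); split;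
        [apply ball_center | now exists l]. }
    destruct (near_line_bounded l Hl) as [A1 A2], (dir_le l) as [A3 A4]; fold B in A1, A2.
    apply ball_triangle with (line_coords l); [|now apply ball_sym].
    assert (Hb : forall x, Rabs x < B + 1 + 1 -> ball 0 (B + 1 + 1) x).
    { intros x Hx; change (Rabs (x - 0) < B + 1 + 1); now rewrite Rminus_0_r. }
    split; split; apply Hb; simpl; lra.
  - intros l Hl; now apply near_line_meets, (support_offset h).
Qed.

Definition ridge (p : plane) : R := dens delta (fst p - perp x0 (snd p)).

Lemma rsmooth_ridge : rsmooth ridge.
Proof.
  assert (S0 : rsmooth (fun p => fst p - perp x0 (snd p))).
  { apply (rsmooth_minus fst (fun p => perp x0 (snd p))); [exact (smooth_coord axis1)|].
    apply (rsmooth_plus (fun p => fst x0 * - sin (snd p)) (fun p => snd x0 * cos (snd p))).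
    - exact (rsmooth_mult _ _ (rsmooth_const _) (rsmooth_normal axis1)).
    - exact (rsmooth_mult _ _ (rsmooth_const _) (rsmooth_normal axis2)). }
  apply (rsmooth_comp (fun _ => True) bump
    (fun p => delta ^ 2 - (fst p - perp x0 (snd p)) ^ 2)); auto using bump_chain.
  apply rsmooth_minus; [apply rsmooth_const|]; simpl.
  apply rsmooth_mult; [exact S0|]; apply rsmooth_mult; [exact S0 | apply rsmooth_const].
Qed.

Lemma near_point_ridge : near_point (fun p => RtoC (ridge p)).
Proof.
  split; [apply rsmooth_ridge|]; split.
  - intros q Hq; unfold ridge; now rewrite dens_supp.
  - intros s a a' Haa; unfold ridge, perp; simpl; injection Haa as -> ->; reflexivity.
Qed.

Lemma backproj_ridge_avg y : delta ^ 2 < nsq x0 y ->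
  backproj (fun p => RtoC (ridge p)) y = RtoC (2 * avg delta 0 (nsq x0 y)).
Proof.
  intros Hy; rewrite <- backproj_ridge by (try exact Hy; lra).
  unfold backproj; rewrite <- CRInt_RtoC; [reflexivity|].
  intros a; apply (continuous_comp (fun a => perp y a - perp x0 a) (dens delta));
    [|apply dens_continuous].
  apply (ex_derive_continuous (K := R_AbsRing) (V := R_NormedModule)); unfold perp; auto_derive; trivial.
Qed.

(** The test function on lines is [D_s h], where the backprojection of [h] is
    the given derivative. *)
Lemma divergence_kills f : vcompact_distribution f -> vanishes_on_lines_meeting V (Xperp f) ->
  forall w, divergence f (iter_partial w (backproj (fun p => RtoC (ridge p)))) = RtoC 0.
Proof.
  intros Hf HX w.
  destruct (iter_backproj w _ near_point_ridge) as (h & Hh & ->).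
  assert (Hh1 := near_point_partial h Hh).
  assert (E := HX _ (test_on_lines _ Hh1)).
  rewrite (Xperp_divergence f _ h Hf (proj1 Hh)) in E by (symmetry; now apply pullback_on_lines).
  replace (divergence f (backproj h)) with (- - divergence f (backproj h))%C by ring.
  rewrite E; ring.
Qed.

End NearPoint.

(** In a small disc around a point of [V], the transform provides the averages
    [Havg] of the unique continuation theorem. *)
Lemma divergence_zero f V : vcompact_distribution f -> open V -> (exists x, V x) ->
  dist_zero_on V (divergence f) -> vanishes_on_lines_meeting V (Xperp f) ->
  dist_zero (divergence f).
Proof.
  intros Hf HVo [x0 Hx0] HdV HX.
  destruct (HVo x0 Hx0) as [rho Hrho].
  assert (Hr := cond_pos rho).
  assert (HV : forall p, nsq x0 p <= (rho / 2) ^ 2 -> V p).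
  { intros p Hp; apply Hrho.
    destruct (nsq_le_abs x0 (rho / 2) p ltac:(lra) Hp) as [A1 A2].
    split; [apply (Rle_lt_trans _ _ rho A1) | apply (Rle_lt_trans _ _ rho A2)]; lra. }
  apply (unique_continuation (divergence f) V x0 (rho / 2)); auto using cd_divergence; [lra|].
  intros delta Hd.
  set (Psi := backproj (fun p => RtoC (ridge x0 delta p))).
  assert (SPsi : smooth Psi) by (apply smooth_backproj, rsmooth_ridge).
  exists (fun p => (RtoC (/ 2) * Psi p)%C); split; [now apply smooth_scal|]; split.
  - intros w; rewrite iter_partial_scal, (cd_scal _ (cd_divergence f Hf)) by auto using smooth_iter.
    unfold Psi; rewrite (divergence_kills V x0 (rho / 2) delta Hd HV f Hf HX); ring.
  - intros p Hp; unfold Psi; rewrite (backproj_ridge_avg x0 (rho / 2)) by (unfold outer in Hp; nra).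
    rewrite <- RtoC_mult; f_equal; field.
Qed.

(** * Harmonic fields *)

Lemma wirt_monomial x0 c a b p : wirt c (fun q => (zcb x0 q ^ a * zc x0 q ^ b)%C) p =
  ((RtoC 1 - c * Ci) * (RtoC (INR a) * (zcb x0 p ^ pred a * zc x0 p ^ b)) +
   (RtoC 1 + c * Ci) * (RtoC (INR b) * (zcb x0 p ^ a * zc x0 p ^ pred b)))%C.
Proof.
  rewrite wirt_mult, !wirt_pow, wirt_zc, wirt_zcb by auto using smooth_pow, smooth_zc, smooth_zcb.
  ring.
Qed.

(** The equations [div f = 0] and [d f = 0] say that [D_1 + c D_2] annihilates
    [f_1 - c f_2] for [c = i] and [c = -i]. Every complex monomial is a
    multiple of such a derivative of a monomial, so both combinations kill all
    polynomials. *)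
Lemma closed_coclosed_zero f : vcompact_distribution f -> dist_zero (divergence f) ->
  dist_zero (exterior_d f) -> vdist_zero f.
Proof.
  intros Hf Hdiv Hd; assert (Hf' := Hf); destruct Hf' as [H1 H2].
  set (mono := fun a b p => (zcb (0, 0) p ^ a * zc (0, 0) p ^ b)%C).
  assert (Sm : forall a b, smooth (mono a b)).
  { intros; apply smooth_mult; apply smooth_pow; [apply smooth_zcb | apply smooth_zc]. }
  assert (HW : forall c phi, (c * c)%C = (- RtoC 1)%C -> smooth phi ->
    (fst f (wirt c phi) + - c * snd f (wirt c phi))%C = RtoC 0).
  { intros c phi Hc Sphi.
    pose proof (Hdiv phi Sphi) as E1; pose proof (Hd phi Sphi) as E2.
    unfold divergence, exterior_d, dist_partial in E1, E2; unfold wirt.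
    rewrite (cd_plus _ H1), (cd_plus _ H2), (cd_scal _ H1), (cd_scal _ H2)
      by auto using smooth_partial, smooth_scal.
    transitivity (- (- fst f (partial axis1 phi) + - snd f (partial axis2 phi))
       + c * (- snd f (partial axis1 phi) - - fst f (partial axis2 phi))
       - (c * c + RtoC 1) * snd f (partial axis2 phi))%C; [ring|].
    rewrite E1, E2, Hc; ring. }
  assert (HZ : forall c a b, (c * c)%C = (- RtoC 1)%C -> (c = Ci \/ c = (- Ci)%C) ->
    (fst f (mono a b) + - c * snd f (mono a b))%C = RtoC 0).
  { intros c a b Hc [-> | ->].
    - pose proof (HW Ci (mono (S a) b) Ci_sq (Sm _ _)) as E.
      replace (wirt Ci (mono (S a) b)) with (fun p => (RtoC (2 * INR (S a)) * mono a b p)%C) in E.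
      + rewrite (cd_scal _ H1), (cd_scal _ H2) in E by auto.
        assert (Hn : RtoC (2 * INR (S a)) <> RtoC 0)
          by (apply RtoC_neq_0; pose proof (not_0_INR (S a) ltac:(lia)); lra).
        transitivity (/ RtoC (2 * INR (S a)) * (RtoC (2 * INR (S a)) * fst f (mono a b) +
           - Ci * (RtoC (2 * INR (S a)) * snd f (mono a b))))%C; [field; exact Hn | rewrite E; ring].
      + apply functional_extensionality; intros p; unfold mono; rewrite wirt_monomial, Ci_sq.
        rewrite RtoC_mult; simpl pred; replace (RtoC 2) with (RtoC 1 + RtoC 1)%C
          by (rewrite <- RtoC_plus; f_equal; ring); ring.
    - pose proof (HW (- Ci)%C (mono a (S b)) Hc (Sm _ _)) as E.
      replace (wirt (- Ci) (mono a (S b))) with (fun p => (RtoC (2 * INR (S b)) * mono a b p)%C) in E.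
      + rewrite (cd_scal _ H1), (cd_scal _ H2) in E by auto.
        assert (Hn : RtoC (2 * INR (S b)) <> RtoC 0)
          by (apply RtoC_neq_0; pose proof (not_0_INR (S b) ltac:(lia)); lra).
        transitivity (/ RtoC (2 * INR (S b)) * (RtoC (2 * INR (S b)) * fst f (mono a b) +
           - - Ci * (RtoC (2 * INR (S b)) * snd f (mono a b))))%C; [field; exact Hn | rewrite E; ring].
      + apply functional_extensionality; intros p; unfold mono; rewrite wirt_monomial.
        replace (- Ci * Ci)%C with (RtoC 1) by (transitivity (- (Ci * Ci))%C; [rewrite Ci_sq|]; ring).
        rewrite RtoC_mult; simpl pred; replace (RtoC 2) with (RtoC 1 + RtoC 1)%C
          by (rewrite <- RtoC_plus; f_equal; ring); ring. }
  assert (HCi : (- Ci * - Ci)%C = (- RtoC 1)%C) by (transitivity (Ci * Ci)%C; [ring | apply Ci_sq]).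
  assert (H2n : RtoC 2 <> RtoC 0) by (apply RtoC_neq_0; lra).
  split; apply (complex_polynomials_dense (0, 0)); auto; intros a b;
    pose proof (HZ Ci a b Ci_sq (or_introl eq_refl)) as E1;
    pose proof (HZ (- Ci)%C a b HCi (or_intror eq_refl)) as E2;
    fold (mono a b); set (u1 := fst f (mono a b)) in *; set (u2 := snd f (mono a b)) in *.
  - transitivity (RtoC (/ 2) * ((u1 + - Ci * u2) + (u1 + - - Ci * u2)))%C.
    + transitivity ((RtoC (/ 2) + RtoC (/ 2)) * u1)%C; [|ring].
      rewrite <- RtoC_plus; replace (/ 2 + / 2) with 1 by field; ring.
    + rewrite E1, E2; ring.
  - transitivity (RtoC (/ 2) * Ci * ((u1 + - Ci * u2) + - (u1 + - - Ci * u2)))%C.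
    + transitivity (- (Ci * Ci) * ((RtoC (/ 2) + RtoC (/ 2)) * u2))%C; [|ring].
      rewrite <- RtoC_plus, Ci_sq; replace (/ 2 + / 2) with 1 by field; ring.
    + rewrite E1, E2; ring.
Qed.

(** * Vanishing of the transverse and longitudinal transforms *)

Theorem corollary1p8 :
  forall (f : vfunctional) (V : plane -> Prop),
    vcompact_distribution f ->
    open V ->
    (exists x : plane, V x) ->
    (dist_zero_on V (divergence f) ->
       (vanishes_on_lines_meeting V (Xperp f) <-> dist_zero (divergence f)))
    /\
    (dist_zero_on V (exterior_d f) ->
       dist_zero_on V (divergence f) ->
       vanishes_on_lines_meeting V (X1 f) ->
       vanishes_on_lines_meeting V (Xperp f) ->
       vdist_zero f).
Proof.
  intros f V Hf HV Hne; split.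
  - intros HdV; split.
    + intros HX; now apply (divergence_zero f V).
    + intros Hdiv psi [Hpsi _]; now apply Xperp_of_div_zero.
  - intros Hd Hdiv HX HXp.
    apply closed_coclosed_zero; [exact Hf | now apply (divergence_zero f V) |].
    (* [X1 f] is the transverse transform of the rotated field [(- f_2, f_1)],
       whose divergence is [- d f]; here [- f_2] is written [f_2 - 2 f_2], a linear
       combination of compactly supported distributions *)
    set (h := ((fun phi => (snd f phi + - (RtoC 1 + RtoC 1) * snd f phi)%C), fst f) : vfunctional).
    assert (Hh : vcompact_distribution h).
    { split; [|apply Hf]; apply cd_add_scal; apply Hf. }
    assert (E : forall phi, divergence h phi = (- exterior_d f phi)%C).
    { intros phi; unfold divergence, exterior_d, dist_partial, h; simpl; ring. }
    assert (Z : dist_zero (divergence h)).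
    { apply (divergence_zero h V); auto.
      - intros phi Hphi; rewrite E, (Hd phi Hphi); ring.
      - intros psi Hpsi; rewrite <- (HX psi Hpsi).
        unfold Xperp, X1, pairing, rotateB, h; simpl; ring. }
    intros phi Sphi; replace (exterior_d f phi) with (- divergence h phi)%C by (rewrite E; ring).
    rewrite (Z phi Sphi); ring.
Qed.
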